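(* The asymptotic law (as $n\to\infty$) of $\chi_t=\sum_{i=1}^{[tn]}u_{ii}$ with $t\in(0,1]$ is as follows: (1) For $O_n^*$ we get the squeezed complex Gaussian semigroup, i.e. the squeezed version of the complex Gaussian law of parameter $t$. (2) For $H_n^{(s)}$ we get the squeezed $s$-Bessel semigroup, i.e. the squeezed version of the $s$-Bessel law of parameter $t$.
   Context: $C(O_n^* )$ is the universal $C^*$-algebra generated by self-adjoint variables $u_{ij}$ ($1\le i,j\le n$) with $uu^t=u^tu=1$, where $u=(u_{ij})$, $u^t=(u_{ji})$, and with $abc=cba$ for all $a,b,c\in\{u_{ij}\}$. For $s\in\{2,3,\ldots,\infty\}$, $C(H_n^{(s)})$ is its quotient by the cubic relations $u_{ij}u_{ik}=u_{ji}u_{ki}=0$ (any $i$, any $j\neq k$) and the $s$-mixing relations $abab\ldots=baba\ldots$ (length $s$ words, any $a,b\in\{u_{ij}\}$); for $s=\infty$ the $s$-mixing relations disappear. Both define compact quantum groups with $\Delta(u_{ij})=\sum_k u_{ik}\otimes u_{kj}$, and laws are taken with respect to the Haar functional. The complex Gaussian law of parameter $t>0$ is the law of $x+iy$, where $x,y$ are independent (real, centered) Gaussian variables of parameter $t$. The $s$-Bessel law of parameter $t>0$ is the law of $\sum_{r=1}^s e^{2\pi i r/s}x_r$, where $x_1,\ldots,x_s$ are independent Poisson variables of parameter $t/s$; for $s=\infty$ it is understood as the limit of these laws as $s\to\infty$. Given a complex probability measure $\mu$, its squeezed version is the law of $\sqrt{zz^*}$, where $z$ follows the law $\mu$ (this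 does not depend on the choice of $z$).
   Formalization: The limit proved is the symmetrized squeezed law (law of ±√(zz* ) with independent uniform sign), as odd moments of χ_t vanish; and in the complex Gaussian law of parameter t, x and y have variance t/2, so E|z|²=t, since variance t would give 2t. Convergence is in moments. *)

(* Defs.v *)
From HB Require Import structures.
From mathcomp Require Import all_boot all_order all_algebra complex.
From mathcomp Require Import all_classical all_reals all_analysis measurable_realfun.

Set Implicit Arguments.
Unset Strict Implicit.
Unset Printing Implicit Defensive.

Import Order.TTheory GRing.Theory Num.Theory.
Import numFieldNormedType.Exports.

Local Open Scope classical_set_scope.
Local Open Scope ring_scope.
Local Open Scope complex_scope.

(** * Unital C*-algebras *)

(* A plain record rather than an HB structure: HB cannot join [algType] with the
   normed-module hierarchy, because both already meet in [numDomainType]. *)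
Record cstarAlg (R : realType) := CstarAlg {
  cstar_car :> algType R[i];
  star : cstar_car -> cstar_car;
  cnorm : cstar_car -> R;
  starK : involutive star;
  starD : forall x y, star (x + y) = star x + star y;
  starZ : forall (c : R[i]) x, star (c *: x) = c^* *: star x;
  starM : forall x y, star (x * y) = star y * star x;
  cnorm0_eq0 : forall x, cnorm x = 0 -> x = 0;
  cnormD_le : forall x y, cnorm (x + y) <= cnorm x + cnorm y;
  cnormZ : forall (c : R[i]) x, (cnorm (c *: x))%:C = `|c| * (cnorm x)%:C;
  cnormM_le : forall x y, cnorm (x * y) <= cnorm x * cnorm y;
  cnorm_star_mul : forall x, cnorm (star x * x) = cnorm x ^+ 2;
  cnorm_complete : forall x : nat -> cstar_car,
    (forall e : R, 0 < e -> exists N, forall m n, (N <= m)%N -> (N <= n)%N ->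
       cnorm (x m - x n) < e) ->
    exists l, forall e : R, 0 < e -> exists N, forall n, (N <= n)%N ->
       cnorm (x n - l) < e
}.

Section QuantumGroups.
Variable R : realType.

(* A set of relations between n * n variables, given by the matrices, over an
   arbitrary C*-algebra, that satisfy them. *)
Definition cstar_relations (n : nat) : Type :=
  forall A : cstarAlg R, 'M[A]_n -> Prop.

Definition is_star_hom (A B : cstarAlg R) (phi : {lrmorphism A -> B}) : Prop :=
  forall a, phi (star a) = star (phi a).

Definition is_universal n (rel : cstar_relations n)
    (A : cstarAlg R) (u : 'M[A]_n) : Prop :=
  rel A u /\
  forall (B : cstarAlg R) (v : 'M[B]_n), rel B v ->
    exists phi : {lrmorphism A -> B},
      [/\ is_star_hom phi,
          forall i j, phi (u i j) = v i j &
          forall psi : {lrmorphism A -> B}, is_star_hom psi ->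
            (forall i j, psi (u i j) = v i j) -> psi =1 phi].

(* Relations of C(O_n^star). *)
Definition Ostar_rel n : cstar_relations n := fun A u =>
  [/\ forall i j, star (u i j) = u i j,
      u *m u^T = 1%:M,
      u^T *m u = 1%:M &
      forall i1 j1 i2 j2 i3 j3,
        u i1 j1 * u i2 j2 * u i3 j3 = u i3 j3 * u i2 j2 * u i1 j1].

(* The word a b a b ... of length s. *)
Definition alt_word (A : cstarAlg R) (s : nat) (a b : A) : A :=
  \prod_(k < s) (if odd k then b else a).

(* Relations of C(H_n^(s)); [None] stands for s = oo. *)
Definition H_rel n (s : option nat) : cstar_relations n := fun A u =>
  [/\ Ostar_rel u,
      forall i j k, j != k -> u i j * u i k = 0,
      forall i j k, j != k -> u j i * u k i = 0 &
      if s is Some m then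
        forall i1 j1 i2 j2,
          alt_word m (u i1 j1) (u i2 j2) = alt_word m (u i2 j2) (u i1 j1)
      else True].

(* The monomial u_{i_1 j_1} ... u_{i_k j_k}. *)
Definition word (A : cstarAlg R) n (u : 'M[A]_n) k (i j : {ffun 'I_k -> 'I_n})
    : A :=
  \prod_(m < k) u (i m) (j m).

(* The Haar functional: the state h with
   (h (x) id) Delta = h(.) 1 = (id (x) h) Delta, evaluated on monomials, where
   Delta (word u i j) = \sum_l word u i l (x) word u l j.  As the u_ij are
   self-adjoint the monomials span a dense subspace, and states are bounded. *)
Record is_Haar (A : cstarAlg R) n (u : 'M[A]_n) (h : {scalar A}) : Prop := {
  Haar_one : h 1 = 1;
  Haar_pos : forall a, 0 <= h (star a * a);
  Haar_left : forall k (i j : {ffun 'I_k -> 'I_n}),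
    \sum_l h (word u i l) *: word u l j = (h (word u i j))%:A;
  Haar_right : forall k (i j : {ffun 'I_k -> 'I_n}),
    \sum_l h (word u l j) *: word u i l = (h (word u i j))%:A
}.

Definition truncated_char (A : cstarAlg R) n (u : 'M[A]_n) (t : R) : A :=
  \sum_(i < n | (i < Num.truncn (t * n%:R))%N) u i i.

End QuantumGroups.

(** * Laws; the complex plane is identified with R * R *)

Section Laws.
Variable R : realType.
Local Notation T := (measurableTypeR R).
Local Notation C := (T * T)%type.
Local Notation K := (R[i] : numFieldType).

Definition plane_add (p : C * C) : C := (p.1.1 + p.2.1, p.1.2 + p.2.2).

Lemma measurable_plane_add : measurable_fun setT plane_add.
Proof.
have m1 (f : C * C -> C) :
    measurable_fun setT f -> measurable_fun setT (fun p => (f p).1 : T).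
  by move=> mf; exact: measurableT_comp.
have m2 (f : C * C -> C) :
    measurable_fun setT f -> measurable_fun setT (fun p => (f p).2 : T).
  by move=> mf; exact: measurableT_comp.
by apply: measurable_fun_pair;
  apply: (@measurable_funD _ _ R); (apply: m1 || apply: m2).
Qed.

HB.instance Definition _ :=
  isMeasurableFun.Build _ _ _ _ plane_add measurable_plane_add.

(* k e^{2 i pi r / s} *)
Definition rotate (s r k : nat) : C :=
  (k%:R * cos (2 * pi * r%:R / s%:R), k%:R * sin (2 * pi * r%:R / s%:R)).

Lemma measurable_rotate s r : measurable_fun setT (rotate s r).
Proof. by []. Qed.

HB.instance Definition _ s r :=
  isMeasurableFun.Build _ _ _ _ (rotate s r) (@measurable_rotate s r).

(* sqrt (z z^star) *)
Definition modulus (z : C) : T := Num.sqrt (z.1 ^+ 2 + z.2 ^+ 2).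

Lemma measurable_modulus : measurable_fun setT modulus.
Proof.
apply: (@measurableT_comp _ _ _ _ _ _ (@Num.sqrt R)).
  by apply: continuous_measurable_fun; exact: sqrt_continuous.
by apply: (@measurable_funD _ _ R); exact: measurable_funX.
Qed.

HB.instance Definition _ :=
  isMeasurableFun.Build _ _ _ _ modulus measurable_modulus.

Definition apply_sign (p : T * bool) : T := if p.2 then p.1 else - p.1.

Lemma measurable_apply_sign : measurable_fun setT apply_sign.
Proof.
apply: measurable_fun_ifT => //; apply: (@measurable_funN _ _ R).
exact: measurable_fst.
Qed.

HB.instance Definition _ :=
  isMeasurableFun.Build _ _ _ _ apply_sign measurable_apply_sign.

(* Law of the sum of two independent complex variables of laws mu and nu. *)
Definition convolution (mu nu : probability C R) : probability C R :=
  distribution (mu \x nu : probability _ R)%E plane_add.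

(* Law of x + i y, with x and y independent centered Gaussian variables.  The
   real Gaussian law of parameter t is normalised as the density
   exp (- x^2 / t) / sqrt (pi t), i.e. variance t / 2, so that E |z|^2 = t, in
   accordance with h (chi_t ^ 2) = [t n] / n for O_n^star. *)
Definition complex_gaussian (t : R) : probability C R :=
  (normal_prob 0%R (Num.sqrt (t / 2)%R) \x
   normal_prob 0%R (Num.sqrt (t / 2)%R))%E.

(* Law of e^{2 i pi r / s} x with x Poisson of parameter t; the last argument
   of [poisson_prob] is a dummy. *)
Definition rotated_poisson (s r : nat) (t : R) : probability C R :=
  distribution (poisson_prob t 0 : probability nat R) (rotate s r).

(* Law of \sum_(1 <= r <= s) e^{2 i pi r / s} x_r with the x_r independent
   Poisson variables of parameter t / s. *)
Definition bessel (s : nat) (t : R) : probability C R :=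
  foldr (fun r mu => convolution (rotated_poisson s r (t / s%:R)) mu)
    (\d_((0, 0) : C) : probability C R) (iota 1 s).

Definition cvg_weakly (mu_ : nat -> probability C R) (mu : probability C R) :=
  forall f : R * R -> R, continuous f -> (exists M : R, forall z, `|f z| <= M) ->
    \int[mu_ k]_z f z @[k --> \oo] --> \int[mu]_z f z.

(* [None] stands for s = oo. *)
Definition is_bessel (s : option nat) (t : R) (mu : probability C R) : Prop :=
  if s is Some m then mu = bessel m t else cvg_weakly (bessel^~ t) mu.

(* Law of sqrt (z z^star) with z of law mu. *)
Definition squeezed (mu : probability C R) : probability T R :=
  distribution mu modulus.

(* Law of e x with x of law nu and e an independent uniform sign.  As u_ij |->
   - u_ij preserves the relations of O_n^star and H_n^(s), the odd moments of
   truncated characters vanish: their limits are symmetric laws, so the square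
   root of z z^star has to be taken with a random sign. *)
Definition symmetrized (nu : probability T R) : probability T R :=
  distribution (nu \x bernoulli_prob 2^-1%R : probability _ R)%E apply_sign.

(* The law of a self-adjoint element a is given by its moments h (a ^+ k). *)
Definition asymptotic_law (A : nat -> cstarAlg R)
    (h : forall n, {scalar (A n)}) (a : forall n, A n)
    (nu : probability T R) : Prop :=
  forall k : nat, nu.-integrable setT (fun x => (x ^+ k)%:E) /\
    (h n (a n ^+ k) : K) @[n --> \oo] --> ((\int[nu]_x (x ^+ k))%:C : K).

End Laws.

(* Main.v *)
(* If v is a unitary matrix (in the case of H_n^(s), a monomial one whose nonzero
   entries are s-th roots of unity, or any phases for s = oo), the matrices
   [[0, v_ij], [conj v_ij, 0]] satisfy the defining relations.  By universality and
   invariance of the Haar functional h, the words of odd length have h = 0, and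
   the array h(u_{i_1 j_1} ... u_{i_2m j_2m}), as a function of j, is fixed by
   v (x) conj v (x) ... (x) conj v.

   For O_n^star the fixed arrays are spanned by the m! pairings of the odd places
   with the even ones.  Their Gram matrix is n^m (1 + O(1/n)), so that
   h(chi_t^{2m}) tends to m! t^m.

   For H_n^(s) a nonzero value forces every fibre of j to contain, modulo s, as
   many odd places as even ones.  The mixing relations then turn words into
   products of the projections u_ij^2, and h(chi_t^{2m}) tends to the sum of
   t^|P| over the partitions P of the 2m places with blocks balanced modulo s.

   The same numbers are the moments E |z|^{2m}: by integration by parts for the
   Gaussian law, and because a sum of rotated Poisson variables has mixed
   cumulants t or 0 according as the block is balanced.  For s = oo, truncating
   |z|^{2m} carries the moments through the weak limit. *)
Require Import Defs.
From HB Require Import structures.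
From mathcomp Require Import all_boot all_order all_fingroup all_algebra complex.
From mathcomp Require Import ring lra zify.
Set Implicit Arguments.
Unset Strict Implicit.
Unset Printing Implicit Defensive.
Import Order.TTheory GRing.Theory Num.Theory.
Local Open Scope ring_scope.

(** * Words in half-commuting letters *)

(** Invariance comes from a single device: the homomorphism into the 2 x 2 matrices given by
    universality is applied to the left invariance identity of the Haar functional, which is then
    read at the entry (0,0). As universality quantifies over C*-algebras, these matrices have to be
    given their operator norm.

    Invariance restricts the shape of the array of values of h, and identities in the algebra then
    determine the values. For H_n^(s) the identity is that the products of the u_ij^2 with
    prescribed rows add up to 1; since h is constant on each kernel class of columns, its value on a
    balanced class is the inverse of a falling factorial. For O_n^star the identities form a linear
    system governed by the Gram matrix of the pairings. This matrix is never inverted: for n > m! an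
    a priori bound on the sum of the absolute values of the unknowns shows that only its diagonal
    matters in the limit.

    On the side of the Bessel laws, a sum over partitions is recognised by the recursion on the
    block of one chosen element; for the Poisson law this recursion comes from k p_k = lam
    p_(k-1). *)

Section HalfCommuting.
Variables (A : nzRingType) (L : eqType) (a : L -> A).
Hypothesis half_comm : forall x y z, a x * a y * a z = a z * a y * a x.

(* The word e_1 o_1 e_2 o_2 ... with the letters at odd places in [e] and those
   at even places in [o]. *)
Definition zword (e o : seq L) : A := \prod_(p <- zip e o) (a p.1 * a p.2).

Definition square (x : L) : A := a x * a x.

Lemma zword_cons x y e o : zword (x :: e) (y :: o) = a x * a y * zword e o.
Proof. by rewrite /zword /= big_cons. Qed.

Lemma zword_nil : zword [::] [::] = 1.
Proof. by rewrite /zword big_nil. Qed.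

Lemma square_comm x y : a y * square x = square x * a y.
Proof. by rewrite /square mulrA half_comm. Qed.

Lemma pair_swapr x y x' y' : a x * a y * (a x' * a y') = a x * a y' * (a x' * a y).
Proof. by rewrite -!mulrA (mulrA (a y)) half_comm -!mulrA. Qed.

Lemma pair_swapl x y x' y' : a x * a y * (a x' * a y') = a x' * a y * (a x * a y').
Proof. by rewrite mulrA half_comm -mulrA. Qed.

Lemma pair_comm x y x' y' : a x * a y * (a x' * a y') = a x' * a y' * (a x * a y).
Proof. by rewrite pair_swapl pair_swapr. Qed.

(** Half-commutation exchanges neighbouring letters of equal parity, so any letter at an even place
    can be brought to the front. Hence a word depends only on its two multisets of letters. *)
Lemma zword_frontr x e b o1 o2 : size (x :: e) = size (o1 ++ b :: o2) ->
  zword (x :: e) (o1 ++ b :: o2) = a x * a b * zword e (o1 ++ o2).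
Proof.
elim: o1 x e => [|c o1 IH] x e /=; first by rewrite zword_cons.
case: e => [|x' e] /= [sz]; first by rewrite size_cat addnS in sz.
rewrite !zword_cons IH /= ?sz// !mulrA.
by rewrite -(mulrA (a x * a c)) pair_swapr mulrA.
Qed.

Lemma zword_frontl y o b e1 e2 : size (y :: o) = size (e1 ++ b :: e2) ->
  zword (e1 ++ b :: e2) (y :: o) = a b * a y * zword (e1 ++ e2) o.
Proof.
elim: e1 y o => [|c e1 IH] y o /=; first by rewrite zword_cons.
case: o => [|y' o] /= [sz]; first by rewrite size_cat addnS in sz.
rewrite !zword_cons IH /= ?sz// !mulrA.
by rewrite -(mulrA (a c * a y)) pair_swapl !mulrA.
Qed.

Lemma perm_split (x : L) s s' : perm_eq (x :: s) s' ->
  exists s1 s2, s' = s1 ++ x :: s2 /\ perm_eq s (s1 ++ s2).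
Proof.
move=> p; have: x \in s' by rewrite -(perm_mem p) mem_head.
move=> xs'; case/splitPr: xs' p => s1 s2 p; exists s1, s2; split=> //.
by rewrite -(perm_cons x) (permPl p) -cat1s perm_catCA.
Qed.

Lemma zword_permr e o o' : size e = size o -> perm_eq o o' ->
  zword e o = zword e o'.
Proof.
elim: e o o' => [|x e IH] [|y o] o' //= => [_|[sz] p].
  by rewrite perm_sym => /perm_nilP->.
have [o1 [o2 [-> p2]]] := perm_split p.
rewrite zword_frontr /=; last first.
  by rewrite size_cat /= addnS -size_cat -(perm_size p2) sz.
by rewrite zword_cons (IH _ _ sz p2).
Qed.

Lemma zword_perml e e' o : size e = size o -> perm_eq e e' ->
  zword e o = zword e' o.
Proof.
elim: o e e' => [|x o IH] [|y e] e' //= => [_|[sz] p].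
  by rewrite perm_sym => /perm_nilP->.
have [o1 [o2 [-> p2]]] := perm_split p.
rewrite zword_frontl /=; last first.
  by rewrite size_cat /= addnS -size_cat -(perm_size p2) sz.
by rewrite zword_cons (IH _ _ sz p2).
Qed.

Lemma zword_cat e e' o o' : size e = size o ->
  zword (e ++ e') (o ++ o') = zword e o * zword e' o'.
Proof. by move=> sz; rewrite /zword zip_cat// big_cat. Qed.

Lemma zword_nseq n x y : zword (nseq n x) (nseq n y) = (a x * a y) ^+ n.
Proof.
elim: n => [|n IH]; first by rewrite zword_nil.
by rewrite zword_cons IH exprS.
Qed.

Definition alternate (s : nat) (x y : L) : A :=
  \prod_(k < s) (if odd k then a y else a x).

Lemma alternate_even n x y : alternate n.*2 x y = (a x * a y) ^+ n.
Proof.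
elim: n => [|n IH]; first by rewrite /alternate big_ord0.
rewrite doubleS /alternate !big_ord_recr /= odd_double /= -/(alternate _ _ _) IH.
by rewrite exprSr mulrA.
Qed.

Lemma alternate_odd n x y : alternate n.*2.+1 x y = (a x * a y) ^+ n * a x.
Proof.
by rewrite /alternate big_ord_recr /= odd_double -/(alternate _ _ _) alternate_even.
Qed.

Hypothesis cube : forall x, a x * a x * a x = a x.

Lemma square_idem x : square x * square x = square x.
Proof. by rewrite /square mulrA cube. Qed.

Lemma square_square_comm x y : square x * square y = square y * square x.
Proof. by rewrite [in LHS]/square -mulrA square_comm mulrA square_comm -mulrA. Qed.

Lemma mulr_pair_square x y : a x * a y * (a y * a x) = square x * square y.
Proof.
by rewrite mulrA -(mulrA (a x)) -/(square y) square_comm -mulrA square_square_comm.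
Qed.

Lemma mulr_squares_idem x y :
  (square x * square y) * (square x * square y) = square x * square y.
Proof.
rewrite mulrA -(mulrA (square x)) (square_square_comm y x) mulrA square_idem.
by rewrite -mulrA square_idem.
Qed.

Lemma mulr_squares_expS x y n : (square x * square y) ^+ n.+1 = square x * square y.
Proof.
by elim: n => [|n IH]; rewrite ?expr1// exprS IH mulr_squares_idem.
Qed.

(** (xy)^s is a product of two alternating words of length s. Mixing turns one of them around, and
    the factors then pair up as xyyx = x^2 y^2, an idempotent; [1 < s] keeps at least one such
    factor. *)
Lemma pair_expr_mixing s x y : (1 < s)%N ->
  alternate s x y = alternate s y x -> (a x * a y) ^+ s = square x * square y.
Proof.
have cxy : GRing.comm (a x * a y) (a y * a x) by exact: pair_comm.
rewrite -{1 2 3 4}(odd_double_half s); case: (odd s); rewrite ?add0n ?add1n => s1.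
  rewrite !alternate_odd => e.
  have yp n : a y * (a x * a y) ^+ n = (a y * a x) ^+ n * a y.
    elim: n => [|n IH]; first by rewrite !expr0 mulr1 mul1r.
    by rewrite exprSr mulrA IH exprSr !mulrA.
  have xp n : a x * (a x * a y) ^+ n = (a y * a x) ^+ n * a x.
    elim: n => [|n IH]; first by rewrite !expr0 mulr1 mul1r.
    by rewrite exprSr mulrA IH -mulrA (mulrA (a x)) half_comm exprSr !mulrA.
  rewrite -addnn -addnS exprD exprS -(mulrA (a x)) yp -e !mulrA.
  rewrite -(mulrA _ (a x)) xp mulrA -exprMn_comm// mulr_pair_square -mulrA -/(square x).
  case: s./2 s1 => // n _.
  rewrite -[RHS]mulrA -/(square y) mulr_squares_expS -mulrA (square_square_comm y).
  by rewrite mulrA square_idem.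
rewrite !alternate_even => e.
rewrite -addnn exprD {2}e -exprMn_comm// mulr_pair_square.
by case: s./2 s1 => // n _; rewrite mulr_squares_expS.
Qed.

Lemma squares_comm_prod x s :
  square x * (\prod_(c <- s) square c) = (\prod_(c <- s) square c) * square x.
Proof.
elim: s => [|c s IH]; first by rewrite big_nil mulr1 mul1r.
by rewrite big_cons mulrA square_square_comm -mulrA IH mulrA.
Qed.

Lemma prod_square_perm s s' : perm_eq s s' ->
  \prod_(c <- s) square c = \prod_(c <- s') square c.
Proof.
elim: s s' => [|c s IH] s' p.
  by move: p; rewrite perm_sym => /perm_nilP->.
have [s1 [s2 [-> p2]]] := perm_split p.
rewrite big_cons (IH _ p2) !big_cat big_cons /= mulrA squares_comm_prod.
by rewrite -mulrA.
Qed.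

Lemma prod_square_nseq n x : (0 < n)%N -> \prod_(c <- nseq n x) square c = square x.
Proof.
case: n => // n _; elim: n => [|n IH]; first by rewrite /= big_seq1.
by rewrite [nseq _ _]/= big_cons IH square_idem.
Qed.

Definition balanced_words (d : nat) (e o : seq L) :=
  forall c, count_mem c e = count_mem c o %[mod d].

Lemma perm_nseq (x : L) s n : (n <= count_mem x s)%N ->
  exists s', perm_eq s (nseq n x ++ s').
Proof.
move=> le; exists (nseq (count_mem x s - n) x ++ [seq c <- s | predC1 x c]).
rewrite catA -nseqD subnKC // -(perm_filterC (pred1 x)) perm_cat2r.
by have /all_pred1P -> := filter_all (pred1 x) s; rewrite size_filter.
Qed.

Definition mixing (s : option nat) :=
  if s is Some m then (1 < m)%N /\ (forall x y, alternate m x y = alternate m y x)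
  else True.

(** Reduction modulo 0 is the identity, so modulus 0 turns congruence into equality and represents s
    = oo. *)
Definition modulus_of (s : option nat) : nat := if s is Some m then m else 0%N.

(* In [x y x y ...] a letter common to both parities contributes a central
   square; once there is none left, all multiplicities are multiples of [s] and
   the mixing relation takes over. *)
Lemma zword_balanced s e o : mixing s ->
  size e = size o -> balanced_words (modulus_of s) e o ->
  zword e o = (\prod_(c <- e) square c) * (\prod_(c <- o) square c).
Proof.
move=> mix; have [n] := ubnP (size e); elim: n => // n IH in e o *.
move=> le_n sz bal.
have [/hasP[x xe xo]|/hasPn nox] := boolP (has (mem o) e).
  have [e' pe] : exists e', perm_eq e (x :: e').
    by exists (rem x e); exact: perm_to_rem.
  have [o' po] : exists o', perm_eq o (x :: o').
    by exists (rem x o); exact: perm_to_rem.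
  rewrite (zword_perml sz pe) (zword_permr _ po) -?(perm_size pe)//.
  rewrite (prod_square_perm pe) (prod_square_perm po) !big_cons zword_cons.
  have sz' : size e' = size o'.
    by apply: succn_inj; rewrite -(perm_size pe : _ = (size e').+1) sz (perm_size po).
  rewrite IH//.
  - rewrite -/(square x) -[RHS]mulrA (mulrA _ (square x)) -squares_comm_prod.
    by rewrite -(mulrA (square x)) (mulrA (square x) (square x)) square_idem !mulrA.
  - by move: le_n; rewrite (perm_size pe) /= ltnS.
  - move=> c; have := bal c; rewrite (seq.permP pe) (seq.permP po) /=.
    by move/eqP; rewrite eqn_modDl => /eqP.
case: e => [|x e] in sz bal le_n nox *.
  by move/esym/size0nil: sz => ->; rewrite zword_nil !big_nil mulr1.
case: o => // y o in sz bal nox *.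
(* For s = oo the multiplicities are equal, so the first letter of [e] would also occur in [o],
   which was just excluded. *)
case: s => [s|] in mix bal IH *; last first.
  have := bal x; rewrite !modn0 /= eqxx => xx.
  have: x \in y :: o by rewrite -has_pred1 has_count /= -xx.
  by have := nox x; rewrite mem_head => /(_ isT) /negP.
case: mix => s1 mix.
have cntx : count_mem x (y :: o) = 0%N.
  by apply/count_memPn; have := nox x (mem_head _ _).
have cnty : count_mem y (x :: e) = 0%N.
  apply/count_memPn; apply/negP => yin.
  by have := nox y yin; rewrite /= mem_head.
have sx : (s <= count_mem x (x :: e))%N.
  have := bal x; rewrite cntx mod0n => /eqP; rewrite -/(dvdn _ _) => dv.
  by apply: dvdn_leq dv; rewrite /= eqxx.
have sy : (s <= count_mem y (y :: o))%N.
  have := bal y; rewrite cnty mod0n => /esym/eqP; rewrite -/(dvdn _ _) => dv.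
  by apply: dvdn_leq dv; rewrite /= eqxx.
have [e' pe] := perm_nseq sx; have [o' po] := perm_nseq sy.
rewrite (zword_perml sz pe) (zword_permr _ po) -?(perm_size pe)//.
rewrite zword_cat ?size_nseq// zword_nseq.
rewrite (prod_square_perm pe) (prod_square_perm po) !big_cat /=.
have sz' : size e' = size o'.
  have := sz; rewrite (perm_size pe) (perm_size po) !size_cat !size_nseq.
  exact: addnI.
rewrite (IH e' o')//.
- rewrite (pair_expr_mixing s1 (mix x y)) !prod_square_nseq ?(ltnW s1)//.
  rewrite -(mulrA (square x)) -(mulrA (square x)); congr (_ * _).
  by rewrite (mulrA (square y)) squares_comm_prod -mulrA.
- move: le_n; rewrite (perm_size pe) size_cat size_nseq ltnS.
  by apply: leq_trans; rewrite -[X in (X < _)%N]add0n ltn_add2r ltnW.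
(* The s copies of [x] and of [y] split off do not change multiplicities modulo s. *)
- move=> c; have := bal c; rewrite (seq.permP pe) (seq.permP po) !count_cat.
  rewrite !count_nseq /= => h.
  rewrite -(modnMDl (c == x) (count_mem c e')) -(modnMDl (c == y) (count_mem c o')).
  by rewrite [X in _ = X %[mod _]]/= (eq_sym c x) (eq_sym c y).
Qed.

End HalfCommuting.

(** * Set partitions *)

Section SameKernel.
Variables (I X : finType).

Definition same_ker (f g : I -> X) := [forall i, forall j, (f i == f j) == (g i == g j)].

Lemma same_kerP (f g : I -> X) :
  reflect (forall i j, (f i == f j) = (g i == g j)) (same_ker f g).
Proof.
apply: (iffP forallP) => [fg i j|fg i]; first by have /forallP/(_ j)/eqP := fg i.
by apply/forallP => j; rewrite fg.
Qed.

Lemma same_ker_refl f : same_ker f f.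
Proof. exact/same_kerP. Qed.

(** The permutation grows along an enumeration of [I]: at a new value of [f] a transposition
    corrects the image, and equality of the kernels keeps it away from the images already fixed. *)
Lemma same_ker_perm (f g : I -> X) : same_ker f g ->
  exists s : {perm X}, forall i, g i = s (f i).
Proof.
move=> /same_kerP fg.
suff [s sP] : exists s : {perm X}, {in enum I, forall i, g i = s (f i)}.
  by exists s => i; apply: sP; rewrite mem_enum.
elim: (enum I) => [|i0 r [s sP]]; first by exists 1%g.
have [/hasP[i ir /eqP fi]|/hasPn nr] := boolP (has (fun i => f i == f i0) r).
  exists s => j; rewrite inE => /predU1P[->|/sP//].
  by rewrite -fi -sP//; apply/eqP; rewrite -fg fi.
exists (s * tperm (s (f i0)) (g i0))%g => j; rewrite inE permM.
move=> /predU1P[->|jr]; first by rewrite tpermL.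
have fj := nr j jr; rewrite tpermD; first exact: sP.
  by rewrite (inj_eq perm_inj) eq_sym.
by rewrite -(sP _ jr) -fg eq_sym.
Qed.

End SameKernel.

(** * The moment-cumulant formula over set partitions *)

Section PartitionSums.
Variables (T : finType) (K : comNzRingType).
Implicit Types (D B : {set T}) (P : {set {set T}}) (kappa : {set T} -> K).

Lemma prod_add_subsets (F G : T -> K) D :
  \prod_(e in D) (F e + G e) =
  \sum_(B : {set T} | B \subset D) (\prod_(e in B) F e) * \prod_(e in D :\: B) G e.
Proof.
have [k] := ubnP #|D|; elim: k => // k IH in D *; rewrite ltnS => le_k.
have [->|[x xD]] := set_0Vmem D.
  rewrite big_set0 (big_pred1 set0) => [|B]; last exact: subset0.
  by rewrite setD0 !big_set0 mulr1.
rewrite (big_setD1 x)//= IH; last first.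
  by apply: leq_trans le_k; rewrite [leqRHS](cardsD1 x) xD.
rewrite [RHS](bigID (fun B : {set T} => x \in B)) /= mulrDl; congr (_ + _).
  rewrite mulr_sumr [RHS](reindex_onto (fun B => x |: B) (fun B => B :\ x)) /=; last first.
    by move=> B /andP[_ xB]; rewrite setD1K.
  apply: eq_big => [B|B BD].
    rewrite subUset sub1set xD setU11 andbT /= subsetD1.
    congr (_ && _); apply/idP/eqP => [xB|<-]; first by rewrite setU1K.
    by rewrite setD11.
  have xB : x \notin B by move: BD; rewrite subsetD1 => /andP[].
  rewrite big_setU1//= -mulrA; congr (_ * (_ * _)).
  by apply: eq_bigl => e; rewrite !inE negb_or andbCA andbA.
rewrite mulr_sumr; apply: eq_big => [B|B BD]; first by rewrite subsetD1.
have xB : x \notin B by move: BD; rewrite subsetD1 => /andP[].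
rewrite mulrCA; congr (_ * _).
rewrite [RHS](big_setD1 x) /=; last by rewrite inE xB.
congr (_ * _); apply: eq_bigl => e; rewrite !inE.
by rewrite andbCA.
Qed.

(** The moment on [D] of variables with joint cumulants [kappa]. *)
Definition partition_sum kappa D : K :=
  \sum_(P : {set {set T}} | partition P D) \prod_(B in P) kappa B.

(* The moment-cumulant recursion: condition on the block of [x]. *)
Lemma partition_sum_rec kappa D x : x \in D ->
  partition_sum kappa D =
  \sum_(B : {set T} | (x \in B) && (B \subset D)) kappa B * partition_sum kappa (D :\: B).
Proof.
move=> xD; rewrite /partition_sum.
rewrite (partition_big (fun P => pblock P x)
  (fun B : {set T} => (x \in B) && (B \subset D))) /=; last first.
  move=> P PD; have xP : x \in cover P by rewrite (cover_partition PD).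
  by rewrite mem_pblock xP (partitionS PD) ?pblock_mem.
apply: eq_bigr => B /andP[xB BD]; rewrite mulr_sumr.
rewrite (reindex_onto (fun Q => B |: Q) (fun P => P :\ B)) /=; last first.
  move=> P /andP[PD /eqP PB]; rewrite setD1K// -PB pblock_mem//.
  by rewrite (cover_partition PD).
have notin Q : partition Q (D :\: B) -> B \notin Q.
  move=> QD; apply/negP => /(partitionS QD)/subsetP/(_ x xB).
  by rewrite inE xB.
rewrite [LHS](eq_bigl (fun Q => partition Q (D :\: B))) => [|Q].
  by apply: eq_bigr => Q QD; rewrite big_setU1 ?notin.
apply/idP/idP => [/andP[/andP[QD /eqP QB] /eqP QQ]|QD].
  by rewrite -QQ; apply: partitionD1 QD (setU11 _ _).
have BD0 : [disjoint B & D :\: B].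
  by rewrite disjoint_sym disjoints_subset subsetDr.
have B0 : B != set0 by apply/set0Pn; exists x.
have := partitionU1 QD B0 BD0.
have -> : B :|: D :\: B = D.
  apply/setP => y; rewrite !inE; case: (boolP (y \in B)) => //= yB.
  by rewrite (subsetP BD).
move=> QU; rewrite QU setU1K ?notin// eqxx andbT.
rewrite (def_pblock (partition_trivIset QU) _ xB) ?eqxx//.
exact: setU11.
Qed.

Lemma partition_sum_set0 kappa : partition_sum kappa set0 = 1.
Proof.
rewrite /partition_sum (big_pred1 set0) => [|P]; first by rewrite big_set0.
exact: partition_set0.
Qed.

(** Recognises a family of moments by its recursion alone; sums of independent variables, the
    Poisson laws and the Dirac mass all enter in this way. *)
Lemma partition_sum_unique kappa (f : {set T} -> K) : f set0 = 1 ->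
  (forall D x, x \in D -> f D =
     \sum_(B : {set T} | (x \in B) && (B \subset D)) kappa B * f (D :\: B)) ->
  forall D, f D = partition_sum kappa D.
Proof.
move=> f0 frec D; have [k] := ubnP #|D|; elim: k => // k IH in D *.
rewrite ltnS => le_k; have [->|[x xD]] := set_0Vmem D.
  by rewrite f0 partition_sum_set0.
rewrite (frec _ _ xD) (partition_sum_rec _ xD); apply: eq_bigr => B /andP[xB BD].
rewrite IH//; apply: leq_trans le_k; apply: proper_card.
apply/properP; split; first exact: subsetDl.
by exists x; rewrite // inE xB.
Qed.

(* The exponential formula: adding cumulants convolves moments. *)
Lemma partition_sumD kappa kappa' D :
  \sum_(B : {set T} | B \subset D) partition_sum kappa B * partition_sum kappa' (D :\: B) =
  partition_sum (fun B => kappa B + kappa' B) D.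
Proof.
set f := partition_sum kappa; set f' := partition_sum kappa'.
pose conv D := \sum_(B : {set T} | B \subset D) f B * f' (D :\: B).
rewrite -/(conv D); apply: partition_sum_unique => [|{}D x xD].
  rewrite /conv (big_pred1 set0) => [|B]; last exact: subset0.
  by rewrite setD0 /f /f' !partition_sum_set0 mulr1.
(* The two summands of the cumulant correspond to the side of the cut on which [x], hence its whole
   block, lies. *)
rewrite /conv (bigID (fun B : {set T} => x \in B)) /=.
under [RHS]eq_bigr do rewrite mulrDl.
rewrite big_split /=; congr (_ + _).
  transitivity (\sum_(B : {set T} | (B \subset D) && (x \in B))
     \sum_(C : {set T} | (x \in C) && (C \subset B)) kappa C * f (B :\: C) * f' (D :\: B)).
    by apply: eq_bigr => B /andP[BD xB]; rewrite /f (partition_sum_rec _ xB) mulr_suml.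
  rewrite (exchange_big_dep (fun C : {set T} => (x \in C) && (C \subset D))) /=; last first.
    by move=> B C /andP[BD xB] /andP[-> CB]; rewrite (subset_trans CB BD).
  apply: eq_bigr => C /andP[xC CD]; rewrite mulr_sumr.
  rewrite (reindex_onto (fun B => C :|: B) (fun B => B :\: C)) /=; last first.
    move=> B /andP[_ /andP[_ CB]]; apply/setP => y; rewrite !inE.
    by case: (boolP (y \in C)) => //= yC; rewrite (subsetP CB).
  apply: eq_big => [B|B /andP[_ /eqP CB]]; last first.
    by rewrite CB -mulrA setDDl.
  rewrite subUset CD inE xC subsetUl !andbT /= subsetD; congr (_ && _).
  rewrite setDUl setDv set0U; apply/eqP/idP => [<-|].
    by rewrite disjoints_subset setDE subsetIr.
  by move=> dBC; apply/setDidPl.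
transitivity (\sum_(B : {set T} | (B \subset D) && (x \notin B))
     \sum_(C : {set T} | (x \in C) && (C \subset D :\: B))
        f B * (kappa' C * f' (D :\: B :\: C))).
  apply: eq_bigr => B /andP[BD xB].
  by rewrite /f' (@partition_sum_rec _ (D :\: B) x) ?inE ?xB// mulr_sumr.
rewrite (exchange_big_dep (fun C : {set T} => (x \in C) && (C \subset D))) /=; last first.
  by move=> B C _ /andP[->] /subset_trans; apply; exact: subsetDl.
apply: eq_bigr => C /andP[xC CD]; rewrite mulr_sumr; apply: eq_big => [B|B _].
  rewrite xC !subsetD CD /= disjoint_sym.
  case: (boolP [disjoint B & C]) => dBC; rewrite ?andbF// !andbT.
  by rewrite (disjointFl dBC xC) andbT.
by rewrite mulrCA !setDDl setUC.
Qed.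

End PartitionSums.

(** * Functions with a prescribed kernel *)

Section KernelPartition.
Variables (T X : finType).
Implicit Types (f g : {ffun T -> X}) (P : {set {set T}}).

Definition ker_partition f : {set {set T}} := preim_partition f [set: T].

Lemma ker_partitionP f : partition (ker_partition f) [set: T].
Proof. exact: preim_partitionP. Qed.

Lemma mem_pblock_ker f x y : (y \in pblock (ker_partition f) x) = (f x == f y).
Proof.
rewrite /ker_partition /preim_partition pblock_equivalence_partition ?inE//.
by split=> // /eqP->.
Qed.

Lemma ker_partition_eq f g : (ker_partition f == ker_partition g) = same_ker f g.
Proof.
apply/eqP/same_kerP => [fg x y|fg]; first by rewrite -!mem_pblock_ker fg.
by apply: eq_in_imset => x _; apply/setP => y; rewrite !inE fg.
Qed.

(** A function with kernel [P] is an injection from the blocks of [P]. The range [S] is left free: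
    all indices serve to count the words of a class, the indices below the truncation those that
    occur in the character. *)
Lemma card_ker_partition P (S : {pred X}) : partition P [set: T] ->
  #|[pred f : {ffun T -> X} | (ker_partition f == P) && [forall x, f x \in S]]| =
  #|S| ^_ #|P|.
Proof.
move=> PT; pose D : finType := {B : {set T} | B \in P}.
have cov x : x \in cover P by rewrite (cover_partition PT) inE.
pose blk x : D := exist _ (pblock P x) (pblock_mem (cov x)).
have blk_ex (B : D) : exists x, blk x == B.
  have /set0Pn[x xB] := partition_neq0 PT (valP B).
  by exists x; apply/eqP/val_inj/(def_pblock (partition_trivIset PT) (valP B)).
pose rep B := xchoose (blk_ex B).
have repK B : blk (rep B) = B by exact/eqP/(xchooseP (blk_ex B)).
have kerP f : (ker_partition f == P) = [forall x, forall y, (f x == f y) == (blk x == blk y)].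
  rewrite -{1}(preim_partition_pblock PT).
  apply/eqP/'forall_'forall_eqP => [fP x y|fP].
    rewrite -mem_pblock_ker fP /preim_partition.
    rewrite pblock_equivalence_partition ?inE// => a b c _ _ _.
    by split=> // /eqP->.
  by apply: eq_in_imset => x _; apply/setP => y; rewrite !inE fP.
pose lift (g : {ffun D -> X}) : {ffun T -> X} := [ffun x => g (blk x)].
have lift_inj : injective lift.
  move=> g g' /ffunP gg; apply/ffunP => B.
  by have := gg (rep B); rewrite !ffunE repK.
have -> : #|P| = #|{: D}| by rewrite card_sig.
rewrite -card_inj_ffuns_on -(card_imset _ lift_inj).
apply: eq_card => f; rewrite inE kerP; apply/andP/imsetP => [[]|[g]].
  move=> /'forall_'forall_eqP fP /forallP fS.
  have ff x y : blk x = blk y -> f x = f y by move/eqP; rewrite -fP => /eqP.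
  exists [ffun B => f (rep B)]; last first.
    by apply/ffunP => x; rewrite !ffunE; apply: ff; rewrite repK.
  rewrite inE; apply/andP; split; first by apply/ffun_onP => B; rewrite ffunE.
  apply/injectiveP => B B'; rewrite !ffunE => e.
  have eB : blk (rep B) = blk (rep B') by apply/eqP; rewrite -fP; apply/eqP.
  exact: etrans (esym (repK B)) (etrans eB (repK B')).
rewrite inE => /andP[/ffun_onP gS /injectiveP gI] ->; split.
  by apply/'forall_'forall_eqP => x y; rewrite !ffunE (inj_eq gI).
by apply/forallP => x; rewrite ffunE.
Qed.

End KernelPartition.

From mathcomp Require Import all_classical all_reals all_analysis.
From mathcomp Require Import measurable_realfun.
Import numFieldNormedType.Exports.

Lemma cvgn_sum (K : numFieldType) (V : normedModType K) (I : Type) (r : seq I)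
    (P : pred I) (f : I -> nat -> V) (l : I -> V) :
  (forall i, P i -> f i n @[n --> \oo] --> l i)%classic ->
  (\sum_(i <- r | P i) f i n @[n --> \oo] --> \sum_(i <- r | P i) l i)%classic.
Proof.
by move=> fl; apply: cvg_big => //; exact: add_continuous.
Qed.

(** * Matrix algebras as C*-algebras *)

Section VectorNorm.
Local Open Scope complex_scope.
Variables (R : realType) (N : nat).
Local Notation C := R[i].
Implicit Types (v w : 'cV[C]_N) (x : 'M[C]_N).

(* Only the real part of the Hermitian product is needed. *)
Definition re_dot v w : R := complex.Re (\sum_i (v i 0)^* * w i 0).

Definition sqnorm v := re_dot v v.

Definition vnorm v := Num.sqrt (sqnorm v).

Lemma re_dotC v w : re_dot v w = re_dot w v.
Proof.
rewrite /re_dot !raddf_sum; apply: eq_bigr => i _.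
by case: (v i 0) (w i 0) => [a b] [c d] /=; ring.
Qed.

Lemma re_dotDl v w z : re_dot (v + w) z = re_dot v z + re_dot w z.
Proof.
rewrite /re_dot -raddfD -big_split /=; congr complex.Re.
by apply: eq_bigr => i _; rewrite mxE rmorphD mulrDl.
Qed.

Lemma re_dotDr v w z : re_dot z (v + w) = re_dot z v + re_dot z w.
Proof. by rewrite re_dotC re_dotDl !(re_dotC _ z). Qed.

Lemma re_dotZl (r : R) v w : re_dot (r%:C *: v) w = r * re_dot v w.
Proof.
rewrite /re_dot !raddf_sum mulr_sumr; apply: eq_bigr => i _.
by rewrite mxE; case: (v i 0) (w i 0) => [a b] [c d] /=; ring.
Qed.

Lemma re_dotZr (r : R) v w : re_dot w (r%:C *: v) = r * re_dot w v.
Proof. by rewrite re_dotC re_dotZl re_dotC. Qed.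

Lemma sqnormE v : sqnorm v =
  \sum_i (complex.Re (v i 0) ^+ 2 + complex.Im (v i 0) ^+ 2).
Proof.
rewrite /sqnorm /re_dot raddf_sum; apply: eq_bigr => i _.
by case: (v i 0) => [a b] /=; ring.
Qed.

Lemma sqnorm_ge0 v : 0 <= sqnorm v.
Proof. by rewrite sqnormE sumr_ge0// => i _; rewrite addr_ge0 ?sqr_ge0. Qed.

Lemma entry_le_sqnorm v i :
  complex.Re (v i 0) ^+ 2 + complex.Im (v i 0) ^+ 2 <= sqnorm v.
Proof.
rewrite sqnormE (bigD1 i)//= lerDl sumr_ge0// => j _.
by rewrite addr_ge0 ?sqr_ge0.
Qed.

Lemma sqnorm0_eq0 v : sqnorm v = 0 -> v = 0.
Proof.
move=> v0; apply/matrixP => i j; rewrite ord1 mxE.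
have := entry_le_sqnorm v i; rewrite v0.
case: (v i 0) => [a b] /= le0.
have : a ^+ 2 + b ^+ 2 == 0 by rewrite eq_le le0 addr_ge0 ?sqr_ge0.
by rewrite paddr_eq0 ?sqr_ge0// !sqrf_eq0 => /andP[/eqP-> /eqP->].
Qed.

Lemma sqnormZ (c : C) v :
  sqnorm (c *: v) = (complex.Re c ^+ 2 + complex.Im c ^+ 2) * sqnorm v.
Proof.
rewrite !sqnormE mulr_sumr; apply: eq_bigr => i _.
by rewrite mxE; case: c (v i 0) => [a b] [x y] /=; ring.
Qed.

Lemma re_dot_CauchySchwarz v w : re_dot v w ^+ 2 <= sqnorm v * sqnorm w.
Proof.
have [w0|] := eqVneq (sqnorm w) 0.
  rewrite (sqnorm0_eq0 w0); have -> : (0 : 'cV[C]_N) = (0 : R)%:C *: 0.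
    by rewrite scaler0.
  by rewrite re_dotZr mul0r expr0n /= mulr_ge0 ?sqnorm_ge0.
rewrite neq_lt ltNge sqnorm_ge0 /= => w0.
(* Up to the factor [sqnorm w], this vector is the component of [v] orthogonal to [w] for the real
   scalar product. *)
have := sqnorm_ge0 ((sqnorm w)%:C *: v + (- re_dot v w)%:C *: w).
rewrite /sqnorm re_dotDl !re_dotDr !re_dotZl !re_dotZr -!/(sqnorm _).
rewrite (re_dotC w v) => h.
have : 0 <= sqnorm w * (sqnorm v * sqnorm w - re_dot v w ^+ 2).
  by apply: le_trans h _; rewrite le_eqVlt; apply/orP; left; apply/eqP; ring.
by rewrite pmulr_rge0// subr_ge0.
Qed.

Lemma vnorm_ge0 v : 0 <= vnorm v.
Proof. exact: sqrtr_ge0. Qed.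

Lemma sqr_vnorm v : vnorm v ^+ 2 = sqnorm v.
Proof. by rewrite sqr_sqrtr// sqnorm_ge0. Qed.

Lemma re_dot_le v w : re_dot v w <= vnorm v * vnorm w.
Proof.
rewrite -sqrtrM ?sqnorm_ge0//; apply: le_trans (ler_norm _) _.
rewrite -sqrtr_sqr ler_sqrt ?re_dot_CauchySchwarz//.
by rewrite mulr_ge0 ?sqnorm_ge0.
Qed.

Lemma vnormD v w : vnorm (v + w) <= vnorm v + vnorm w.
Proof.
rewrite -(@ler_pXn2r _ 2) ?nnegrE ?vnorm_ge0 ?addr_ge0 ?vnorm_ge0//.
rewrite sqr_vnorm sqrrD !sqr_vnorm /sqnorm re_dotDl !re_dotDr (re_dotC w v).
rewrite -!/(sqnorm _); have := re_dot_le v w; lra.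
Qed.

Lemma vnorm0 : vnorm 0 = 0.
Proof.
rewrite /vnorm sqnormE big1 ?sqrtr0// => i _.
by rewrite mxE /= expr0n addr0.
Qed.

Lemma vnorm_eq0 v : vnorm v = 0 -> v = 0.
Proof. by move=> v0; apply: sqnorm0_eq0; rewrite -sqr_vnorm v0 expr0n. Qed.

Lemma vnormZ (c : C) v :
  vnorm (c *: v) = Num.sqrt (complex.Re c ^+ 2 + complex.Im c ^+ 2) * vnorm v.
Proof. by rewrite /vnorm sqnormZ sqrtrM// addr_ge0 ?sqr_ge0. Qed.

Lemma vnorm_sum I (r : seq I) (F : I -> 'cV[C]_N) :
  vnorm (\sum_(i <- r) F i) <= \sum_(i <- r) vnorm (F i).
Proof.
elim: r => [|i r IH]; first by rewrite !big_nil vnorm0.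
by rewrite !big_cons (le_trans (vnormD _ _))// lerD2l.
Qed.

Lemma entry_le_vnorm v i :
  Num.sqrt (complex.Re (v i 0) ^+ 2 + complex.Im (v i 0) ^+ 2) <= vnorm v.
Proof. by rewrite ler_sqrt ?entry_le_sqnorm// sqnorm_ge0. Qed.

Lemma vnorm_le_entries v :
  vnorm v <= \sum_i (`|complex.Re (v i 0)| + `|complex.Im (v i 0)|).
Proof.
set s := \sum_i _; suff [s0 vs] : 0 <= s /\ sqnorm v <= s ^+ 2.
  by rewrite -(@ler_pXn2r _ 2) ?nnegrE ?vnorm_ge0// sqr_vnorm.
rewrite /s sqnormE; elim/big_ind2: _ => [|a b c d [b0 ab] [d0 cd]|i _].
- by rewrite expr0n.
- split; first exact: addr_ge0.
  rewrite sqrrD addrAC (le_trans (lerD ab cd))// lerDl.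
  by rewrite pmulrn_lge0// mulr_ge0.
- split; first by rewrite addr_ge0.
  rewrite sqrrD !real_normK ?num_real// addrAC lerDl pmulrn_lge0//.
Qed.

End VectorNorm.

(** * The operator norm, its C*-identity and completeness *)

Section OperatorNorm.
Local Open Scope classical_set_scope.
Local Open Scope ring_scope.
Local Open Scope complex_scope.
Variables (R : realType) (N : nat).
Local Notation C := R[i].
Implicit Types (v w : 'cV[C]_N) (x y : 'M[C]_N).

Definition opnorm x : R :=
  sup [set r | exists v, vnorm v <= 1 /\ r = vnorm (x *m v)].

Lemma mulmx_colE x v : x *m v = \sum_j v j 0 *: col j x.
Proof.
apply/matrixP => i k; rewrite ord1 !mxE summxE; apply: eq_bigr => j _.
by rewrite !mxE mulrC.
Qed.

Lemma vnorm_mulmx_le_cols x v :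
  vnorm (x *m v) <= (\sum_j vnorm (col j x)) * vnorm v.
Proof.
rewrite mulmx_colE (le_trans (vnorm_sum _ _))// mulr_suml.
apply: ler_sum => j _; rewrite vnormZ mulrC ler_wpM2l ?vnorm_ge0//.
exact: entry_le_vnorm.
Qed.

Lemma vnorm_mulmx_le_opnorm x v : vnorm (x *m v) <= opnorm x * vnorm v.
Proof.
have [v0|] := eqVneq (vnorm v) 0.
  by rewrite v0 mulr0 (vnorm_eq0 v0) mulmx0 vnorm0.
rewrite neq_lt ltNge vnorm_ge0 /= => v0.
have vV : vnorm ((vnorm v)^-1%:C *: v) = 1.
  by rewrite vnormZ /= expr0n addr0 sqrtr_sqr gtr0_norm ?invr_gt0// mulVf ?gt_eqF.
rewrite -ler_pdivrMr//; apply: sup_upper_bound.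
  split; first by exists 0, 0; rewrite mulmx0 vnorm0.
  exists (\sum_j vnorm (col j x)) => _ [w [w1 ->]].
  rewrite (le_trans (vnorm_mulmx_le_cols _ _))// ler_piMr//.
  by rewrite sumr_ge0// => j _; exact: vnorm_ge0.
exists ((vnorm v)^-1%:C *: v); split; first by rewrite vV.
rewrite -scalemxAr vnormZ /= expr0n addr0 sqrtr_sqr gtr0_norm ?invr_gt0//.
by rewrite mulrC.
Qed.

Lemma opnorm_le x K : (forall v, vnorm (x *m v) <= K * vnorm v) -> 0 <= K ->
  opnorm x <= K.
Proof.
move=> xK K0; apply: ge_sup; first by exists 0, 0; rewrite mulmx0 vnorm0.
by move=> _ [v [v1 ->]]; rewrite (le_trans (xK v))// ler_piMr.
Qed.

Lemma opnorm_ge0 x : 0 <= opnorm x.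
Proof.
apply: sup_upper_bound; last by exists 0; rewrite mulmx0 vnorm0.
split; first by exists 0, 0; rewrite mulmx0 vnorm0.
exists (\sum_j vnorm (col j x)) => _ [w [w1 ->]].
rewrite (le_trans (vnorm_mulmx_le_cols _ _))// ler_piMr//.
by rewrite sumr_ge0// => j _; exact: vnorm_ge0.
Qed.

Lemma opnorm_le_cols x : opnorm x <= \sum_j vnorm (col j x).
Proof.
apply: opnorm_le => [v|]; first exact: vnorm_mulmx_le_cols.
by rewrite sumr_ge0// => j _; exact: vnorm_ge0.
Qed.

Lemma vnorm_col_le_opnorm x j : vnorm (col j x) <= opnorm x.
Proof.
have -> : col j x = x *m delta_mx j 0 by rewrite colE.
apply: le_trans (vnorm_mulmx_le_opnorm _ _) _.
suff -> : vnorm (delta_mx j 0 : 'cV[C]_N) = 1 by rewrite mulr1.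
rewrite /vnorm sqnormE (bigD1 j)//= big1 => [|i /negPf ij].
  by rewrite mxE !eqxx /= expr1n expr0n !addr0 sqrtr1.
by rewrite mxE ij /= expr0n addr0.
Qed.

Lemma opnorm0_eq0 x : opnorm x = 0 -> x = 0.
Proof.
move=> x0; apply/matrixP => i j; rewrite [RHS]mxE.
have /vnorm_eq0/matrixP/(_ i 0) : vnorm (col j x) = 0.
  by apply/eqP; rewrite eq_le vnorm_ge0 -x0 vnorm_col_le_opnorm.
by rewrite !mxE.
Qed.

Lemma opnormD_le x y : opnorm (x + y) <= opnorm x + opnorm y.
Proof.
apply: opnorm_le => [v|]; last by rewrite addr_ge0 ?opnorm_ge0.
rewrite mulmxDl (le_trans (vnormD _ _))// mulrDl.
by rewrite lerD ?vnorm_mulmx_le_opnorm.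
Qed.

Lemma opnormM_le x y : opnorm (x *m y) <= opnorm x * opnorm y.
Proof.
apply: opnorm_le => [v|]; last by rewrite mulr_ge0 ?opnorm_ge0.
rewrite -mulmxA (le_trans (vnorm_mulmx_le_opnorm _ _))// -mulrA.
by rewrite ler_wpM2l ?opnorm_ge0 ?vnorm_mulmx_le_opnorm.
Qed.

Lemma opnormZ (c : C) x : (opnorm (c *: x))%:C = `|c| * (opnorm x)%:C.
Proof.
rewrite normc_def -rmorphM; congr (_%:C).
set r := Num.sqrt _; have r0 : 0 <= r by exact: sqrtr_ge0.
have le (d : C) y : opnorm (d *: y) <=
    Num.sqrt (complex.Re d ^+ 2 + complex.Im d ^+ 2) * opnorm y.
  apply: opnorm_le => [v|]; last by rewrite mulr_ge0 ?sqrtr_ge0 ?opnorm_ge0.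
  by rewrite -scalemxAl vnormZ -mulrA ler_wpM2l ?sqrtr_ge0 ?vnorm_mulmx_le_opnorm.
apply/eqP; rewrite eq_le le /=.
have [->|r_neq0] := eqVneq r 0; first by rewrite mul0r opnorm_ge0.
have c0 : c != 0.
  by apply: contraNneq r_neq0 => c0; rewrite /r c0 /= expr0n addr0 sqrtr0.
have rV : Num.sqrt (complex.Re c^-1 ^+ 2 + complex.Im c^-1 ^+ 2) = r^-1.
  apply: (@complexI R); rewrite -normc_def fmorphV normfV; congr (_^-1).
  by rewrite normc_def.
(* The reverse inequality is the direct one for c^-1 and c x. *)
have := le c^-1 (c *: x); rewrite scalerA mulVf// scale1r rV.
by rewrite mulrC ler_pdivlMr 1?mulrC// lt_neqAle eq_sym r_neq0.
Qed.

Definition adjmx x : 'M[C]_N := map_mx conjc x^T.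

Lemma re_dot_adj x v w : re_dot (x *m v) w = re_dot v (adjmx x *m w).
Proof.
rewrite /re_dot; congr complex.Re.
under eq_bigr => i _ do rewrite mxE rmorph_sum mulr_suml.
rewrite exchange_big /=; apply: eq_bigr => j _.
rewrite mxE mulr_sumr; apply: eq_bigr => i _.
by rewrite !mxE rmorphM mulrCA mulrA.
Qed.

Lemma adjmxK : involutive adjmx.
Proof. by move=> x; apply/matrixP => i j; rewrite !mxE conjcK. Qed.

(** |x v|^2 is the real part of <v, x^* x v>, which Cauchy-Schwarz bounds by the norm of x^* x times
    |v|^2. *)
Lemma opnorm_le_mul_adj x : opnorm x ^+ 2 <= opnorm (adjmx x *m x).
Proof.
rewrite -[leRHS]sqr_sqrtr ?opnorm_ge0// ler_pXn2r ?nnegrE ?opnorm_ge0 ?sqrtr_ge0//.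
apply: opnorm_le => [v|]; last exact: sqrtr_ge0.
rewrite -(@ler_pXn2r _ 2) ?nnegrE ?vnorm_ge0 ?mulr_ge0 ?sqrtr_ge0 ?vnorm_ge0//.
rewrite exprMn (sqr_sqrtr (opnorm_ge0 _)) sqr_vnorm /sqnorm re_dot_adj mulmxA.
rewrite (le_trans (re_dot_le _ _))// mulrC expr2 mulrA.
by rewrite ler_wpM2r ?vnorm_ge0 ?vnorm_mulmx_le_opnorm.
Qed.

Lemma opnorm_adj_ge x : opnorm x <= opnorm (adjmx x).
Proof.
have [->|x0] := eqVneq (opnorm x) 0; first exact: opnorm_ge0.
have := le_trans (opnorm_le_mul_adj x) (opnormM_le _ _).
by rewrite expr2 ler_pM2r// lt_neqAle eq_sym x0 opnorm_ge0.
Qed.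

Lemma opnorm_star_mul x : opnorm (adjmx x *m x) = opnorm x ^+ 2.
Proof.
apply/eqP; rewrite eq_le opnorm_le_mul_adj andbT.
apply: le_trans (opnormM_le _ _) _; rewrite expr2; apply: ler_wpM2r.
  exact: opnorm_ge0.
by have := opnorm_adj_ge (adjmx x); rewrite adjmxK.
Qed.

Lemma real_cauchy_lim (r : nat -> R) :
  (forall e : R, 0 < e -> exists n0, forall m n, (n0 <= m)%N -> (n0 <= n)%N ->
     `|r m - r n| < e) -> r @ \oo --> lim (r @ \oo).
Proof.
move=> rc; apply/cauchy_cvgP/cauchy_exP => e e0.
have [n0 rn] := rc e e0; exists (r n0).
by exists n0 => // n len /=; rewrite -ball_normE /=; apply: rn.
Qed.

Lemma normr_le_sqrt (a b : R) :
  `|a| <= Num.sqrt (a ^+ 2 + b ^+ 2) /\ `|b| <= Num.sqrt (a ^+ 2 + b ^+ 2).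
Proof.
by rewrite -!sqrtr_sqr !ler_sqrt ?addr_ge0 ?sqr_ge0// lerDl lerDr !sqr_ge0.
Qed.

(** The operator norm dominates the real and imaginary parts of each entry and is dominated by the
    sum of their absolute values, so completeness is that of the reals, entry by entry. *)
Lemma opnorm_complete (x : nat -> 'M[C]_N) :
  (forall e : R, 0 < e -> exists n0, forall m n, (n0 <= m)%N -> (n0 <= n)%N ->
     opnorm (x m - x n) < e) ->
  exists l, forall e : R, 0 < e -> exists n0, forall n, (n0 <= n)%N ->
     opnorm (x n - l) < e.
Proof.
move=> xc.
have le_op y i j : `|complex.Re (y i j)| <= opnorm y /\
                   `|complex.Im (y i j)| <= opnorm y.
  have [le1 le2] := normr_le_sqrt (complex.Re (y i j)) (complex.Im (y i j)).
  have := le_trans (entry_le_vnorm (col j y) i) (vnorm_col_le_opnorm y j).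
  by rewrite mxE => h; split; [exact: le_trans le1 h|exact: le_trans le2 h].
pose l : 'M[C]_N := \matrix_(i, j)
  (lim ((fun n => complex.Re (x n i j)) @ \oo) +i*
   lim ((fun n => complex.Im (x n i j)) @ \oo)).
have cvRe i j : (fun n => complex.Re (x n i j)) @ \oo --> complex.Re (l i j).
  rewrite mxE /=; apply: real_cauchy_lim => e /xc[n0 xn]; exists n0 => m n lem len.
  apply: le_lt_trans (xn m n lem len).
  by have [+ _] := le_op (x m - x n) i j; rewrite !mxE raddfB.
have cvIm i j : (fun n => complex.Im (x n i j)) @ \oo --> complex.Im (l i j).
  rewrite mxE /=; apply: real_cauchy_lim => e /xc[n0 xn]; exists n0 => m n lem len.
  apply: le_lt_trans (xn m n lem len).
  by have [_ +] := le_op (x m - x n) i j; rewrite !mxE raddfB.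
pose d n := \sum_j \sum_i (`|complex.Re (x n i j) - complex.Re (l i j)| +
                           `|complex.Im (x n i j) - complex.Im (l i j)|).
have d0 : d n @[n --> \oo] --> (0 : R).
  have -> : (0 : R) = \sum_(j < N) \sum_(i < N) (0 + 0).
    by rewrite addr0 big1// => j _; rewrite big1.
  apply: cvgn_sum => j _; apply: cvgn_sum => i _; apply: cvgD.
    rewrite -(normr0 R); apply: cvg_norm; rewrite -(subrr (complex.Re (l i j))).
    by apply: cvgB; [exact: cvRe|exact: cvg_cst].
  rewrite -(normr0 R); apply: cvg_norm; rewrite -(subrr (complex.Im (l i j))).
  by apply: cvgB; [exact: cvIm|exact: cvg_cst].
exists l => e e0; move/cvgrPdist_lt: d0 => /(_ e e0)[n0 _ dn].
exists n0 => n /dn /=; rewrite sub0r normrN => ltd.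
apply: le_lt_trans (le_lt_trans (ler_norm _) ltd).
rewrite (le_trans (opnorm_le_cols _))//; apply: ler_sum => j _.
rewrite (le_trans (vnorm_le_entries _))//; apply: ler_sum => i _.
by rewrite !mxE !raddfB.
Qed.

End OperatorNorm.

Section MatrixAlgebra.
Local Open Scope complex_scope.
Variables (R : realType) (N : nat).

(** Target of the homomorphisms provided by universality; the model takes [N = 1], that is, 2 x 2
    matrices. *)
Definition matrix_cstar : cstarAlg R.
Proof.
apply: (@CstarAlg R ('M[R[i]]_N.+1 : algType R[i]) (@adjmx R N.+1) (@opnorm R N.+1)).
- exact: adjmxK.
- by move=> x y; rewrite /adjmx linearD /= map_mxD.
- by move=> c x; apply/matrixP => i j; rewrite !mxE rmorphM.
- by move=> x y; rewrite /adjmx -mulmxE trmx_mul map_mxM.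
- exact: opnorm0_eq0.
- exact: opnormD_le.
- exact: opnormZ.
- exact: opnormM_le.
- exact: opnorm_star_mul.
- exact: opnorm_complete.
Defined.

End MatrixAlgebra.

(** * The antidiagonal model and the invariance of the Haar functional *)

Section AntidiagonalModel.
Variable R : realType.
Local Notation C := R[i].
Local Notation M2 := (matrix_cstar R 1).

(* The antidiagonal matrix [[0, z], [conj z, 0]]; even products of such are of
   the form [dmx]. *)
Definition jmx (z : C) : M2 :=
  \matrix_(i, j) (if i == j then 0 else if i == 0 then z else z^*).

Definition dmx (z : C) : M2 :=
  \matrix_(i, j) (if i == j then if i == 0 then z else z^* else 0).

Lemma ord2P (P : 'I_2 -> Prop) : P 0 -> P 1 -> forall i, P i.
Proof.
move=> P0 P1 [[|[|//]] Hi]; [move: P0|move: P1]; congr P; exact: val_inj.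
Qed.

Lemma mulmx2E (x y : M2) i j :
  (x * y) i j = x i 0 * y 0 j + x i 1 * y 1 j.
Proof. by rewrite mxE big_ord_recl big_ord1; congr (_ + x i _ * y _ j); exact: val_inj. Qed.

Lemma jmxM a b : jmx a * jmx b = dmx (a * b^*).
Proof.
apply/matrixP; apply: ord2P; apply: ord2P; rewrite mulmx2E !mxE /=;
  rewrite ?(mulr0, mul0r, addr0, add0r)//.
by rewrite rmorphM /= conjCK.
Qed.

Lemma dmxM a b : dmx a * dmx b = dmx (a * b).
Proof.
apply/matrixP; apply: ord2P; apply: ord2P; rewrite mulmx2E !mxE /=;
  by rewrite ?(mulr0, mul0r, addr0, add0r) ?rmorphM.
Qed.

Lemma dmx_jmxM a b : dmx a * jmx b = jmx (a * b).
Proof.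
apply/matrixP; apply: ord2P; apply: ord2P; rewrite mulmx2E !mxE /=;
  by rewrite ?(mulr0, mul0r, addr0, add0r) ?rmorphM.
Qed.

Lemma dmx1 : dmx 1 = 1.
Proof.
change (dmx 1 = (1%:M : 'M[C]_2)).
by apply/matrixP; apply: ord2P; apply: ord2P; rewrite !mxE /= ?(rmorph0, rmorph1).
Qed.

Lemma dmx0 : dmx 0 = 0.
Proof.
by apply/matrixP; apply: ord2P; apply: ord2P; rewrite !mxE /= ?(rmorph0, rmorph1).
Qed.

Lemma dmx_sum I (r : seq I) (F : I -> C) :
  \sum_(i <- r) dmx (F i) = dmx (\sum_(i <- r) F i).
Proof.
elim: r => [|i r IH]; first by rewrite !big_nil dmx0.
rewrite !big_cons IH; apply/matrixP; apply: ord2P; apply: ord2P;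
  by rewrite !mxE /= ?addr0 ?rmorphD.
Qed.

Lemma star_jmx a : star (jmx a) = jmx a.
Proof.
apply/matrixP; apply: ord2P; apply: ord2P; rewrite !mxE //=.
- exact: conjc0.
- exact: conjcK.
- exact: conjc0.
Qed.

Lemma dmx_exp a n : dmx a ^+ n = dmx (a ^+ n).
Proof.
elim: n => [|n IH]; first by rewrite !expr0 dmx1.
by rewrite !exprS IH dmxM.
Qed.

Lemma prod_dmx I (r : seq I) (F : I -> C) :
  \prod_(i <- r) dmx (F i) = dmx (\prod_(i <- r) F i).
Proof.
elim: r => [|i r IH]; first by rewrite !big_nil dmx1.
by rewrite !big_cons IH dmxM.
Qed.

(** Three antidiagonal factors multiply to the antidiagonal matrix of a conj(b) c, which is
    symmetric in a and c. *)
Lemma jmx_half_comm a b c : jmx a * jmx b * jmx c = jmx c * jmx b * jmx a.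
Proof. by rewrite !jmxM !dmx_jmxM; congr jmx; ring. Qed.

Lemma prod_jmx_odd I (r : seq I) (F : I -> C) : odd (size r) ->
  (\prod_(i <- r) jmx (F i) : M2) 0 0 = 0.
Proof.
move=> odd_r; suff [w ->] : exists w, \prod_(i <- r) jmx (F i) = jmx w.
  by rewrite mxE.
have [n] := ubnP (size r).
elim: n => // n IH in r odd_r *; case: r odd_r => [|x [|y r]] //=.
  by exists (F x); rewrite big_seq1.
rewrite negbK ltnS => odd_r /ltnW /IH-/(_ odd_r)[w ww].
by rewrite !big_cons ww mulrA jmxM dmx_jmxM; eexists.
Qed.

(** Unitarity in the form that u u^t = 1 and u^t u = 1 take under [jmxM], where the second factor is
    conjugated. *)
Definition unitary_entries n (v : 'M[C]_n) :=
  (forall i j, \sum_k v i k * (v j k)^* = (i == j)%:R) /\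
  (forall i j, \sum_k v k i * (v k j)^* = (i == j)%:R).

Definition model_mx n (v : 'M[C]_n) : 'M[M2]_n := \matrix_(i, j) jmx (v i j).

Lemma model_Ostar n (v : 'M[C]_n) : unitary_entries v ->
  @Ostar_rel R n M2 (model_mx v).
Proof.
move=> [vr vc]; split.
- by move=> i j; rewrite mxE star_jmx.
- apply/matrixP => i j; rewrite !mxE.
  under eq_bigr do rewrite !mxE jmxM.
  by rewrite dmx_sum vr; case: (i == j); rewrite ?dmx0 ?dmx1.
- apply/matrixP => i j; rewrite !mxE.
  under eq_bigr do rewrite !mxE jmxM.
  by rewrite dmx_sum vc; case: (i == j); rewrite ?dmx0 ?dmx1.
- by move=> *; rewrite !mxE jmx_half_comm.
Qed.

Lemma alternate_jmx_even n (a b : C) :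
  alternate jmx n.*2 a b = dmx ((a * b^*) ^+ n).
Proof. by rewrite alternate_even jmxM dmx_exp. Qed.

Lemma alternate_jmx_odd n (a b : C) :
  alternate jmx n.*2.+1 a b = jmx ((a * b^*) ^+ n * a).
Proof. by rewrite alternate_odd jmxM dmx_exp dmx_jmxM. Qed.

Definition root_or_zero s (a : C) := a = 0 \/ a ^+ s = 1 /\ a * a^* = 1.

Lemma alternate_jmx s (a b : C) : (1 < s)%N ->
  root_or_zero s a -> root_or_zero s b ->
  alternate jmx s a b = alternate jmx s b a.
Proof.
rewrite -(odd_double_half s); move: (s./2) (odd s) => n [] /=;
  rewrite ?add1n ?add0n => n0 ha hb.
- rewrite !alternate_jmx_odd; congr jmx.
  have {}n0 : (0 < n)%N by case: n n0 {ha hb}.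
  case: ha => [->|[a1 aa]].
    by rewrite rmorph0 !(mul0r, mulr0) expr0n gtn_eqF// mul0r.
  case: hb => [->|[b1 bb]].
    by rewrite rmorph0 !(mul0r, mulr0) expr0n gtn_eqF// mul0r.
  (* The nonzero factor a^n b^n completes every conjugate to a squared modulus, which is 1, and
     leaves a^s on one side and b^s on the other; both are 1. *)
  apply: (@mulIf _ (a^+ n * b ^+ n)).
    by rewrite mulf_neq0// expf_neq0//;
      [apply: contra_eq_neq aa => ->|apply: contra_eq_neq bb => ->];
      rewrite mul0r eq_sym oner_eq0.
  have -> : (a * b^*) ^+ n * a * (a ^+ n * b ^+ n) = a ^+ n.*2.+1 * (b * b^*) ^+ n.
    by rewrite !exprMn exprS -addnn exprD; ring.
  have -> : (b * a^*) ^+ n * b * (a ^+ n * b ^+ n) = b ^+ n.*2.+1 * (a * a^*) ^+ n.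
    by rewrite !exprMn exprS -addnn exprD; ring.
  by rewrite a1 b1 aa bb.
- rewrite !alternate_jmx_even; congr dmx.
  have {}n0 : (0 < n)%N by case: n n0 {ha hb}.
  case: ha => [->|[a1 aa]].
    by rewrite rmorph0 !(mul0r, mulr0).
  case: hb => [->|[b1 bb]].
    by rewrite rmorph0 !(mul0r, mulr0).
  apply: (@mulIf _ (a^+ n * b ^+ n)).
    by rewrite mulf_neq0// expf_neq0//;
      [apply: contra_eq_neq aa => ->|apply: contra_eq_neq bb => ->];
      rewrite mul0r eq_sym oner_eq0.
  have -> : (a * b^*) ^+ n * (a ^+ n * b ^+ n) = a ^+ n.*2 * (b * b^*) ^+ n.
    by rewrite !exprMn -addnn exprD; ring.
  have -> : (b * a^*) ^+ n * (a ^+ n * b ^+ n) = b ^+ n.*2 * (a * a^*) ^+ n.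
    by rewrite !exprMn -addnn exprD; ring.
  by rewrite a1 b1 aa bb.
Qed.

Lemma model_H n s (v : 'M[C]_n) : unitary_entries v ->
  (forall i j k, j != k -> v i j * (v i k)^* = 0) ->
  (forall i j k, j != k -> v j i * (v k i)^* = 0) ->
  (if s is Some m then (1 < m)%N /\ forall i j, root_or_zero m (v i j) else True) ->
  @H_rel R n s M2 (model_mx v).
Proof.
move=> uv vr vc rs; split.
- exact: model_Ostar.
- by move=> i j k jk; rewrite !mxE jmxM vr// dmx0.
- by move=> i j k jk; rewrite !mxE jmxM vc// dmx0.
- case: s rs => // m [m1 rs] i1 j1 i2 j2; rewrite !mxE.
  exact: (alternate_jmx m1 (rs i1 j1) (rs i2 j2)).
Qed.

End AntidiagonalModel.

(** * The places of a word of even length as pairs with a parity *)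

Section Legs.
Variable m : nat.

Lemma leg_of_subproof (q : 'I_m.*2) : (q./2 < m)%N.
Proof. by rewrite ltn_half_double. Qed.

(** Places are numbered from 0 here: [false] marks the even numbers, which are the odd places of the
    overview and carry v rather than its conjugate. *)
Definition leg_of (q : 'I_m.*2) : 'I_m * bool :=
  (Ordinal (leg_of_subproof q), odd q).

Lemma place_subproof (p : 'I_m * bool) : (p.2 + p.1.*2 < m.*2)%N.
Proof. by case: p => [[r rm] []] /=; lia. Qed.

Definition place (p : 'I_m * bool) : 'I_m.*2 := Ordinal (place_subproof p).

Lemma placeK : cancel place leg_of.
Proof.
case=> [[r rm] b]; congr (_, _).
  by apply: val_inj; rewrite /= half_bit_double.
by rewrite /= oddD odd_double addbF oddb.
Qed.

Lemma leg_ofK : cancel leg_of place.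
Proof. by move=> q; apply: val_inj; rewrite /= odd_double_half. Qed.

Lemma prod_legs (A : pzSemiRingType) (F : 'I_m * bool -> A) :
  \prod_q F (leg_of q) = \prod_r (F (r, false) * F (r, true)).
Proof.
(* [F] is extended by 1 to all natural numbers, so that the induction on the length leaves it
   unchanged. *)
pose G r b := if insub r is Some r' then F (r', b) else 1.
have GE (r : 'I_m) b : G r b = F (r, b) by rewrite /G valK.
transitivity (\prod_(0 <= q < m.*2) G q./2 (odd q)).
  rewrite big_mkord; apply: eq_bigr => q _.
  by rewrite -(GE (Ordinal (leg_of_subproof q))).
transitivity (\prod_(0 <= r < m) (G r false * G r true)); last first.
  by rewrite big_mkord; apply: eq_bigr => r _; rewrite !GE.
elim: m => [|k IH]; first by rewrite !big_geq.
rewrite doubleS !big_nat_recr//= IH -mulrA odd_double /= doubleK.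
by rewrite uphalf_double.
Qed.

Definition of_legs (T : Type) (l : {ffun 'I_m * bool -> T}) : {ffun 'I_m.*2 -> T} :=
  [ffun q => l (leg_of q)].

Definition to_legs (T : Type) (i : {ffun 'I_m.*2 -> T}) : {ffun 'I_m * bool -> T} :=
  [ffun p => i (place p)].

Lemma of_legsK T : cancel (@of_legs T) (@to_legs T).
Proof. by move=> l; apply/ffunP => p; rewrite !ffunE placeK. Qed.

Lemma to_legsK T : cancel (@to_legs T) (@of_legs T).
Proof. by move=> l; apply/ffunP => p; rewrite !ffunE leg_ofK. Qed.

End Legs.

(** * From universality to invariance of the Haar functional *)

Section HaarInvariance.
Variables (R : realType) (n : nat) (rel : @cstar_relations R n).
Variables (A : cstarAlg R) (u : 'M[A]_n) (h : {scalar A}).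
Hypotheses (universal_u : is_universal rel u) (Haar_h : is_Haar u h).
Local Notation C := (R[i]%C).

Definition pword m (l l' : {ffun 'I_m * bool -> 'I_n}) : A :=
  \prod_r (u (l (r, false)) (l' (r, false)) * u (l (r, true)) (l' (r, true))).

Lemma word_of_legs m (l l' : {ffun 'I_m * bool -> 'I_n}) :
  word u (of_legs l) (of_legs l') = pword l l'.
Proof.
rewrite /word /pword -(prod_legs (fun p => u (l p) (l' p))).
by apply: eq_bigr => q _; rewrite !ffunE.
Qed.

(** Matrix coefficient of the alternating tensor product of v and conj v. *)
Definition model_weight (v : 'M[C]_n) m (l l' : {ffun 'I_m * bool -> 'I_n}) : C :=
  \prod_r (v (l (r, false)) (l' (r, false)) * (v (l (r, true)) (l' (r, true)))^*).

(** The homomorphism sending u to the model is applied to left invariance. The right-hand side is a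
    multiple of the unit, so its entry at (0,0) is the value of h. *)
Lemma Haar_model (v : 'M[C]_n) k (i j : {ffun 'I_k -> 'I_n}) :
  rel (model_mx v) ->
  \sum_l h (word u i l) * (\prod_q jmx (v (l q) (j q))) 0 0 = h (word u i j).
Proof.
move=> rel_v; have [_ /(_ _ _ rel_v)[phi [_ phiu _]]] := universal_u.
have /(congr1 phi) := Haar_left Haar_h i j.
rewrite linearZ rmorph1 raddf_sum => /(congr1 (fun x : 'M[C]_2 => x 0 0)) /=.
rewrite [RHS]mxE mxE eqxx mulr1 => <-.
rewrite summxE; apply: eq_bigr => l _.
rewrite linearZ [RHS]mxE; congr (_ * _).
rewrite rmorph_prod; congr ((_ : 'M[C]_2) 0 0).
by apply: eq_bigr => q _; rewrite -[RHS]/(phi (u (l q) (j q))) phiu mxE.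
Qed.

Lemma Haar_odd (v : 'M[C]_n) k (i j : {ffun 'I_k -> 'I_n}) :
  rel (model_mx v) -> odd k -> h (word u i j) = 0.
Proof.
move=> rel_v odd_k; rewrite -(Haar_model _ _ rel_v) big1// => l _.
rewrite (prod_jmx_odd (fun q => v (l q) (j q))) ?mulr0//.
by rewrite /index_enum -enumT size_enum_ord.
Qed.

Lemma Haar_invariant (v : 'M[C]_n) m (l l' : {ffun 'I_m * bool -> 'I_n}) :
  rel (model_mx v) ->
  \sum_w h (pword l w) * model_weight v w l' = h (pword l l').
Proof.
move=> rel_v; rewrite -word_of_legs -(Haar_model _ _ rel_v).
rewrite (reindex (@of_legs m _)) /=; last first.
  by exists (@to_legs m _) => x _; rewrite ?of_legsK ?to_legsK.
apply: eq_bigr => w _; rewrite word_of_legs; congr (_ * _).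
under [in RHS]eq_bigr do rewrite !ffunE.
rewrite (prod_legs (fun p => jmx (v (w p) (l' p)))).
under [in RHS]eq_bigr do rewrite jmxM.
by rewrite prod_dmx mxE.
Qed.

End HaarInvariance.

(** * Monomial invariance *)

Section UnitCircle.
Variable R : realType.
Local Notation C := (R[i]%C).

Definition expi (x : R) : C := Complex (cos x) (sin x).

Lemma expiD x y : expi (x + y) = expi x * expi y.
Proof.
rewrite /expi cosD sinD; apply/eqP.
by rewrite eq_complex /= eqxx addrC mulrC (mulrC (sin y)) eqxx.
Qed.

Lemma expi0 : expi 0 = 1.
Proof. by rewrite /expi cos0 sin0. Qed.

Lemma expiMn x k : expi (x *+ k) = expi x ^+ k.
Proof.
elim: k => [|k IH]; first by rewrite mulr0n expi0.
by rewrite mulrS expiD IH exprS.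
Qed.

Lemma expi_conj x : (expi x)^* = expi (- x).
Proof. by rewrite /expi cosN sinN. Qed.

Lemma expi_mul_conj x : expi x * (expi x)^* = 1.
Proof. by rewrite expi_conj -expiD subrr expi0. Qed.

Definition root_of_unity (d : nat) : C := expi (2 * pi / d%:R).

Lemma root_of_unity_mul_conj d : root_of_unity d * (root_of_unity d)^* = 1.
Proof. exact: expi_mul_conj. Qed.

(** Let 2y be the argument of a power below the d-th. Then 0 < y < pi, so sin y > 0, and cos 2y = 1
    is impossible. *)
Lemma root_of_unity_prim d : (0 < d)%N -> d.-primitive_root (root_of_unity d).
Proof.
move=> d0; have d0' : 0 < d%:R :> R by rewrite ltr0n.
have expd : root_of_unity d ^+ d = 1.
  have e : (2 * pi / d%:R) *+ d = pi *+ 2 :> R.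
    by rewrite -mulr_natr divfK ?gt_eqF// mulr_natl.
  by rewrite -expiMn e /expi cos2pi sin2pi.
apply/andP; split=> //; apply/forallP => -[i id] /=.
apply/eqP; rewrite unity_rootE; have [->|ineq] := eqVneq i.+1 d.
  by rewrite expd eqxx.
have {}id : (i.+1 < d)%N by rewrite ltn_neqAle ineq.
apply/negbTE; rewrite -expiMn; apply/eqP => -[ci _].
pose y : R := pi * i.+1%:R / d%:R.
have ey : (2 * pi / d%:R) *+ i.+1 = y *+ 2.
  by rewrite -mulr_natr -[RHS]mulr_natr /y; ring.
have y0 : 0 < sin y.
  apply: sin_gt0_pi; rewrite /y divr_gt0 ?mulr_gt0 ?pi_gt0 ?ltr0n//=.
  by rewrite ltr_pdivrMr// ltr_pM2l ?pi_gt0// ltr_nat.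
have := cos2Dsin2 y; move: ci; rewrite ey cos_mulr2n => c1 cs.
have : 0 < sin y ^+ 2 by rewrite exprn_gt0.
by move: c1 cs; move: (cos y ^+ 2) (sin y ^+ 2) => p q; lra.
Qed.

Lemma root_of_unity_expJ d p q : (0 < d)%N ->
  (root_of_unity d ^+ p * (root_of_unity d)^* ^+ q == 1) = (p == q %[mod d])%N.
Proof.
move=> d0; rewrite -(eq_prim_root_expr (root_of_unity_prim d0)).
have w0 : root_of_unity d ^+ q != 0.
  rewrite expf_neq0//; apply: contra_eq_neq (root_of_unity_mul_conj d) => ->.
  by rewrite mul0r eq_sym oner_eq0.
rewrite -(inj_eq (mulIf w0)) mul1r -mulrA -exprMn (mulrC _^*).
by rewrite root_of_unity_mul_conj expr1n mulr1.
Qed.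

End UnitCircle.

(** * Monomial matrices and the arrays they fix *)

Section Monomial.
Variables (R : realType) (n : nat).
Local Notation C := (R[i]%C).

Definition monomial_mx (s : {perm 'I_n}) (th : 'I_n -> C) : 'M[C]_n :=
  \matrix_(i, j) (if i == s j then th j else 0).

Lemma monomial_unitary s th : (forall j, th j * (th j)^* = 1) ->
  unitary_entries (monomial_mx s th).
Proof.
move=> th1; split=> i j.
  rewrite (bigD1 ((s^-1)%g i))//= big1 => [|k ki]; last first.
    rewrite !mxE ifN ?mul0r//; apply: contraNneq ki => ->.
    by rewrite permK.
  rewrite !mxE permKV eqxx addr0 (eq_sym j); case: eqP => _; first exact: th1.
  by rewrite rmorph0 mulr0.
rewrite (bigD1 (s i))//= big1 => [|k ki]; last first.
  by rewrite !mxE (negPf ki) mul0r.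
rewrite !mxE eqxx addr0 (inj_eq perm_inj); case: eqP => [<-|_].
  exact: th1.
by rewrite rmorph0 mulr0.
Qed.

Lemma monomial_row s th i j k : j != k ->
  monomial_mx s th i j * (monomial_mx s th i k)^* = 0.
Proof.
move=> jk; rewrite !mxE; case: eqP => [->|_]; last by rewrite mul0r.
by rewrite (inj_eq perm_inj) (negPf jk) rmorph0 mulr0.
Qed.

Lemma monomial_col s th i j k : j != k ->
  monomial_mx s th j i * (monomial_mx s th k i)^* = 0.
Proof.
move=> jk; rewrite !mxE; case: eqP => [ji|_]; last by rewrite mul0r.
by rewrite -ji (eq_sym k) (negPf jk) rmorph0 mulr0.
Qed.

Variable m : nat.
Local Notation multi := {ffun 'I_m * bool -> 'I_n}.

Definition invariant_under (v : 'M[C]_n) (g : multi -> C) :=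
  forall l', \sum_w g w * model_weight v w l' = g l'.

Definition mult (l : multi) b c := #|[pred r | l (r, b) == c]|.

Definition balanced d (l : multi) := forall c, mult l false c = mult l true c %[mod d].

Lemma monomial_invariant s th g (l' : multi) : invariant_under (monomial_mx s th) g ->
  g [ffun p => s (l' p)] * \prod_r (th (l' (r, false)) * (th (l' (r, true)))^*) = g l'.
Proof.
move=> /(_ l') <-; rewrite (bigD1 [ffun p => s (l' p)])//= [X in _ + X]big1 ?addr0 => [|w wl].
  congr (_ * _); apply: eq_bigr => r _; rewrite !mxE !ffunE !eqxx //.
suff [p wp] : exists p, w p != s (l' p).
  apply/eqP; rewrite mulf_eq0; apply/orP; right; case: p wp => r b wp.
  rewrite /model_weight (bigD1 r)//= !mxE; case: b wp => /negPf ->.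
    by rewrite rmorph0 mulr0 mul0r.
  by rewrite !mul0r.
apply/existsP; apply: contraNT wl => /existsPn wl.
by apply/eqP/ffunP => p; rewrite ffunE; apply/eqP; have := wl p; rewrite negbK.
Qed.

Lemma invariant_perm g (l l' : multi) : (forall s, invariant_under (monomial_mx s (fun=> 1)) g) ->
  same_ker l l' -> g l = g l'.
Proof.
move=> inv /same_ker_perm[s sP]; rewrite -(monomial_invariant l (inv s)).
rewrite big1 ?mulr1 => [|r _]; last by rewrite rmorph1 mulr1.
by congr g; apply/ffunP => p; rewrite ffunE -sP.
Qed.

Definition phase d (c j : 'I_n) : C := if j == c then root_of_unity R d else 1.

(** Turning the single coordinate c by a primitive d-th root of unity w multiplies g at l by w^p
    conj(w)^q, where p and q are the multiplicities of c on the two parities. *)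
Lemma invariant_balanced d g (l : multi) : (0 < d)%N ->
  (forall c, invariant_under (monomial_mx 1 (phase d c)) g) ->
  g l != 0 -> balanced d l.
Proof.
move=> d0 inv gl c; have := monomial_invariant l (inv c).
have -> : [ffun p => (1%g : {perm 'I_n}) (l p)] = l by apply/ffunP => p; rewrite ffunE perm1.
rewrite -[RHS]mulr1 => /(mulfI gl)/eqP; rewrite big_split /=.
have -> : \prod_i phase d c (l (i, false)) = root_of_unity R d ^+ mult l false c.
  by rewrite -big_mkcond prodr_const.
have -> : \prod_i (phase d c (l (i, true)))^* = (root_of_unity R d)^* ^+ mult l true c.
  rewrite -rmorph_prod -rmorphXn /=; congr (_^*).
  by rewrite -big_mkcond prodr_const.
by rewrite root_of_unity_expJ// => /eqP.
Qed.

Lemma phase_mul_conj d c j : phase d c j * (phase d c j)^* = 1.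
Proof. by rewrite /phase; case: ifP => _; rewrite ?root_of_unity_mul_conj// rmorph1 mulr1. Qed.

Lemma mult_le l b c : (mult l b c <= m)%N.
Proof. by rewrite -[leqRHS](card_ord m) max_card. Qed.

(** Multiplicities are at most m, so the modulus m + 1 already forces equality: roots of unity of
    finite order are enough for s = oo and for the full unitary group. *)
Lemma balanced0P l : balanced m.+1 l -> balanced 0 l.
Proof. by move=> bal c; have := bal c; rewrite !modn0 !modn_small ?ltnS ?mult_le. Qed.

End Monomial.

(** * Words and Haar values for H_n^(s) *)

Section HyperWords.
Variables (R : realType) (n : nat) (s : option nat) (A : cstarAlg R) (u : 'M[A]_n).
Hypothesis s_ge2 : if s is Some m then (2 <= m)%N else true.
Hypothesis u_rel : H_rel s u.
Local Notation letter := (fun c : 'I_n * 'I_n => u c.1 c.2).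
Local Notation sq := (square letter).
Local Notation multi m := {ffun 'I_m * bool -> 'I_n}.

Let half_comm x y z :
  letter x * letter y * letter z = letter z * letter y * letter x.
Proof. by case: u_rel => -[_ _ _ hc] _ _ _; exact: hc. Qed.

Lemma sum_square_row i : \sum_j sq (i, j) = 1.
Proof.
case: u_rel => -[_ uu _ _] _ _ _; have /matrixP/(_ i i) := uu.
rewrite !mxE eqxx => e; rewrite -[RHS]e.
by apply: eq_bigr => j _; rewrite mxE.
Qed.

(** Multiply by 1, written as the sum of u_ik^2 over k: the terms with k != j vanish by the cubic
    relations. *)
Let cube x : letter x * letter x * letter x = letter x.
Proof.
case: x => i j /=; case: u_rel => _ ur _ _.
rewrite -[RHS]mulr1 -(sum_square_row i) mulr_sumr (bigD1 j)//=.
rewrite big1 ?addr0 ?mulrA// => k kj.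
by rewrite /square /= mulrA ur 1?eq_sym// mul0r.
Qed.

Let mixing_u : mixing letter s.
Proof.
case: u_rel => _ _ _; case: s s_ge2 => // m m2 mix; split=> // x y.
exact: mix.
Qed.

Lemma square_row0 i j k : j != k -> sq (i, j) * sq (i, k) = 0.
Proof.
case: u_rel => _ ur _ _ jk.
by rewrite /square /= mulrA -(mulrA (u i j)) ur// mulr0 mul0r.
Qed.

Lemma square_col0 i j k : j != k -> sq (j, i) * sq (k, i) = 0.
Proof.
case: u_rel => _ _ uc _ jk.
by rewrite /square /= mulrA -(mulrA (u j i)) uc// mulr0 mul0r.
Qed.

Definition square_word m (l l' : multi m) : A := \prod_p sq (l p, l' p).

Lemma sum_square_word m (l : multi m) : \sum_l' square_word l l' = 1.
Proof.
rewrite /square_word -(bigA_distr_bigA (fun p j => sq (l p, j))).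
by rewrite big1// => p _; exact: sum_square_row.
Qed.

Lemma square_word_eq0 m (l l' : multi m) : ~~ same_ker l l' -> square_word l l' = 0.
Proof.
move=> /same_kerP/existsNP[p /existsNP[q /eqP pq]].
have qp : q != p by apply: contraNneq pq => ->; rewrite !eqxx.
have perm_pq : perm_eq (index_enum ('I_m * bool)%type)
    [:: p, q & rem q (rem p (index_enum ('I_m * bool)%type))].
  apply: perm_trans (perm_to_rem (mem_index_enum p)) _.
  by rewrite perm_cons perm_to_rem// mem_rem_uniq ?index_enum_uniq// inE qp mem_index_enum.
rewrite /square_word -(big_map (fun p => (l p, l' p)) predT (fun c => sq c)).
rewrite (prod_square_perm half_comm (perm_map _ perm_pq)) /= !big_cons mulrA.
suff -> : sq (l p, l' p) * sq (l q, l' q) = 0 by rewrite mul0r.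
case: (eqVneq (l p) (l q)) pq => [->|lpq]; case: (eqVneq (l' p) (l' q)) => [e|ne] // _.
  exact: square_row0.
by rewrite e; exact: square_col0.
Qed.

(** With equal kernels the letter at a place is determined by its row index, so letters have the
    multiplicities of [l] and balance of [l] passes to the word. *)
Lemma pword_square m (l l' : multi m) : balanced (modulus_of s) l ->
  same_ker l l' -> pword u l l' = square_word l l'.
Proof.
move=> bal /same_kerP ll.
pose e b := [seq (l (r, b), l' (r, b)) | r <- enum 'I_m].
transitivity (zword letter (e false) (e true)).
  by rewrite /pword /zword /e zip_map big_map /index_enum -enumT.
have cnt b c : count_mem c (e b) = #|[pred r | (l (r, b), l' (r, b)) == c]|.
  rewrite count_map -sum1_count -sum1_card /index_enum -enumT.
  by apply: eq_bigl => r; rewrite inE.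
rewrite (zword_balanced half_comm cube mixing_u).
- rewrite -big_cat /= /square_word -(big_map (fun p => (l p, l' p)) predT (fun c => sq c)).
  apply: prod_square_perm => //.
  pose f (b : bool) (r : 'I_m) := (r, b).
  have -> : e false ++ e true = [seq (l p, l' p) |
      p <- [seq f false r | r <- enum 'I_m] ++ [seq f true r | r <- enum 'I_m]].
    by rewrite map_cat; congr (_ ++ _); rewrite -map_comp.
  apply: perm_map; apply: uniq_perm; rewrite ?index_enum_uniq//.
    have injf b : injective (f b) by move=> x y [].
    rewrite cat_uniq !(map_inj_uniq (injf _)) !enum_uniq.
    by rewrite andbT; apply/hasPn => _ /mapP[r _ ->]; apply/mapP => -[].
  move=> [r b]; rewrite mem_index_enum mem_cat; apply/orP.
  by case: b; [right|left]; apply/mapP; exists r; rewrite // mem_enum.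
- by rewrite !size_map.
- move=> [c c']; rewrite !cnt.
  have [/existsP[p /eqP pc]|/existsPn no] := boolP [exists p, (l p, l' p) == (c, c')].
    have eb b : #|[pred r | (l (r, b), l' (r, b)) == (c, c')]| = mult l b c.
      apply: eq_card => r; rewrite !inE; case: pc => <- <-.
      by rewrite xpair_eqE -ll andbb.
    by rewrite !eb; exact: bal.
  have eb b : #|[pred r | (l (r, b), l' (r, b)) == (c, c')]| = 0%N.
    by apply: eq_card0 => r; rewrite !inE; apply: negbTE; exact: no.
  by rewrite !eb.
Qed.

Variable h : {scalar A}.
Hypotheses (universal_u : is_universal (@H_rel R n s) u) (Haar_h : is_Haar u h).

Lemma rel_monomial (sg : {perm 'I_n}) (th : 'I_n -> (R[i]%C)) :
  (forall j, th j * (th j)^* = 1) ->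
  (if s is Some m then forall j, th j ^+ m = 1 else True) ->
  @H_rel R n s _ (model_mx (monomial_mx sg th)).
Proof.
move=> th1 ths; apply: model_H.
- exact: monomial_unitary.
- exact: monomial_row.
- exact: monomial_col.
- case: s s_ge2 ths => // m m2 ths; split=> // i j; rewrite !mxE.
  by case: eqP => _; [right|left].
Qed.

Lemma rel_perm (sg : {perm 'I_n}) :
  @H_rel R n s _ (model_mx (monomial_mx sg (fun=> 1))).
Proof.
apply: rel_monomial => [j|]; first by rewrite rmorph1 mulr1.
by case: s => // m _; rewrite expr1n.
Qed.

Lemma Haar_same_ker m (l0 l l' : multi m) : same_ker l l' ->
  h (pword u l0 l) = h (pword u l0 l').
Proof.
apply: (@invariant_perm _ _ _ (fun l => h (pword u l0 l))) => sg w.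
exact: (Haar_invariant universal_u Haar_h _ _ (rel_perm sg)).
Qed.

Lemma Haar_balanced m (l0 l : multi m) : h (pword u l0 l) != 0 ->
  balanced (modulus_of s) l.
Proof.
pose d := if s is Some d then d else m.+1.
have d0 : (0 < d)%N by rewrite /d; case: s s_ge2 => // k; exact: ltnW.
have := @invariant_balanced _ _ _ d (fun l => h (pword u l0 l)) l d0.
move=> H /H; have {H} : forall c,
    invariant_under (monomial_mx 1 (phase R d c)) (fun l => h (pword u l0 l)).
  move=> c w; apply: (Haar_invariant universal_u Haar_h _ _ (rel_monomial _ _ _)) => [j|].
    exact: phase_mul_conj.
  rewrite /d; case: s s_ge2 => // k k2 j; rewrite /phase; case: ifP => _.
    by rewrite prim_expr_order// root_of_unity_prim// ltnW.
  by rewrite expr1n.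
by rewrite /d; case: s => [k|] H /(_ H)// => /balanced0P.
Qed.

(** Invariance under permutations makes h constant over the [l'] with the kernel of [l]. These
    values add up to h(1) = 1, because the square words with another kernel vanish and all square
    words together sum to 1. *)
Theorem Haar_hyper_diag m (l : multi m) :
  h (pword u l l) = if `[< balanced (modulus_of s) l >] then
    (#|[pred l' : multi m | same_ker l l']|%:R)^-1 else 0.
Proof.
case: asboolP => [bal|nbal]; last first.
  by apply/eqP; apply: contra_notT nbal; exact: Haar_balanced.
have : \sum_(l' : multi m | same_ker l l') h (pword u l l') = 1.
  rewrite -raddf_sum -(Haar_one Haar_h) -(sum_square_word l); congr (h _).
  rewrite [RHS](bigID (fun l' : multi m => same_ker l l')) /=.
  rewrite [X in _ = _ + X]big1 ?addr0 => [|l' nl].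
    by apply: eq_bigr => l' ll; exact: pword_square.
  exact: square_word_eq0.
rewrite (eq_bigr (fun=> h (pword u l l))) => [|l' ll]; last first.
  exact/esym/Haar_same_ker.
have c0 : #|[pred l' : multi m | same_ker l l']|%:R != 0 :> (R[i]%C).
  rewrite pnatr_eq0 -lt0n; apply/card_gt0P; exists l; rewrite inE.
  exact: same_ker_refl.
by rewrite sumr_const -[_ *+ _]mulr_natr => /(canRL (mulfK c0)); rewrite mul1r.
Qed.

End HyperWords.

(** * Unitary invariance *)

Section Householder.
Variables (R : realType) (n : nat) (a b : 'I_n).
Local Notation C := (R[i]%C).
Hypothesis ab : a != b.

(** The normal vector e_a - 2 e_b, of squared length 5, whence the factor 2/5 below. Its unequal
    coordinates give a rational reflection without zero entries in the plane of e_a and e_b, whereas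
    e_a - e_b would only give a transposition. *)
Let c (i : 'I_n) : R := (i == a)%:R - (i == b)%:R *+ 2.

Definition householder_entry (i j : 'I_n) : R := (i == j)%:R - 2 / 5 * (c i * c j).

(* The reflection [[3/5, 4/5], [4/5, -3/5]] of the plane of e_a and e_b. *)
Definition householder : 'M[C]_n := \matrix_(i, j) real_complex R (householder_entry i j).

Let sum_c2 : \sum_k c k * c k = 5.
Proof.
rewrite (bigD1 a)//= (bigD1 b) 1?eq_sym//= big1 => [|k /andP[ka kb]]; last first.
  by rewrite /c (negPf ka) (negPf kb) mul0rn subr0 mul0r.
by rewrite /c !eqxx (eq_sym b) (negPf ab) /=; ring.
Qed.

Lemma householder_sym i j : householder i j = householder j i.
Proof. by rewrite !mxE /householder_entry eq_sym (mulrC (c i)). Qed.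

Lemma householder_conj i j : (householder i j)^* = householder i j.
Proof. by rewrite mxE; exact: conjc_real. Qed.

Lemma householder_sqr i j :
  \sum_k householder i k * householder k j = (i == j)%:R.
Proof.
under eq_bigr do rewrite !mxE -rmorphM.
rewrite -rmorph_sum /= -(rmorph_nat (real_complex R)); congr (real_complex R _).
have pick (F : 'I_n -> R) k0 : \sum_k (k == k0)%:R * F k = F k0.
  rewrite (bigD1 k0)//= big1 ?addr0 ?eqxx ?mul1r// => k /negPf ->.
  by rewrite mul0r.
transitivity (\sum_k ((k == i)%:R * (k == j)%:R - 2 / 5 * c j * ((k == i)%:R * c k)
   - 2 / 5 * c i * ((k == j)%:R * c k) + 4 / 25 * (c i * c j) * (c k * c k))).
  by apply: eq_bigr => k _; rewrite /householder_entry (eq_sym i k); field.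
rewrite !big_split /= !sumrN -!mulr_sumr sum_c2 !pick eq_sym.
by rewrite eq_sym; field.
Qed.

Lemma householder_unitary : unitary_entries householder.
Proof.
split=> i j; rewrite -householder_sqr; apply: eq_bigr => k _.
  by rewrite householder_conj (householder_sym k).
by rewrite householder_conj (householder_sym k).
Qed.

Lemma householder_fix i j : i != a -> i != b -> householder i j = (i == j)%:R.
Proof.
move=> ia ib; rewrite mxE /householder_entry /c (negPf ia) (negPf ib).
by rewrite mul0rn subr0 mul0r mulr0 subr0 /= (rmorph_nat (real_complex R)).
Qed.

Lemma householder_plane i j : (i == a) || (i == b) -> j != a -> j != b ->
  householder i j = 0.
Proof.
move=> iab ja jb; rewrite householder_sym householder_fix//.
by case/orP: iab => /eqP->; rewrite ?(negPf ja) ?(negPf jb).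
Qed.

Lemma householder_neq0 i : householder i i != 0 /\ householder a b != 0.
Proof.
rewrite !mxE /householder_entry /c !eqxx (negPf ab) (eq_sym b) (negPf ab).
have inj0 (r : R) : r != 0 -> real_complex R r != 0.
  by apply: contraNneq => /(@complexI R) ->.
split; apply: inj0; last by apply/eqP => /= e; lra.
case: (eqVneq i a) => [->|ia]; first by rewrite (negPf ab); apply/eqP => /= e; lra.
by case: (eqVneq i b) => _; apply/eqP => /= e; lra.
Qed.

End Householder.

(** * Arrays fixed by all unitary matrices *)

Section UnitaryInvariants.
Variables (R : realType) (n m : nat).
Local Notation C := (R[i]%C).
Local Notation tuples := {ffun 'I_m -> 'I_n}.
Local Notation multi := {ffun 'I_m * bool -> 'I_n}.

Definition mk_legs (x y : tuples) : multi := [ffun p => if p.2 then y p.1 else x p.1].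
Definition row_of (b : bool) (l : multi) : tuples := [ffun r => l (r, b)].

Lemma mk_legsK l : mk_legs (row_of false l) (row_of true l) = l.
Proof. by apply/ffunP => -[r []]; rewrite !ffunE. Qed.

Lemma row_mk_legs b x y : row_of b (mk_legs x y) = if b then y else x.
Proof. by apply/ffunP => r; rewrite !ffunE /=; case: b. Qed.

Lemma sum_legs (V : nmodType) (F : multi -> V) :
  \sum_l F l = \sum_x \sum_y F (mk_legs x y).
Proof.
rewrite pair_big /=.
rewrite (reindex (fun p : tuples * tuples => mk_legs p.1 p.2))//=.
exists (fun l => (row_of false l, row_of true l)) => [[x y] _|l _] /=.
  by rewrite !row_mk_legs.
exact: mk_legsK.
Qed.

Definition tensor_weight (v : 'M[C]_n) (x x' : tuples) : C := \prod_r v (x r) (x' r).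

Lemma tensor_weight_comp (v w : 'M[C]_n) (x x' : tuples) :
  (forall i j, \sum_k v i k * w k j = (i == j)%:R) ->
  \sum_z tensor_weight v x z * tensor_weight w z x' = (x == x')%:R.
Proof.
move=> vw; under eq_bigr do rewrite -big_split /=.
rewrite -(bigA_distr_bigA (fun r k => v (x r) k * w k (x' r))).
under eq_bigr do rewrite vw.
have [->|] := eqVneq x x'; first by rewrite big1// => r _; rewrite eqxx.
move=> xx'; have [r] : exists r, x r != x' r.
  apply/existsP; apply: contraNT xx' => /existsPn xx'.
  by apply/eqP/ffunP => r; apply/eqP; have := xx' r; rewrite negbK.
by move=> /negPf xr; rewrite (bigD1 r)//= xr mul0r.
Qed.

Variable g : multi -> C.
Hypothesis g_inv : forall v, unitary_entries v -> invariant_under v g.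

Let G x y := g (mk_legs x y).

Let G_inv v x y : unitary_entries v ->
  G x y = \sum_x' \sum_y' G x' y' *
    (tensor_weight v x' x * (tensor_weight v y' y)^*).
Proof.
move=> vU; rewrite {1}/G -(g_inv vU) sum_legs.
apply: eq_bigr => x' _; apply: eq_bigr => y' _; congr (_ * _).
rewrite /model_weight big_split /= rmorph_prod; congr (_ * _);
  by apply: eq_bigr => r _; rewrite !ffunE.
Qed.

(** Read as a matrix between the two families of legs, an array fixed by the alternating tensor
    product commutes with the m-th tensor power of v. Here v is real, symmetric and involutive, so
    no adjoint appears. *)
Let G_comm a b x z : a != b ->
  \sum_x' tensor_weight (householder R a b) x x' * G x' z =
  \sum_y G x y * tensor_weight (householder R a b) y z.
Proof.
move=> ab; set v := householder R a b.
have vJ x1 x2 : (tensor_weight v x1 x2)^* = tensor_weight v x1 x2.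
  by rewrite rmorph_prod; apply: eq_bigr => r _; exact: householder_conj.
have vT x1 x2 : tensor_weight v x1 x2 = tensor_weight v x2 x1.
  by apply: eq_bigr => r _; exact: householder_sym.
under [RHS]eq_bigr do rewrite (G_inv _ _ (householder_unitary R ab)) mulr_suml.
rewrite exchange_big; apply: eq_bigr => x' _ /=.
under eq_bigr do rewrite mulr_suml.
rewrite exchange_big /=.
under eq_bigr => y' _.
  under eq_bigr do rewrite vJ -!mulrA.
  rewrite -!mulr_sumr tensor_weight_comp; last exact: householder_sqr.
  over.
rewrite (bigD1 z)//= eqxx big1 => [|y' /negPf ->]; last by rewrite !mulr0.
by rewrite addr0 mulr1 mulrC vT.
Qed.

Definition tuple_mult (x : tuples) c := #|[pred r | x r == c]|.

Lemma mult_mk_legs x y b c : mult (mk_legs x y) b c = tuple_mult (if b then y else x) c.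
Proof. by apply: eq_card => r; rewrite !inE ffunE /=; case: b. Qed.

Let G_balanced x y : G x y != 0 -> forall c, tuple_mult x c = tuple_mult y c.
Proof.
move=> Gxy c.
have : balanced m.+1 (mk_legs x y).
  apply: invariant_balanced Gxy => // d.
  by apply/g_inv/monomial_unitary => j; exact: phase_mul_conj.
by move=> /balanced0P/(_ c); rewrite !modn0 !mult_mk_legs.
Qed.

Definition comp_perm (x : tuples) (t : {perm 'I_m}) : tuples := [ffun r => x (t r)].

Lemma tuple_mult_perm (x y : tuples) : injective x ->
  (forall c, tuple_mult x c = tuple_mult y c) -> exists t, y = comp_perm x t.
Proof.
move=> xI xy.
have yx r : exists q, x q == y r.
  apply/existsP; rewrite -[[exists _, _]]negbK negb_exists; apply/negP => /forallP no.
  have : (0 < tuple_mult y (y r))%N by apply/card_gt0P; exists r; rewrite inE.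
  by rewrite -xy /tuple_mult eq_card0// => q; rewrite inE; apply: negbTE.
pose f r := xchoose (yx r); have xf r : x (f r) = y r by exact/eqP/(xchooseP (yx r)).
have fI : injective f.
  move=> r q frq.
  have : (tuple_mult y (y r) <= 1)%N.
    rewrite -xy; apply/card_le1_eqP => i j; rewrite !inE => /eqP xi /eqP xj.
    by apply: xI; rewrite xi xj.
  by move=> le1; apply: (card_le1_eqP le1); rewrite inE ?eqxx// -!xf frq.
by exists (perm fI); apply/ffunP => r; rewrite ffunE permE xf.
Qed.

Lemma same_ker_inj (b x : tuples) (t : {perm 'I_m}) : injective b -> injective x ->
  same_ker (mk_legs b (comp_perm b t)) (mk_legs x (comp_perm x t)).
Proof.
move=> bI xI; apply/same_kerP => -[r []] [q []]; rewrite !ffunE /= ?ffunE /=;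
  by rewrite !(inj_eq bI) !(inj_eq xI).
Qed.

(* A value of x taken twice is split by rotating in the plane of that value and
   of a value not taken, so that g at x is controlled by tuples with more values. *)
Lemma unitary_invariant_eq0 (b : tuples) : injective b ->
  (forall t, g (mk_legs b (comp_perm b t)) = 0) -> forall l, g l = 0.
Proof.
move=> bI gb l; rewrite -(mk_legsK l).
suff G0 x y : G x y = 0 by exact: G0.
pose nval (x : tuples) := #|codom x|.
have [k] := ubnP (m - nval x)%N; elim: k => // k IH in x y *; rewrite ltnS => le_k.
have [//|Gxy] := eqVneq (G x y) 0.
have [/injectiveP xI|/injectivePn[p [q pq xpq]]] := boolP (injectiveb x).
  have [t yt] := tuple_mult_perm xI (G_balanced Gxy).
  rewrite yt /G -(invariant_perm (l := mk_legs b (comp_perm b t)) (g := g)) ?gb//.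
    by move=> s; apply/g_inv/monomial_unitary => j; rewrite rmorph1 mulr1.
  exact: same_ker_inj.
have ltn_m : (nval x < m)%N.
  have := leq_image_card x 'I_m; rewrite card_ord /nval ltn_neqAle => ->.
  rewrite andbT; apply/negP => /eqP e.
  have /image_injP : #|codom x| == #|'I_m| by rewrite e card_ord.
  by move=> /(_ p q isT isT xpq) /eqP; rewrite (negPf pq).
(* [b] is injective, so there are at least m indices, while [x] takes fewer than m values. *)
have [c cx] : exists c, c \notin codom x.
  apply/existsP; rewrite -[[exists _, _]]negbK negb_exists; apply/negP => /forallP full.
  have : (n <= nval x)%N.
    rewrite -[n]card_ord; apply: subset_leq_card; apply/fintype.subsetP => c _.
    by have := full c; rewrite negbK.
  apply/negP; rewrite -ltnNge; apply: leq_trans ltn_m _.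
  by have := leq_card _ bI; rewrite !card_ord.
set a := x p; pose x' : tuples := [ffun r => if r == p then c else x r].
have ac : a != c by apply: contraNneq cx => <-; exact: codom_f.
have lt_nval : (nval x < nval x')%N.
  apply: proper_card; apply/fintype.properP; split.
    apply/fintype.subsetP => _ /codomP[r ->].
    have [->|rp] := eqVneq r p.
      by rewrite xpq; apply/codomP; exists q; rewrite ffunE eq_sym (negPf pq).
    by apply/codomP; exists r; rewrite ffunE (negPf rp).
  by exists c => //; apply/codomP; exists p; rewrite ffunE eqxx.
(* [x'] keeps the value of [x] at [p], which is also taken at [q], and gains the value [c]: the
   induction hypothesis applies. *)
have G0 z : G x' z = 0.
  apply: IH; apply: leq_trans le_k.
  by apply: ltn_sub2l.
have := G_comm x' y ac; rewrite [RHS]big1 => [|z _]; last by rewrite G0 mul0r.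
rewrite (bigD1 x)//= big1 ?addr0 => [|x'' x''x].
  move/eqP; rewrite mulf_eq0 (negPf Gxy) orbF => /eqP w0; exfalso.
  suff : tensor_weight (householder R a c) x' x != 0 by rewrite w0 eqxx.
  apply/prodf_neq0 => r _; rewrite ffunE; case: (eqVneq r p) => [->|_].
    by rewrite householder_sym; have [] := householder_neq0 R ac a.
  by have [] := householder_neq0 R ac (x r).
(* No other tuple contributes. If G is nonzero at [x''], then [x''] has the multiplicities of [y],
   hence of [x], so it avoids [c]; a nonzero weight then forces [x''] to agree with [x] at every
   place. *)
apply/eqP; rewrite mulf_eq0 -implyNb; apply/implyP => w0.
apply: contraNT x''x => Gx''.
have mx c' : tuple_mult x'' c' = tuple_mult x c'.
  by rewrite (G_balanced Gx'') (G_balanced Gxy).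
have x''c r : x'' r != c.
  apply: contraNneq cx => e; have : (0 < tuple_mult x'' c)%N.
    by apply/card_gt0P; exists r; rewrite inE e.
  rewrite mx => /card_gt0P[r']; rewrite inE => /eqP <-; exact: codom_f.
apply/eqP/ffunP => r; move/prodf_neq0: w0 => /(_ r isT).
rewrite ffunE; case: (eqVneq r p) => [->|rp].
  move=> w0; apply/eqP; apply: contraNT w0 => x''a; apply/eqP.
  by apply: householder_plane => //; rewrite eqxx orbT.
have [xa|xa] := eqVneq (x r) a.
  rewrite xa => w0; apply/eqP; apply: contraNT w0 => x''a; apply/eqP.
  by apply: householder_plane => //; rewrite eqxx.
rewrite householder_fix//; last by apply: contraNneq cx => <-; exact: codom_f.
by case: (eqVneq (x r) (x'' r)) => [->//|_]; rewrite eqxx.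
Qed.

End UnitaryInvariants.

(** * Pairings, their linear independence and their Gram matrix *)

Section Pairings.
Variables (n m : nat).
Local Notation tuples := {ffun 'I_m -> 'I_n}.
Local Notation multi := {ffun 'I_m * bool -> 'I_n}.
Implicit Types (t s : {perm 'I_m}) (x y b : tuples) (l : multi).

Definition paired t l := row_of true l == comp_perm (row_of false l) t.

Lemma paired_mk t x y : paired t (mk_legs x y) = (y == comp_perm x t).
Proof. by rewrite /paired !row_mk_legs. Qed.

Lemma comp_perm_inj b : injective b -> injective (comp_perm b).
Proof.
move=> bI t s /ffunP ts; apply/permP => r.
by have := ts r; rewrite !ffunE => /bI.
Qed.

Lemma comp_perm_eq x y t : (y == comp_perm x t) = [forall r, x r == y ((t^-1)%g r)].
Proof.
apply/eqP/forallP => [-> r|e]; first by rewrite ffunE permKV.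
by apply/ffunP => r; rewrite ffunE (eqP (e (t r))) permK.
Qed.

Lemma sum_paired (V : nmodType) t (F : multi -> V) :
  \sum_(l | paired t l) F l = \sum_x F (mk_legs x (comp_perm x t)).
Proof.
rewrite big_mkcond sum_legs; apply: eq_bigr => x _.
rewrite -big_mkcond /= (big_pred1 (comp_perm x t))// => y.
by rewrite paired_mk.
Qed.

Lemma sum_forall_prod (K : comNzRingType) (P : 'I_m -> 'I_n -> bool) x :
  \prod_r (P r (x r))%:R = [forall r, P r (x r)]%:R :> K.
Proof.
case: forallP => [all1|/existsNP[r /negP/negPf r0]].
  by rewrite big1// => r _; rewrite all1.
by rewrite (bigD1 r)//= r0 mul0r.
Qed.

Section Expansion.
Variable R : realType.
Local Notation C := (R[i]%C).

Lemma paired_invariant t (v : 'M[C]_n) : unitary_entries v ->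
  invariant_under v (fun l => (paired t l)%:R).
Proof.
move=> [_ vc] l.
under eq_bigr do rewrite mulr_natl mulrb.
rewrite -big_mkcond /= sum_paired -(mk_legsK l) paired_mk.
set x' := row_of false l; set y' := row_of true l.
transitivity (\sum_(x : tuples) \prod_r
   (v (x r) (x' r) * (v (x r) (y' ((t^-1)%g r)))^*)).
  apply: eq_bigr => x _; rewrite /model_weight !big_split /=.
  congr (_ * _); first by apply: eq_bigr => r _; rewrite !ffunE.
  rewrite [RHS](reindex_inj (@perm_inj _ t)) /=.
  by apply: eq_bigr => r _; rewrite !ffunE permK.
rewrite -(bigA_distr_bigA (fun r k => v k (x' r) * (v k (y' ((t^-1)%g r)))^*)).
under eq_bigr do rewrite vc.
rewrite comp_perm_eq.
exact: (sum_forall_prod _ (fun r k => k == y' ((t^-1)%g r))).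
Qed.

(** An injective [b] separates the pairings: at (b, b o s) only the pairing by s is nonzero. The
    coefficients are read off at these points, and what remains of [g] vanishes there, hence
    everywhere. *)
Lemma unitary_invariant_expand (g : multi -> C) b : injective b ->
  (forall v, unitary_entries v -> invariant_under v g) ->
  forall l, g l = \sum_t g (mk_legs b (comp_perm b t)) * (paired t l)%:R.
Proof.
move=> bI ginv l.
pose g' l := g l - \sum_t g (mk_legs b (comp_perm b t)) * (paired t l)%:R.
suff /eqP : g' l = 0 by rewrite subr_eq0 => /eqP.
apply: (@unitary_invariant_eq0 _ _ _ g' _ b) => // [v vU l'|t].
  rewrite /g' -[in RHS](ginv v vU l').
  under eq_bigr do rewrite mulrBl.
  rewrite big_split /= sumrN; congr (_ - _).
under [LHS]eq_bigr do rewrite mulr_suml.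
  rewrite exchange_big /=; apply: eq_bigr => t _.
  under eq_bigr do rewrite -mulrA.
  by rewrite -mulr_sumr paired_invariant.
rewrite /g' (bigD1 t)//= paired_mk eqxx mulr1 big1 ?addr0 ?subrr// => s st.
rewrite paired_mk (inj_eq (comp_perm_inj bI)) eq_sym (negPf st) mulr0 //.
Qed.

End Expansion.

Lemma paired_gram_diag t : #|[pred x : tuples | comp_perm x t == comp_perm x t]| = (n ^ m)%N.
Proof.
have -> : (n ^ m)%N = #|{: tuples}| by rewrite card_ffun !card_ord.
by apply: eq_card => x; rewrite !inE eqxx.
Qed.

(** Two different permutations impose an equation between two distinct coordinates of x, which costs
    a factor n. *)
Lemma paired_gram_off t s : t != s ->
  (#|[pred x : tuples | comp_perm x t == comp_perm x s]| * n <= n ^ m)%N.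
Proof.
move=> ts; have [r rts] : exists r, t r != s r.
  by apply/existsP; apply: contraNT ts => /existsPn ts; apply/eqP/permP => r;
    apply/eqP; have := ts r; rewrite negbK.
(* Changing the value at [t r] gives an injective map to all tuples. *)
pose f (p : tuples * 'I_n) : tuples := [ffun q => if q == t r then p.2 else p.1 q].
have -> : (n ^ m)%N = #|{: tuples}| by rewrite card_ffun !card_ord.
have cardM (P : pred tuples) : (#|P| * n)%N = #|[predX P & 'I_n]|.
  by rewrite cardX card_ord.
rewrite cardM -(card_in_imset (f := f)) ?max_card// => -[x c] [y d] /=.
rewrite !inE /= !andbT => /eqP/ffunP/(_ r) + /eqP/ffunP/(_ r) + /ffunP xy.
rewrite !ffunE => xr yr; have := xy (t r); rewrite !ffunE eqxx /= => <-.
congr (_, _); apply/ffunP => q; have [->|qr] := eqVneq q (t r); last first.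
  by have := xy q; rewrite !ffunE (negPf qr).
by rewrite xr yr; have := xy (s r); rewrite !ffunE eq_sym (negPf rts).
Qed.

End Pairings.

(** * Asymptotic Haar integration over O_n^star *)

Section OrthoHaar.
Variables (R : realType) (n : nat) (A : cstarAlg R) (u : 'M[A]_n) (h : {scalar A}).
Hypotheses (universal_u : is_universal (@Ostar_rel R n) u) (Haar_h : is_Haar u h).
Variable m : nat.
Local Notation C := (R[i]%C).
Local Notation tuples := {ffun 'I_m -> 'I_n}.
Local Notation multi := {ffun 'I_m * bool -> 'I_n}.
Implicit Types (t s : {perm 'I_m}) (x y : tuples) (l : multi).

Local Notation letter := (fun c : 'I_n * 'I_n => u c.1 c.2).

(** Half-commutation reorders the letters at even places until letters with equal column index are
    neighbours; the sum over columns then factors, and u u^t = 1 evaluates each factor. *)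
Lemma Ostar_paired_fixed t l :
  \sum_(l' | paired t l') pword u l l' = (paired t l)%:R.
Proof.
have [[_ uu _ hc] _] := universal_u.
rewrite sum_paired -(mk_legsK l) paired_mk.
set x := row_of false l; set y := row_of true l.
have half_comm c1 c2 c3 :
  letter c1 * letter c2 * letter c3 = letter c3 * letter c2 * letter c1.
  exact: hc.
transitivity (\sum_(x' : tuples) \prod_r (u (x r) (x' r) * u (y ((t^-1)%g r)) (x' r))).
  apply: eq_bigr => x' _.
  pose e := [seq (x r, x' r) | r <- enum 'I_m].
  pose o := [seq (y r, x' (t r)) | r <- enum 'I_m].
  pose o' := [seq (y ((t^-1)%g r), x' r) | r <- enum 'I_m].
  transitivity (zword letter e o).
    rewrite /pword /zword /e zip_map big_map /index_enum -enumT.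
    by apply: eq_bigr => r _; rewrite !ffunE.
  have -> : zword letter e o = zword letter e o'.
    apply: zword_permr => //; first by rewrite !size_map.
    have -> : o = [seq (y ((t^-1)%g r), x' r) | r <- [seq t r | r <- enum 'I_m]].
      by rewrite -map_comp; apply: eq_map => r /=; rewrite permK.
    apply: perm_map; apply: uniq_perm; rewrite ?enum_uniq//.
      by rewrite (map_inj_uniq (@perm_inj _ t)) enum_uniq.
    move=> r; rewrite mem_enum; apply/mapP; exists ((t^-1)%g r).
      by rewrite mem_enum.
    by rewrite permKV.
  rewrite /zword /e /o' zip_map big_map /index_enum -enumT.
  by apply: eq_bigr.
rewrite -(bigA_distr_bigA (fun r k => u (x r) k * u (y ((t^-1)%g r)) k)).
have uuE i j : \sum_k u i k * u j k = (i == j)%:R.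
  have /matrixP/(_ i j) := uu; rewrite !mxE => e; rewrite -[RHS]e.
  by apply: eq_bigr => k _; rewrite mxE.
under eq_bigr do rewrite uuE.
rewrite comp_perm_eq.
case: forallP => [all1|/existsNP[r /negP/negPf r0]].
  by rewrite big1// => r _; rewrite all1.
(* The product lives in a noncommutative algebra, so the vanishing factor is reached by splitting
   the list of indices. *)
have [r1 [r2 ->]] : exists r1 r2, index_enum 'I_m = r1 ++ r :: r2.
  have := mem_index_enum r; case/splitPr => r1 r2; by exists r1, r2.
by rewrite big_cat big_cons /= r0 mul0r mulr0.
Qed.

Lemma Haar_paired t l : \sum_(l' | paired t l') h (pword u l l') = (paired t l)%:R.
Proof.
rewrite -raddf_sum Ostar_paired_fixed; case: (paired t l) => /=.
  exact: (Haar_one Haar_h).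
exact: raddf0.
Qed.

Lemma Haar_unitary_invariant l v : unitary_entries v ->
  invariant_under v (fun l' => h (pword u l l')).
Proof.
move=> vU l'; apply: (Haar_invariant universal_u Haar_h); exact: model_Ostar.
Qed.

Section Estimate.
Variable b : tuples.
Hypotheses (b_inj : injective b) (m_gt0 : (0 < m)%N) (fact_lt : (m`! < n)%N).

(** The coefficients of h on the pairings, the analogue of one row of a Weingarten matrix contracted
    with [l]. *)
Let w l t := h (pword u l (mk_legs b (comp_perm b t))).

Lemma Haar_expand l l' : h (pword u l l') = \sum_t w l t * (paired t l')%:R.
Proof.
apply: (unitary_invariant_expand b_inj (g := fun l' => h (pword u l l'))).
exact: Haar_unitary_invariant.
Qed.

Let gram t s : C := #|[pred x : tuples | comp_perm x t == comp_perm x s]|%:R.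

Let Q : C := (n ^ m.-1)%:R.

Let nm : (n ^ m)%:R = Q * n%:R :> C.
Proof. by rewrite -natrM -expnSr prednK. Qed.

Let n0 : 0 < n%:R :> C.
Proof. by rewrite ltr0n (leq_ltn_trans _ fact_lt). Qed.

Let Q0 : 0 < Q.
Proof. by rewrite ltr0n expn_gt0 -(ltr0n C) n0. Qed.

Let gram_off t s : t != s -> `|gram t s| <= Q.
Proof.
move=> ts; rewrite ger0_norm ?ler0n// -(ler_pM2r n0) -nm -natrM ler_nat.
exact: paired_gram_off.
Qed.

Lemma Haar_gram l t : \sum_s w l s * gram s t = (paired t l)%:R.
Proof.
rewrite -(Haar_paired t l).
under [RHS]eq_bigr do rewrite Haar_expand.
rewrite exchange_big /=; apply: eq_bigr => s _.
rewrite -mulr_sumr; congr (_ * _).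
rewrite (sum_paired t (fun l' => (paired s l')%:R)) /gram -sum1_card natr_sum.
rewrite big_mkcond /=; apply: eq_bigr => x _.
by rewrite paired_mk inE eq_sym; case: eqP.
Qed.

Let S l : C := \sum_t `|w l t|.

(* [S l] bounds the error made in replacing the Gram matrix by n ^ m; [S_le] then
   bounds [S l] by the same estimate. *)
Let w_approx l t : `|w l t * (n ^ m)%:R - (paired t l)%:R| <= S l * Q.
Proof.
rewrite -(Haar_gram l t) (bigD1 t)//= /gram paired_gram_diag opprD addrA subrr.
rewrite add0r normrN (le_trans (ler_norm_sum _ _ _))//.
rewrite /S mulr_suml [leRHS](bigD1 t)//=; apply: ler_wpDl.
  by rewrite mulr_ge0// ltW.
by apply: ler_sum => s st; rewrite normrM ler_wpM2l// gram_off.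
Qed.

(** Summing |w| n^m <= 1 + S Q over the m! permutations, with n^m = Q n, gives S Q n <= m! (1 + S
    Q). Solving for S Q yields this bound, positive once n > m!. *)
Let E : C := m`!%:R / (n%:R - m`!%:R).

Let nmf : 0 < n%:R - m`!%:R :> C.
Proof. by rewrite subr_gt0 ltr_nat. Qed.

Let card_perms : #|{perm 'I_m}| = m`!.
Proof. by rewrite -(card_Sn m) -cardsT. Qed.

Let S_le l : S l * Q <= E.
Proof.
have: S l * (n ^ m)%:R <= \sum_(t : {perm 'I_m}) (1 + S l * Q).
  rewrite mulr_suml; apply: ler_sum => t _.
  rewrite -[X in _ * X]ger0_norm ?ler0n// -normrM.
  rewrite -[X in `|X|](subrK (paired t l)%:R) addrC (le_trans (ler_normD _ _))//.
  by rewrite lerD ?w_approx//; case: (paired t l); rewrite ?normr1 ?normr0 ?ler01.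
rewrite big_split /= !sumr_const card_perms nm => le.
rewrite /E ler_pdivlMr// mulrBr lerBlDr -mulrA (le_trans le)//.
by rewrite (mulr_natr (S l * Q)).
Qed.

Let w_close l t : paired t l -> `|w l t - (n ^ m)%:R^-1| <= E / (n ^ m)%:R.
Proof.
move=> tl; have nm0 : 0 < (n ^ m)%:R :> C by rewrite nm mulr_gt0.
rewrite ler_pdivlMr// -[X in _ * X]gtr0_norm// -normrM mulrBl mulVf ?gt_eqF//.
by have := le_trans (w_approx l t) (S_le l); rewrite tl.
Qed.

Definition bounded_legs N l := [forall p, (l p < N)%N].

Lemma card_bounded_tuples N : (N <= n)%N ->
  #|[pred x : tuples | [forall r, (x r < N)%N]]| = (N ^ m)%N.
Proof.
move=> Nn; have {2}-> : N = #|[pred i : 'I_n | (i < N)%N]|.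
  by rewrite -sum1_card -(big_ord_widen n (fun=> 1%N) Nn) sum1_card card_ord.
rewrite -[X in (_ ^ X)%N](card_ord m) -card_ffun_on; apply: eq_card => x.
rewrite [LHS]inE; apply/forallP/ffun_onP => xN r; first exact: xN r.
exact: xN r.
Qed.

Lemma bounded_mk_legs N x t :
  bounded_legs N (mk_legs x (comp_perm x t)) = [forall r, (x r < N)%N].
Proof.
apply/forallP/forallP => xN r; first by have := xN (r, false); rewrite ffunE.
by case: r => r []; rewrite !ffunE //= ffunE.
Qed.

(** There are m! N^m pairs of a permutation t and a bounded l paired by t. Weight n^-m on each gives
    the main term; each true weight is off by at most E n^-m, and N <= n. *)
Lemma Haar_trace_estimate N : (N <= n)%N ->
  `|\sum_(l | bounded_legs N l) h (pword u l l) -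
    m`!%:R * (N%:R / n%:R) ^+ m| <= m`!%:R * E.
Proof.
move=> Nn; have nm0 : 0 < (n ^ m)%:R :> C by rewrite nm mulr_gt0.
have cnt (c : C) : \sum_(l | bounded_legs N l) \sum_t c * (paired t l)%:R =
    m`!%:R * (N ^ m)%:R * c.
  under eq_bigr do rewrite -mulr_sumr -natr_sum.
  rewrite -mulr_sumr -natr_sum mulrC -natrM; congr (_%:R * _).
  rewrite exchange_big /=.
  rewrite (eq_bigr (fun=> N ^ m)%N) => [|t _]; last first.
    transitivity (\sum_(l | paired t l) (bounded_legs N l : nat))%N.
      rewrite [LHS]big_mkcond [RHS]big_mkcond; apply: eq_bigr => l _ /=.
      by case: (bounded_legs N l); case: (paired t l).
    rewrite sum_paired -(card_bounded_tuples Nn) -sum1_card [RHS]big_mkcond.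
    by apply: eq_bigr => x _; rewrite bounded_mk_legs inE; case: ifP.
  by rewrite sum_nat_const card_perms.
have := cnt (n ^ m)%:R^-1.
have -> : m`!%:R * (N ^ m)%:R * (n ^ m)%:R^-1 = m`!%:R * (N%:R / n%:R) ^+ m :> C.
  by rewrite -mulrA expr_div_n -!natrX.
move=> <-.
rewrite -sumrB; apply: le_trans (ler_norm_sum _ _ _) _.
apply: (@le_trans _ _ (\sum_(l | bounded_legs N l) \sum_t E / (n ^ m)%:R * (paired t l)%:R)).
  apply: ler_sum => l _; rewrite Haar_expand -sumrB.
  apply: le_trans (ler_norm_sum _ _ _) _; apply: ler_sum => t _.
  rewrite -mulrBl normrM normr_nat; case: (boolP (paired t l)) => tl.
    by rewrite !mulr1 w_close.
  by rewrite !mulr0.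
rewrite cnt -mulrA ler_pM2l ?ltr0n ?fact_gt0//.
rewrite mulrA ler_pdivrMr// mulrC ler_pM2l ?ler_nat ?leq_exp2r//.
by rewrite divr_gt0 ?ltr0n ?fact_gt0.
Qed.

End Estimate.

End OrthoHaar.

(** * Moments of truncated characters *)

Section BlockBalance.
Variable m : nat.
Local Notation leg := ('I_m * bool)%type.

Definition block_balanced d (B : {set leg}) :=
  #|[pred p in B | ~~ p.2]| == #|[pred p in B | p.2]| %[mod d].

Definition part_balanced d (P : {set {set leg}}) := [forall B in P, block_balanced d B].

Lemma mult_block n (l : {ffun leg -> 'I_n}) b p :
  mult l b (l p) = #|[pred q in finset.pblock (ker_partition l) p | q.2 == b]|.
Proof.
have fI : injective (fun r : 'I_m => (r, b)) by move=> x y [].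
rewrite /mult -(fintype.card_image fI).
apply: eq_card => -[r c]; rewrite !inE mem_pblock_ker /=.
apply/fintype.imageP/andP => [[q]|[/eqP lr /eqP cb]].
  by rewrite inE => /eqP lq [-> ->]; rewrite lq.
by exists r; rewrite ?inE -cb ?lr.
Qed.

Lemma balancedP n d (l : {ffun leg -> 'I_n}) :
  reflect (balanced d l) (part_balanced d (ker_partition l)).
Proof.
have blk p : block_balanced d (finset.pblock (ker_partition l) p) =
    (mult l false (l p) == mult l true (l p) %[mod d]).
  rewrite !mult_block /block_balanced; congr (_ %% d == _ %% d)%N;
    by apply: eq_card => q; rewrite !inE; case: (q.2).
have cov p : p \in finset.cover (ker_partition l).
  by rewrite (cover_partition (ker_partitionP l)) finset.inE.
apply: (iffP forall_inP) => [bal c|bal B BP].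
  have [/existsP[p /eqP <-]|/existsPn no] := boolP [exists p, l p == c].
    by apply/eqP; rewrite -blk; apply: bal; apply: pblock_mem.
  have m0 b : mult l b c = 0%N.
    by apply: eq_card0 => r; rewrite !inE; apply: negbTE; exact: no.
  by rewrite !m0.
have /finset.set0Pn[p pB] := partition_neq0 (ker_partitionP l) BP.
rewrite -(def_pblock (partition_trivIset (ker_partitionP l)) BP pB) blk.
exact/eqP/bal.
Qed.

End BlockBalance.

Section MomentExpansion.
Variables (R : realType) (n : nat) (A : cstarAlg R) (u : 'M[A]_n) (h : {scalar A}).
Variable (t : R).
Local Notation C := (R[i]%C).
Local Notation N := (Num.truncn (t * n%:R)).

Lemma truncated_char_exp k : truncated_char u t ^+ k =
  \sum_(i : {ffun 'I_k -> 'I_n} | [forall q, (i q < N)%N]) word u i i.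
Proof.
rewrite -[in LHS](card_ord k) -prodr_const /truncated_char.
rewrite (bigA_distr_big _ (fun _ i => u i i)); apply: eq_big => [i|i _].
  by apply/ffun_onP/forallP.
by [].
Qed.

Lemma Haar_char_even m : h (truncated_char u t ^+ m.*2) =
  \sum_(l : {ffun 'I_m * bool -> 'I_n} | bounded_legs N l) h (pword u l l).
Proof.
rewrite truncated_char_exp raddf_sum (reindex (@of_legs m _)) /=; last first.
  by exists (@to_legs m _) => x _; rewrite ?of_legsK ?to_legsK.
apply: eq_big => [l|l _]; last by rewrite word_of_legs.
apply/forallP/forallP => lN p; last by rewrite ffunE.
by have := lN (place p); rewrite ffunE placeK.
Qed.

End MomentExpansion.

Section HyperMoment.
Variables (R : realType) (n : nat) (s : option nat) (A : cstarAlg R) (u : 'M[A]_n).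
Variables (h : {scalar A}) (t : R).
Hypothesis s_ge2 : if s is Some m then (2 <= m)%N else true.
Hypotheses (universal_u : is_universal (@H_rel R n s) u) (Haar_h : is_Haar u h).
Local Notation C := (R[i]%C).
Local Notation N := (Num.truncn (t * n%:R)).
Hypothesis t01 : 0 <= t <= 1.

Lemma truncn_mul_le : (N <= n)%N.
Proof.
have /andP[t0 t1] := t01.
rewrite -(ler_nat R); apply: (@le_trans _ _ (t * n%:R)).
  by rewrite truncn_le mulr_ge0.
by rewrite -[leRHS]mul1r ler_wpM2r.
Qed.

Lemma card_truncn : #|[pred i : 'I_n | (i < N)%N]| = N.
Proof.
by rewrite -sum1_card -(big_ord_widen n (fun=> 1%N) truncn_mul_le) sum1_card card_ord.
Qed.

(** Index tuples are grouped by kernel: [N ^_ #|P|] of them are bounded with kernel [P], and each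
    has Haar value the inverse of [n ^_ #|P|] when [P] is balanced and 0 otherwise. *)
Lemma Haar_hyper_moment m : h (truncated_char u t ^+ m.*2) =
  \sum_(P : {set {set 'I_m * bool}} | finset.partition P finset.setT &&
     part_balanced (modulus_of s) P) (N ^_ #|P|)%:R / (n ^_ #|P|)%:R.
Proof.
rewrite Haar_char_even.
transitivity (\sum_(l : {ffun 'I_m * bool -> 'I_n} | bounded_legs N l &&
    part_balanced (modulus_of s) (ker_partition l))
    (n ^_ #|ker_partition l|)%:R^-1 : C).
  rewrite big_mkcondr; apply: eq_bigr => l _.
  rewrite (Haar_hyper_diag s_ge2 universal_u.1 universal_u Haar_h).
  rewrite (asbool_equiv_eq (rwP (balancedP _ l))) asboolb; case: ifP => // _.
  congr (_%:R^-1); rewrite -[X in (X ^_ _)%N](card_ord n).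
  rewrite -(card_ker_partition 'I_n (ker_partitionP l)).
  apply: eq_card => l'; rewrite !inE -ker_partition_eq eq_sym.
  by rewrite [X in _ && X](_ : _ = true) ?andbT//; apply/forallP.
rewrite (partition_big (@ker_partition _ _) (fun P => finset.partition P finset.setT &&
     part_balanced (modulus_of s) P)) /=; last first.
  by move=> l /andP[_ ->]; rewrite ker_partitionP.
apply: eq_bigr => P /andP[PT Pbal].
rewrite (eq_bigr (fun=> (n ^_ #|P|)%:R^-1)); last by move=> l /andP[_ /eqP->].
rewrite sumr_const -[LHS]mulr_natl; congr (_ * _); congr (_%:R).
rewrite -[X in (X ^_ _)%N]card_truncn -(card_ker_partition _ PT).
apply: eq_card => l; rewrite [LHS]unfold_in /= [RHS]inE.
case: eqVneq => [->|]; rewrite ?andbF// Pbal !andbT /=.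
by apply: eq_forallb => p; rewrite inE.
Qed.

End HyperMoment.

Local Open Scope classical_set_scope.
Local Open Scope ring_scope.

(** * Limits of the moments of truncated characters *)

Section RealLimits.
Variable R : realType.
Local Notation C := (R[i]%C).
Local Notation K := (R[i]%C : numFieldType).

Lemma cvg_real_complex (a : nat -> C) (r e : nat -> R) (l : R) :
  (\forall n \near \oo, `|a n - (r n)%:C%C| <= (e n)%:C%C) ->
  r n @[n --> \oo] --> l -> e n @[n --> \oo] --> 0 ->
  (a n : K) @[n --> \oo] --> (l%:C%C : K).
Proof.
move=> ar rl e0; apply/cvgrPdist_lt => eps eps0.
have [d d0 epsE] : exists2 d : R, 0 < d & eps = d%:C%C.
  exists (complex.Re eps).
    by move: eps0; rewrite ltcE => /andP[_].
  by rewrite RRe_real// gtr0_real.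
have d20 : 0 < d / 2 by rewrite divr_gt0.
move/cvgrPdist_lt: rl => /(_ _ d20) rl.
move/cvgrPdist_lt: e0 => /(_ _ d20) e0.
near=> n; rewrite epsE.
have -> : l%:C%C - a n = (l - r n)%:C%C - (a n - (r n)%:C%C) :> C.
  by rewrite rmorphB; ring.
apply: le_lt_trans (ler_normB _ _) _.
apply: (@le_lt_trans _ _ (`|l - r n|%:C%C + (e n)%:C%C)).
  apply: lerD; last by near: n.
  by rewrite normc_def /= expr0n addr0 sqrtr_sqr.
rewrite -rmorphD ltcR (splitr d) ltrD//; first by near: n.
apply: le_lt_trans (ler_norm _) _.
by rewrite -normrN -sub0r; near: n.
Unshelve. all: by end_near.
Qed.

Lemma cvg_div_nat (x : nat -> R) (t c : R) :
  (forall n, `|x n - t * n%:R| <= c) -> x n / n%:R @[n --> \oo] --> t.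
Proof.
move=> xt; apply/cvgrPdist_lt => e e0.
near=> n.
have n0 : 0 < n%:R :> R by near: n; exact: nbhs_infty_gtr.
have -> : t - x n / n%:R = - (x n - t * n%:R) / n%:R.
  by rewrite mulNr mulrBl mulfK ?gt_eqF// opprB.
rewrite normrM normrN normfV (gtr0_norm n0) ltr_pdivrMr//.
apply: le_lt_trans (xt n) _.
by rewrite mulrC -ltr_pdivrMr//; near: n; exact: nbhs_infty_gtr.
Unshelve. all: by end_near.
Qed.

Variable t : R.
Hypothesis t01 : 0 <= t <= 1.
Local Notation N n := (Num.truncn (t * n%:R)).

Lemma truncn_approx n : `|(N n)%:R - t * n%:R| <= 1.
Proof.
have /andP[t0 t1] := t01.
have tn0 : 0 <= t * n%:R by rewrite mulr_ge0.
have /andP[le lt] := truncn_itv tn0.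
rewrite ler_norml; move: lt; rewrite -natr1 => lt; apply/andP; split; lra.
Qed.

Lemma cvg_truncn_div : (N n)%:R / n%:R @[n --> \oo] --> t.
Proof. exact: cvg_div_nat truncn_approx. Qed.

Lemma subn_approx (a d : nat) : `|(a - d)%:R - a%:R| <= d%:R :> R.
Proof.
rewrite ler_norml; apply/andP; split; last first.
  by rewrite (@le_trans _ _ 0)// subr_le0 ler_nat leq_subr.
have : (a%:R <= (a - d)%:R + d%:R :> R) by rewrite -natrD ler_nat addnC -leq_subLR.
lra.
Qed.

Lemma cvg_ffact_ratio d :
  (N n ^_ d)%:R / (n ^_ d)%:R @[n --> \oo] --> t ^+ d.
Proof.
elim: d => [|d IH].
  under eq_fun do rewrite !ffactn0 divr1.
  by rewrite expr0; exact: cvg_cst.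
have cvg1 : (N n - d)%:R / n%:R @[n --> \oo] --> t.
  apply: (@cvg_div_nat _ t (d%:R + 1)) => n.
  rewrite -(subrK (N n)%:R (N n - d)%:R) -addrA.
  apply: le_trans (ler_normD _ _) _; apply: lerD; first exact: subn_approx.
  exact: truncn_approx.
have cvg2 : (n - d)%:R / n%:R @[n --> \oo] --> (1 : R).
  apply: (@cvg_div_nat _ 1 d%:R) => n; rewrite mul1r; exact: subn_approx.
have := cvgM IH (cvgM cvg1 (cvgV (oner_neq0 R) cvg2)).
rewrite invr1 mulr1 -exprSr => cvg3.
have -> : (fun n => (N n ^_ d.+1)%:R / (n ^_ d.+1)%:R) =
  (fun n => (N n ^_ d)%:R / (n ^_ d)%:R) \*
  ((fun n => (N n - d)%:R / n%:R) \* (fun n => ((n - d)%:R / n%:R)^-1)) :> (nat -> R).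
  (* At n = 0 both sides are 0 by the convention for division; elsewhere the factor n cancels. *)
  apply/funext => -[|n] /=.
    by rewrite mulr0 truncn0 !ffact0n !(mul0r, mulr0).
  rewrite !ffactnSr !natrM !invfM invrK.
  have -> : (N n.+1 - d)%:R / n.+1%:R * ((n.+1 - d)%:R^-1 * n.+1%:R) =
      (N n.+1 - d)%:R / (n.+1 - d)%:R :> R.
    by rewrite (mulrC _^-1 n.+1%:R) mulrA divfK// pnatr_eq0.
  by ring.
exact: cvg3.
Qed.

Definition bessel_moment (d m : nat) : R :=
  \sum_(P : {set {set 'I_m * bool}} | finset.partition P finset.setT &&
     part_balanced d P) t ^+ #|P|.

End RealLimits.

Section MomentLimits.
Variables (R : realType) (t : R) (A : nat -> cstarAlg R) (u : forall n, 'M[A n]_n).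
Variable h : forall n, {scalar (A n)}.
Hypothesis Haar_h : forall n, is_Haar (u n) (h n).
Hypothesis t01 : 0 <= t <= 1.
Local Notation C := (R[i]%C).
Local Notation K := (R[i]%C : numFieldType).
Local Notation chi n := (truncated_char (u n) t).

Lemma cvg_hyper_moment (s : option nat) m :
  (if s is Some m then (2 <= m)%N else true) ->
  (forall n, is_universal (@H_rel R n s) (u n)) ->
  (h n (chi n ^+ m.*2) : K) @[n --> \oo] -->
    ((bessel_moment t (modulus_of s) m)%:C%C : K).
Proof.
move=> s2 univ.
apply: (@cvg_real_complex _ _ (fun n =>
  \sum_(P : {set {set 'I_m * bool}} | finset.partition P finset.setT &&
     part_balanced (modulus_of s) P)
     ((Num.truncn (t * n%:R))^_ #|P|)%:R / (n ^_ #|P|)%:R) (fun=> 0)).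
- apply: nearW => n; rewrite (Haar_hyper_moment s2 (univ n) (Haar_h n) t01).
  rewrite rmorph_sum -sumrB big1 ?normr0// => P _.
  by rewrite rmorphM fmorphV !rmorph_nat subrr.
- by apply: cvgn_sum => P _; exact: cvg_ffact_ratio.
- exact: cvg_cst.
Qed.

Lemma cvg_ortho_moment m : (forall n, is_universal (@Ostar_rel R n) (u n)) ->
  (h n (chi n ^+ m.*2) : K) @[n --> \oo] --> ((m`!%:R * t ^+ m)%:C%C : K).
Proof.
move=> univ; case: m => [|m'].
  rewrite double0 fact0 mul1r expr0.
  under eq_fun do rewrite expr0 (Haar_one (Haar_h _)).
  exact: cvg_cst.
set m := m'.+1.
apply: (@cvg_real_complex _ _
  (fun n => m`!%:R * ((Num.truncn (t * n%:R))%:R / n%:R) ^+ m)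
  (fun n => m`!%:R * (m`!%:R / (n%:R - m`!%:R)))).
- near=> n; rewrite Haar_char_even.
  have lt_n : (m`! < n)%N by near: n; exact: nbhs_infty_gt.
  have le_mn : (m <= n)%N by near: n; exact: nbhs_infty_ge.
  pose b : {ffun 'I_m -> 'I_n} := [ffun r => widen_ord le_mn r].
  have b_inj : injective b.
    by move=> x y; rewrite !ffunE => /(congr1 val) /= xy; exact: val_inj.
  have := Haar_trace_estimate (univ n) (Haar_h n) b_inj isT lt_n (truncn_mul_le n t01).
  rewrite !rmorphM fmorphV rmorphB !rmorph_nat rmorphXn rmorphM fmorphV !rmorph_nat.
  by [].
- apply: cvgM; first exact: cvg_cst.
  apply: (cvg_comp _ (fun x => x ^+ m) (cvg_truncn_div t01)).
  exact: exprn_continuous.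
- rewrite -(mulr0 m`!%:R); apply: cvgM; first exact: cvg_cst.
  rewrite -(mulr0 m`!%:R); apply: cvgM; first exact: cvg_cst.
  apply/gtr0_cvgV0.
    by near=> n; rewrite subr_gt0; near: n; exact: nbhs_infty_gtr.
  apply/cvgryPge => M; near=> n; rewrite lerBrDr.
  by apply: ltW; near: n; exact: nbhs_infty_gtr.
Unshelve. all: by end_near.
Qed.

(** The identity matrix already suffices as v: it sends u_ij to delta_ij times an antidiagonal
    matrix, and odd products of these have zero diagonal. *)
Lemma Haar_char_odd k (rel : forall n, @cstar_relations R n) n :
  is_universal (rel n) (u n) ->
  rel n _ (model_mx (monomial_mx 1 (fun=> 1))) -> odd k -> h n (chi n ^+ k) = 0.
Proof.
move=> univ rel1 odd_k; rewrite truncated_char_exp raddf_sum big1// => i _.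
exact: (Haar_odd univ (Haar_h n) _ _ rel1).
Qed.

End MomentLimits.

(** * Moments of the limit laws *)

Section RealExpectation.
Context {R : realType} {d : measure_display} {T : measurableType d}.
Variable P : probability T R.
Implicit Types f g : T -> R.

Definition summ f := P.-integrable [set: T] (EFin \o f).

Lemma summ_measurable f : summ f -> measurable_fun setT f.
Proof. by move=> /measurable_int /measurable_EFinP. Qed.

Lemma summ_cst c : summ (fun=> c).
Proof.
exact: finite_measure_integrable_cst.
Qed.

Lemma summD f g : summ f -> summ g -> summ (fun x => f x + g x).
Proof.
move=> sf sg; apply: eq_integrable (integrableD measurableT sf sg) => //.
Qed.

Lemma summZ c f : summ f -> summ (fun x => c * f x).
Proof.
move=> sf; apply: eq_integrable (integrableZl measurableT c sf) => //.
Qed.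

Lemma summ_le f g : measurable_fun setT f -> (forall x, `|f x| <= `|g x|) ->
  summ g -> summ f.
Proof.
move=> mf fg sg; apply: le_integrable sg => //; first exact/measurable_EFinP.
by move=> x _; rewrite lee_fin.
Qed.

Lemma expectD f g : summ f -> summ g ->
  \int[P]_x (f x + g x) = \int[P]_x f x + \int[P]_x g x.
Proof. exact: RintegralD. Qed.

Lemma expectZ c f : summ f -> \int[P]_x (c * f x) = c * \int[P]_x f x.
Proof. by move=> sf; rewrite RintegralZl. Qed.

Lemma summ_sum (I : Type) (r : seq I) (p : pred I) (F : I -> T -> R) :
  (forall i, p i -> summ (F i)) -> summ (fun x => \sum_(i <- r | p i) F i x).
Proof.
move=> sF; elim: r => [|i r IH].
  by under eq_fun do rewrite big_nil; exact: summ_cst.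
case pi: (p i); under eq_fun do rewrite big_cons pi; last exact: IH.
by apply: summD => //; exact: sF.
Qed.

Lemma expect_cst c : \int[P]_x c = c.
Proof.
rewrite Rintegral_cst// -[RHS]mulr1; congr (_ * _).
exact: (congr1 fine (probability_setT P)).
Qed.

Lemma expect_sum (I : Type) (r : seq I) (p : pred I) (F : I -> T -> R) :
  (forall i, p i -> summ (F i)) ->
  \int[P]_x (\sum_(i <- r | p i) F i x) = \sum_(i <- r | p i) \int[P]_x F i x.
Proof.
move=> sF; elim: r => [|i r IH].
  by under eq_Rintegral do rewrite big_nil; rewrite expect_cst big_nil.
case pi: (p i); under eq_Rintegral do rewrite big_cons pi; rewrite big_cons pi //.
by rewrite expectD ?IH//; [exact: sF|exact: summ_sum].
Qed.

End RealExpectation.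

Section TransferExpectation.
Context {R : realType} {d d' : measure_display}.
Context {T : measurableType d} {T' : measurableType d'}.
Variables (P : probability T R) (X : {mfun T >-> T'}) (f : T' -> R).
Hypothesis mf : measurable_fun setT f.

Lemma summ_distribution : summ P (f \o X) -> summ (distribution P X) f.
Proof.
move=> sf; apply: integrable_pushforward => //; exact/measurable_EFinP.
Qed.

Lemma expect_distribution : summ P (f \o X) ->
  \int[distribution P X]_x f x = \int[P]_x f (X x).
Proof.
move=> sf; rewrite /Rintegral; congr fine; rewrite integral_distribution//.
exact/measurable_EFinP.
Qed.

End TransferExpectation.

Section ProductExpectation.
Context {R : realType} {d1 d2 : measure_display}.
Context {T1 : measurableType d1} {T2 : measurableType d2}.
Variables (P1 : probability T1 R) (P2 : probability T2 R).
Variables (f : T1 -> R) (g : T2 -> R).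
Hypotheses (sf : summ P1 f) (sg : summ P2 g).

Local Notation P12 := (P1 \x P2 : probability (T1 * T2)%type R)%E.

Lemma measurable_prodfun : measurable_fun setT (fun z : T1 * T2 => f z.1 * g z.2).
Proof.
apply: measurable_funM.
  by apply: measurableT_comp => //; exact: summ_measurable sf.
by apply: measurableT_comp => //; exact: summ_measurable sg.
Qed.

Lemma summ_prod : summ P12 (fun z => f z.1 * g z.2).
Proof.
apply/integrable12ltyP.
  by apply/measurable_EFinP; exact: measurable_prodfun.
rewrite (eq_integral (fun x => `|(f x)%:E| * \int[P2]_y `|(g y)%:E|))%E; last first.
  move=> x _; rewrite -ge0_integralZl//.
    by apply: eq_integral => y _; rewrite /= -EFinM normrM.
  by apply/measurable_EFinP/measurableT_comp => //; exact: summ_measurable sg.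
have /integrableP[_ gfin] := sg; have /integrableP[_ ffin] := sf.
rewrite ge0_integralZr//.
  by rewrite lte_mul_pinfty// ?integral_ge0// ge0_fin_numE// integral_ge0.
by apply/measurable_EFinP/measurableT_comp => //; exact: summ_measurable sf.
by rewrite integral_ge0.
Qed.

Lemma expect_prod :
  \int[P12]_z (f z.1 * g z.2) = (\int[P1]_x f x) * (\int[P2]_y g y).
Proof.
rewrite /Rintegral -(@integral12_prod_meas1 _ _ _ _ _ P1 P2); last exact: summ_prod.
rewrite -fineM; [|exact: integrable_fin_num|exact: integrable_fin_num].
congr fine; rewrite muleC -(fineK (integrable_fin_num measurableT sg)).
rewrite -integralZl//; apply: eq_integral => x _ /=.
rewrite muleC fineK; last exact: integrable_fin_num.
by rewrite -integralZl//.
Qed.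

End ProductExpectation.

Section ComplexExpectation.
Context {R : realType} {d : measure_display} {T : measurableType d}.
Local Notation C := (R[i]%C).
Variable P : probability T R.
Implicit Types f g : T -> C.

Definition csumm f := summ P (fun x => complex.Re (f x)) /\
                      summ P (fun x => complex.Im (f x)).

Definition cexpect f : C :=
  Complex (\int[P]_x complex.Re (f x)) (\int[P]_x complex.Im (f x)).

Lemma csumm_cst c : csumm (fun=> c).
Proof. by split; exact: summ_cst. Qed.

Lemma cexpect_cst c : cexpect (fun=> c) = c.
Proof. by rewrite /cexpect !expect_cst; case: c. Qed.

Lemma csummD f g : csumm f -> csumm g -> csumm (fun x => f x + g x).
Proof.
move=> [f1 f2] [g1 g2]; split.
  by under eq_fun do rewrite raddfD; exact: summD.
by under eq_fun do rewrite raddfD; exact: summD.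
Qed.

Lemma cexpectD f g : csumm f -> csumm g ->
  cexpect (fun x => f x + g x) = cexpect f + cexpect g.
Proof.
move=> [f1 f2] [g1 g2]; apply/eqP; rewrite eq_complex /=.
apply/andP; split; apply/eqP; rewrite -expectD//; apply: eq_Rintegral => x _;
  by rewrite raddfD.
Qed.

Lemma csumm_sum (I : Type) (r : seq I) (p : pred I) (F : I -> T -> C) :
  (forall i, p i -> csumm (F i)) -> csumm (fun x => \sum_(i <- r | p i) F i x).
Proof.
move=> sF; elim: r => [|i r IH].
  by under eq_fun do rewrite big_nil; exact: csumm_cst.
case pi: (p i); under eq_fun do rewrite big_cons pi; last exact: IH.
by apply: csummD => //; exact: sF.
Qed.

Lemma cexpect_sum (I : Type) (r : seq I) (p : pred I) (F : I -> T -> C) :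
  (forall i, p i -> csumm (F i)) ->
  cexpect (fun x => \sum_(i <- r | p i) F i x) = \sum_(i <- r | p i) cexpect (F i).
Proof.
move=> sF; elim: r => [|i r IH].
  by under eq_fun do rewrite big_nil; rewrite cexpect_cst big_nil.
case pi: (p i); under eq_fun do rewrite big_cons pi; rewrite big_cons pi //.
by rewrite cexpectD ?IH//; [exact: sF|exact: csumm_sum].
Qed.

Lemma csummZ_real (c : C) (f : T -> R) : summ P f ->
  csumm (fun x => c * (f x)%:C%C) /\
  cexpect (fun x => c * (f x)%:C%C) = c * (\int[P]_x f x)%:C%C.
Proof.
move=> sf.
have eRe (r : R) : complex.Re (c * r%:C%C) = complex.Re c * r.
  by case: (c) => a b /=; rewrite mulr0 subr0.
have eIm (r : R) : complex.Im (c * r%:C%C) = complex.Im c * r.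
  by case: (c) => a b /=; rewrite mulr0 add0r.
split; first by split; under eq_fun do rewrite ?eRe ?eIm; exact: summZ.
apply/eqP; rewrite eq_complex [complex.Re (c * _)]eRe [complex.Im (c * _)]eIm /=.
apply/andP; split; apply/eqP; rewrite -expectZ//; apply: eq_Rintegral => x _.
  exact: eRe.
exact: eIm.
Qed.

End ComplexExpectation.

Section ComplexTransfer.
Context {R : realType} {d d' : measure_display}.
Context {T : measurableType d} {T' : measurableType d'}.
Local Notation C := (R[i]%C).
Variables (P : probability T R) (X : {mfun T >-> T'}) (f : T' -> C).

Definition cmeasurable {e} {U : measurableType e} (g : U -> C) :=
  measurable_fun setT (fun x => complex.Re (g x)) /\
  measurable_fun setT (fun x => complex.Im (g x)).

Hypothesis mf : cmeasurable f.

Lemma csumm_distribution : csumm P (f \o X) -> csumm (distribution P X) f.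
Proof. by move=> [s1 s2]; split; apply: summ_distribution => //; exact: mf.1 || exact: mf.2. Qed.

Lemma cexpect_distribution : csumm P (f \o X) ->
  cexpect (distribution P X) f = cexpect P (f \o X).
Proof.
move=> [s1 s2]; rewrite /cexpect; congr Complex.
  by rewrite expect_distribution//; exact: mf.1.
by rewrite expect_distribution//; exact: mf.2.
Qed.

End ComplexTransfer.

Section ComplexProduct.
Context {R : realType} {d1 d2 : measure_display}.
Context {T1 : measurableType d1} {T2 : measurableType d2}.
Local Notation C := (R[i]%C).
Variables (P1 : probability T1 R) (P2 : probability T2 R).
Variables (f : T1 -> C) (g : T2 -> C).
Hypotheses (sf : csumm P1 f) (sg : csumm P2 g).

Local Notation P12 := (P1 \x P2 : probability (T1 * T2)%type R)%E.

Let ReM (a b : C) : complex.Re (a * b) =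
  complex.Re a * complex.Re b + (-1) * (complex.Im a * complex.Im b).
Proof. by case: a b => [a1 a2] [b1 b2] /=; ring. Qed.

Let ImM (a b : C) : complex.Im (a * b) =
  complex.Re a * complex.Im b + complex.Im a * complex.Re b.
Proof. by case: a b => [a1 a2] [b1 b2] /=. Qed.

Lemma csumm_prod : csumm P12 (fun z => f z.1 * g z.2).
Proof.
have [sf1 sf2] := sf; have [sg1 sg2] := sg; split.
  under eq_fun do rewrite ReM.
  exact: summD (summ_prod sf1 sg1) (summZ (-1) (summ_prod sf2 sg2)).
under eq_fun do rewrite ImM.
exact: summD (summ_prod sf1 sg2) (summ_prod sf2 sg1).
Qed.

Lemma cexpect_prod : cexpect P12 (fun z => f z.1 * g z.2) = cexpect P1 f * cexpect P2 g.
Proof.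
have [sf1 sf2] := sf; have [sg1 sg2] := sg.
apply/eqP; rewrite eq_complex ReM ImM /=; apply/andP; split; apply/eqP.
  under [LHS]eq_Rintegral do rewrite ReM.
  rewrite (expectD (summ_prod sf1 sg1) (summZ (-1) (summ_prod sf2 sg2))).
  by rewrite (expectZ _ (summ_prod sf2 sg2)) (expect_prod sf1 sg1) (expect_prod sf2 sg2).
under [LHS]eq_Rintegral do rewrite ImM.
rewrite (expectD (summ_prod sf1 sg2) (summ_prod sf2 sg1)).
by rewrite (expect_prod sf1 sg2) (expect_prod sf2 sg1).
Qed.

End ComplexProduct.

(** * Mixed moments of laws on the plane *)

Section MixedMoments.
Variable R : realType.
Variables (I : finType) (col : pred I).
Local Notation T := (measurableTypeR R).
Local Notation Pl := (T * T)%type.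
Local Notation C := (R[i]%C).
Implicit Types (D B : {set I}) (z w : Pl).

Definition to_complex z : C := Complex (z.1 : R) (z.2 : R).

(* [z] or its conjugate, according to the colour of [e] *)
Definition colored (c : C) (e : I) : C := if col e then c^* else c.

(** Factors are indexed by places instead of being counted by two exponents, so that moments and
    cumulants become functions of sets. *)
Definition monomial D z : C := \prod_(e in D) colored (to_complex z) e.

Lemma coloredD c c' e : colored (c + c') e = colored c e + colored c' e.
Proof. by rewrite /colored; case: ifP => // _; rewrite rmorphD. Qed.

Lemma coloredM c c' e : colored (c * c') e = colored c e * colored c' e.
Proof. by rewrite /colored; case: ifP => // _; rewrite rmorphM. Qed.

Lemma colored_real (x : R) e : colored x%:C%C e = x%:C%C.
Proof. by rewrite /colored; case: ifP => // _; exact: conjc_real. Qed.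

Lemma to_complexD z w : to_complex (z.1 + w.1, z.2 + w.2) = to_complex z + to_complex w.
Proof. by []. Qed.

Lemma monomialD D z w : monomial D (z.1 + w.1, z.2 + w.2) =
  \sum_(B : {set I} | B \subset D) monomial B z * monomial (D :\: B) w.
Proof.
rewrite /monomial to_complexD -prod_add_subsets.
by apply: eq_bigr => e _; rewrite coloredD.
Qed.

Lemma cmeasurableM (f g : Pl -> C) : cmeasurable f -> cmeasurable g ->
  cmeasurable (fun z => f z * g z).
Proof.
move=> [mf1 mf2] [mg1 mg2]; split.
  have -> : (fun z => complex.Re (f z * g z)) =
      (fun z => complex.Re (f z) * complex.Re (g z) - complex.Im (f z) * complex.Im (g z)).
    by apply/funext => z; case: (f z) (g z) => [a1 a2] [b1 b2].
  by apply: measurable_funB; exact: measurable_funM.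
have -> : (fun z => complex.Im (f z * g z)) =
    (fun z => complex.Re (f z) * complex.Im (g z) + complex.Im (f z) * complex.Re (g z)).
  by apply/funext => z; case: (f z) (g z) => [a1 a2] [b1 b2].
by apply: measurable_funD; exact: measurable_funM.
Qed.

Lemma cmeasurable_monomial D : cmeasurable (monomial D).
Proof.
rewrite /monomial; elim: (index_enum I) => [|e r IH].
  have -> : (fun z => \prod_(e <- [::] | e \in D) colored (to_complex z) e) = (fun=> 1).
    by apply/funext => z; rewrite big_nil.
  by split; exact: measurable_cst.
case eD: (e \in D); last first.
  suff -> : (fun z => \prod_(j <- e :: r | j \in D) colored (to_complex z) j) =
      (fun z => \prod_(j <- r | j \in D) colored (to_complex z) j) by [].
  by apply/funext => z; rewrite big_cons eD.
have -> : (fun z => \prod_(j <- e :: r | j \in D) colored (to_complex z) j) =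
    (fun z => colored (to_complex z) e *
              \prod_(j <- r | j \in D) colored (to_complex z) j).
  by apply/funext => z; rewrite big_cons eD.
apply: cmeasurableM => //; rewrite /colored; case: (col e); split => /=.
- exact: measurable_fst.
- by apply: (@measurable_funN _ _ R); exact: measurable_snd.
- exact: measurable_fst.
- exact: measurable_snd.
Qed.

Definition all_moments (mu : probability Pl R) := forall D, csumm mu (monomial D).

Definition moment (mu : probability Pl R) D : C := cexpect mu (monomial D).

Lemma convolution_moments (mu nu : probability Pl R) :
  all_moments mu -> all_moments nu ->
  all_moments (convolution mu nu) /\
  forall D, moment (convolution mu nu) D =
    \sum_(B : {set I} | B \subset D) moment mu B * moment nu (D :\: B).
Proof.
move=> amu anu.
have E D : monomial D \o @plane_add R = (fun p =>
    \sum_(B : {set I} | B \subset D) monomial B p.1 * monomial (D :\: B) p.2).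
  by apply/funext => p; rewrite /= /plane_add monomialD.
have sE D : csumm (mu \x nu : probability (Pl * Pl)%type R)%E (monomial D \o @plane_add R).
  rewrite E; apply: csumm_sum => B _; exact: csumm_prod.
split=> D; first exact: (csumm_distribution (cmeasurable_monomial D) (sE D)).
rewrite /moment (cexpect_distribution (cmeasurable_monomial D) (sE D)) E.
rewrite cexpect_sum => [|B _]; last exact: csumm_prod.
by apply: eq_bigr => B _; rewrite cexpect_prod.
Qed.

Lemma monomial0 D : monomial D (0, 0) = (D == finset.set0)%:R.
Proof.
rewrite /monomial; have [->|[x xD]] := finset.set_0Vmem D.
  by rewrite big_set0 eqxx.
rewrite (big_setD1 x)//= {1}/colored.
have -> : to_complex (0, 0) = 0 by [].
rewrite rmorph0 if_same mul0r; case: eqP xD => // ->.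
by rewrite finset.inE.
Qed.

Lemma dirac_expect (f : Pl -> R) : measurable_fun setT f ->
  summ (\d_((0, 0) : Pl) : probability Pl R) f /\
  \int[(\d_((0, 0) : Pl) : probability Pl R)]_x f x = f (0, 0).
Proof.
move=> mf; have mfE : measurable_fun setT (EFin \o f) by exact/measurable_EFinP.
split.
  apply/integrableP; split => //.
  rewrite integral_dirac//; last exact: measurableT_comp.
  by rewrite diracT mul1e /= ltry.
by rewrite /Rintegral integral_dirac// diracT mul1e.
Qed.

Lemma dirac_moments :
  all_moments (\d_((0, 0) : Pl) : probability Pl R) /\
  forall D, moment (\d_((0, 0) : Pl) : probability Pl R) D = (D == finset.set0)%:R.
Proof.
split=> D; have [m1 m2] := cmeasurable_monomial D.
  by split; [have [] := dirac_expect m1|have [] := dirac_expect m2].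
rewrite /moment /cexpect (dirac_expect m1).2 (dirac_expect m2).2 -monomial0.
by case: (monomial D (0, 0)).
Qed.

End MixedMoments.

(** * Poisson moments *)

Section PoissonMoments.
Variables (R : realType) (lam : R).
Hypothesis lam0 : 0 < lam.
Local Notation P := (poisson_prob lam 0 : probability nat R).

Let atom (k : nat) : {measure set nat -> \bar R} :=
  mscale (NngNum (poisson_pmf_ge0 lam k)) \d_k.

Lemma poisson_integral (f : nat -> \bar R) : (forall k, 0 <= f k)%E ->
  (\int[P]_k f k = \sum_(k <oo) (poisson_pmf lam k)%:E * f k)%E.
Proof.
move=> f0.
rewrite (eq_measure_integral (mseries atom 0)); last first.
  move=> U mU _; rewrite /= /poisson_prob lam0 /mseries.
  rewrite esum_mkcond -nneseries_esumT; last first.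
    by move=> k; case: ifP => // _; rewrite lee_fin poisson_pmf_ge0.
  apply: eq_eseriesr => k _; rewrite /atom /= /mscale /= diracE.
  by case: ifP => _; rewrite ?mule1 ?mule0.
rewrite ge0_integral_measure_series//.
apply: eq_eseriesr => k _; rewrite /atom ge0_integral_mscale//.
by rewrite integral_dirac// diracT mul1e.
Qed.

Lemma nneseriesS (f : nat -> \bar R) : (forall k, 0 <= f k)%E ->
  (\sum_(k <oo) f k = f 0%N + \sum_(k <oo) f k.+1)%E.
Proof.
move=> f0; rewrite nneseries_recl//; congr (_ + _)%E; apply: cvg_lim => //.
rewrite -cvg_shiftS.
have -> : [sequence (\sum_(1 <= k < n.+1) f k)%E]_n =
          (fun n => \sum_(0 <= k < n) f k.+1)%E.
  by apply/funext => n /=; rewrite big_add1.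
by apply: is_cvg_nneseries => k _ _; exact: f0.
Qed.

(** The Chen-Stein identity, from k p_k = lam p_(k-1). Stated for extended integrals of nonnegative
    functions, it can also prove integrability of the powers by induction. *)
Lemma poisson_stein (f : nat -> R) : (forall k, 0 <= f k) ->
  (\int[P]_k (k%:R * f k)%:E = lam%:E * \int[P]_k (f k.+1)%:E)%E.
Proof.
move=> f0; rewrite !poisson_integral; last 2 first.
- by move=> k; rewrite lee_fin.
- by move=> k; rewrite lee_fin mulr_ge0.
rewrite -nneseriesZl => [|k _]; last by rewrite mule_ge0// lee_fin// poisson_pmf_ge0.
rewrite nneseriesS => [|k]; last first.
  by rewrite mule_ge0// lee_fin ?poisson_pmf_ge0// mulr_ge0.
rewrite mul0r mule0 add0e; apply: eq_eseriesr => k _.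
rewrite -!EFinM; congr EFin; rewrite /poisson_pmf lam0 factS natrM invfM exprS.
have k0 : k.+1%:R != 0 :> R by rewrite pnatr_eq0.
have kf0 : k`!%:R != 0 :> R by rewrite pnatr_eq0 -lt0n fact_gt0.
by move: (expR _) (lam ^+ k) (f k.+1) => a b c; field; apply/andP.
Qed.

Let summ_powS p : summ P (fun k => k%:R ^+ p) -> summ P (fun k => k.+1%:R ^+ p).
Proof.
(* k + 1 <= 2 k for k > 0, and the added 1 takes care of k = 0. *)
move=> IH; apply: (@summ_le _ _ _ _ _ (fun k => 2 ^+ p * (k%:R ^+ p + 1))) => // [k|].
  rewrite !ger0_norm ?mulr_ge0 ?addr_ge0 ?exprn_ge0//.
  have [->|k0] := posnP k.
    rewrite expr1n; apply: (@le_trans _ _ (1 * 1)); first by rewrite mulr1.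
    by rewrite ler_pM// ?exprn_ege1 ?ler1n// lerDr exprn_ge0.
  apply: (@le_trans _ _ (2 ^+ p * k%:R ^+ p)); last by rewrite ler_pM2l ?exprn_gt0// lerDl.
  rewrite -exprMn lerXn2r ?nnegrE ?mulr_ge0// -natrM ler_nat.
  by rewrite mul2n -addnn -addn1 leq_add2l.
by apply: summZ; apply: summD => //; exact: summ_cst.
Qed.

Lemma poisson_summ_pow p : summ P (fun k => k%:R ^+ p).
Proof.
have mf (f : nat -> R) : measurable_fun setT f by [].
elim: p => [|p IH]; first by under eq_fun do rewrite expr0; exact: summ_cst.
have IH1 := summ_powS IH.
apply/integrableP; split => //.
rewrite (eq_integral (fun k : nat => (k%:R * k%:R ^+ p)%:E)) => [|k _]; last first.
  by rewrite /= ger0_norm ?exprn_ge0// exprS.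
rewrite (poisson_stein (f := fun k => k%:R ^+ p)) => [|k]; last by rewrite exprn_ge0.
rewrite lte_mul_pinfty// ?lee_fin ?ltW//.
have /integrableP[_] := IH1; congr (_ < _)%E; apply: eq_integral => k _ /=.
by rewrite ger0_norm ?exprn_ge0.
Qed.

Lemma poisson_summ_powS p : summ P (fun k => k.+1%:R ^+ p).
Proof. exact/summ_powS/poisson_summ_pow. Qed.

Definition poisson_moment p : R := \int[P]_k (k%:R ^+ p).

Lemma poisson_moment0 : poisson_moment 0 = 1.
Proof. by rewrite /poisson_moment; under eq_Rintegral do rewrite expr0; rewrite expect_cst. Qed.

Lemma poisson_momentS p : poisson_moment p.+1 = lam * \int[P]_k (k.+1%:R ^+ p).
Proof.
rewrite /poisson_moment /Rintegral.
under eq_integral do rewrite exprS.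
rewrite (poisson_stein (f := fun k => k%:R ^+ p)) => [|k]; last by rewrite exprn_ge0.
rewrite fineM//; apply: integrable_fin_num => //; exact: poisson_summ_powS.
Qed.

End PoissonMoments.

(** * Cumulants of rotated Poisson and Bessel laws *)

Section BesselMoments.
Variables (R : realType) (I : finType) (col : pred I).
Local Notation T := (measurableTypeR R).
Local Notation Pl := (T * T)%type.
Local Notation C := (R[i]%C).
Implicit Types (D B : {set I}).

Definition colored_prod (c : C) D : C := \prod_(e in D) colored col c e.

Lemma colored_prodD c D B : B \subset D ->
  colored_prod c D = colored_prod c B * colored_prod c (D :\: B).
Proof.
move=> BD; rewrite /colored_prod (big_setID B) /=; congr (_ * _).
by apply: eq_bigl => e; rewrite (finset.setIidPr BD).
Qed.

Definition angle (s r : nat) : C := expi (2 * pi * r%:R / s%:R : R).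

Lemma monomial_rotate s r D (k : nat) :
  monomial col D (rotate R s r k) = colored_prod (angle s r) D * (k%:R ^+ #|D|)%:C%C.
Proof.
rewrite /monomial /colored_prod rmorphXn -prodr_const -big_split.
apply: eq_bigr => e _ /=; rewrite -(colored_real col _ e) -coloredM; congr colored.
by apply/eqP; rewrite eq_complex /= !mulr0 subr0 add0r mulrC eqxx mulrC eqxx.
Qed.

Lemma rotated_poisson_moments s r (lam : R) : 0 < lam ->
  all_moments col (rotated_poisson s r lam) /\
  forall D, moment col (rotated_poisson s r lam) D =
    partition_sum (fun B => lam%:C%C * colored_prod (angle s r) B) D.
Proof.
move=> lam0; set P : probability nat R := poisson_prob lam 0.
set c := angle s r.
have E D : monomial col D \o rotate R s r =
    (fun k => colored_prod c D * (k%:R ^+ #|D|)%:C%C).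
  by apply/funext => k /=; rewrite monomial_rotate.
have [sE mE] : (forall D, csumm P (monomial col D \o rotate R s r)) /\
  forall D, cexpect P (monomial col D \o rotate R s r) =
     colored_prod c D * (poisson_moment lam #|D|)%:C%C.
  split=> D; rewrite E;
    have [h1 h2] := csummZ_real (colored_prod c D) (poisson_summ_pow lam0 #|D|) => //.
split=> D; first exact: (csumm_distribution (cmeasurable_monomial R col D) (sE D)).
rewrite /moment (cexpect_distribution (cmeasurable_monomial R col D) (sE D)) mE.
apply: (partition_sum_unique (f := fun D => colored_prod c D * (poisson_moment lam #|D|)%:C%C)).
  by rewrite /colored_prod big_set0 cards0 poisson_moment0 mulr1.
move=> {}D x xD; rewrite (cardsD1 x) xD poisson_momentS//.
(* The power of k + 1 is expanded place by place; the set A of places where 1 is chosen becomes,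
   with [x] added, the block of [x]. *)
have -> : \int[P]_k (k.+1%:R ^+ #|D :\ x|) =
    \sum_(A : {set I} | A \subset D :\ x) poisson_moment lam #|(D :\ x) :\: A|.
  rewrite -expect_sum => [|A _]; last exact: poisson_summ_pow.
  apply: eq_Rintegral => k _; rewrite -natr1 addrC -prodr_const.
  rewrite (prod_add_subsets (fun=> 1) (fun=> k%:R)); apply: eq_bigr => A _.
  by rewrite prodr_const expr1n mul1r prodr_const.
rewrite rmorphM rmorph_sum mulr_sumr mulr_sumr.
rewrite [RHS](reindex_onto (fun A => x |: A) (fun B => B :\ x)) /=; last first.
  by move=> B /andP[xB _]; rewrite finset.setD1K.
apply: eq_big => [A|A AD].
  rewrite finset.setU11 finset.subUset finset.sub1set xD /= finset.subsetD1.
  congr (_ && _); apply/idP/eqP => [xA|<-]; first by rewrite finset.setU1K.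
  by rewrite finset.setD11.
have xAD : x |: A \subset D.
  by move: AD; rewrite finset.subsetD1 finset.subUset finset.sub1set xD => /andP[->].
rewrite (colored_prodD c xAD) finset.setDDl.
by rewrite mulrCA -[RHS]mulrA; congr (_ * _); rewrite [RHS]mulrA.
Qed.

Lemma foldr_bessel_moments s (lam : R) (rs : seq nat) : 0 < lam ->
  let mu := foldr (fun r mu => convolution (rotated_poisson s r lam) mu)
    (\d_((0, 0) : Pl) : probability Pl R) rs in
  all_moments col mu /\
  forall D, moment col mu D =
    partition_sum (fun B => \sum_(r <- rs) lam%:C%C * colored_prod (angle s r) B) D.
Proof.
move=> lam0; elim: rs => [|r rs [IH1 IH2]] /=.
  have [d1 d2] := dirac_moments R col; split=> // D; rewrite d2.
  apply: (partition_sum_unique (f := fun D : {set I} => (D == finset.set0)%:R)).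
    by rewrite eqxx.
  move=> {}D x xD; rewrite big1 => [|B _]; last by rewrite big_nil mul0r.
  by case: eqP xD => // ->; rewrite finset.inE.
have [r1 r2] := rotated_poisson_moments s r lam0.
have [c1 c2] := convolution_moments r1 IH1.
split=> // D; rewrite c2.
under eq_bigr do rewrite r2 IH2.
rewrite partition_sumD /partition_sum; apply: eq_bigr => Q _; apply: eq_bigr => B _.
by rewrite big_cons.
Qed.

End BesselMoments.

Section BesselLaw.
Variable R : realType.
Local Notation T := (measurableTypeR R).
Local Notation Pl := (T * T)%type.
Local Notation C := (R[i]%C).
Variable m : nat.
Local Notation leg := ('I_m * bool)%type.
Local Notation col := (fun e : leg => e.2).

Lemma angleE s r : angle R s r = root_of_unity R s ^+ r.
Proof.
by rewrite -expiMn /angle -mulr_natr; congr expi; ring.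
Qed.

Lemma colored_prod_angle s r (B : {set leg}) : colored_prod col (angle R s r) B =
  (root_of_unity R s ^+ #|[pred p in B | ~~ p.2]| *
   (root_of_unity R s)^* ^+ #|[pred p in B | p.2]|) ^+ r.
Proof.
rewrite angleE exprMn -!exprM !(mulnC _ r) !exprM /colored_prod.
rewrite (bigID col) /= mulrC; congr (_ * _).
  rewrite -prodr_const; apply: eq_big => [p|p /andP[_]]; first by rewrite !inE.
  by rewrite /colored => /negPf ->.
rewrite -rmorphXn -prodr_const; apply: eq_big => [p|p /andP[_]]; first by rewrite !inE.
by rewrite /colored => ->.
Qed.

Lemma sum_root_pow (z : C) s : (0 < s)%N -> z ^+ s = 1 ->
  \sum_(r <- iota 1 s) z ^+ r = if z == 1 then s%:R else 0.
Proof.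
move=> s0 zs; rewrite -[iota 1 s]/(iota (1 + 0) s) iotaDl big_map.
have -> : \sum_(j <- iota 0 s) z ^+ (1 + j) = z * \sum_(j < s) z ^+ j.
  rewrite mulr_sumr -(big_mkord predT (fun j => z * z ^+ j)) /index_iota subn0.
  by apply: eq_bigr => j _; rewrite exprS.
case: eqP => [->|/eqP z1].
  rewrite mul1r (eq_bigr (fun=> 1)) => [|j _]; last by rewrite expr1n.
  by rewrite sumr_const card_ord.
have := subrX1 z s; rewrite zs subrr => /esym/eqP.
by rewrite mulf_eq0 subr_eq0 (negPf z1) /= => /eqP->; rewrite mulr0.
Qed.

Lemma bessel_moments s (t : R) : (0 < s)%N -> 0 < t ->
  all_moments col (bessel s t) /\
  moment col (bessel s t) finset.setT = (bessel_moment t s m)%:C%C.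
Proof.
move=> s0 t0; have s0' : 0 < s%:R :> R by rewrite ltr0n.
have lam0 : 0 < t / s%:R by rewrite divr_gt0.
have [b1 b2] := @foldr_bessel_moments R _ col s _ (iota 1 s) lam0.
split=> //; rewrite [LHS]b2.
rewrite /bessel_moment rmorph_sum big_mkcondr /partition_sum; apply: eq_bigr => P PT.
(* The s rotations contribute a full sum of powers of an s-th root of unity, which is s if the root
   is 1, that is, if the block is balanced, and 0 otherwise; s cancels the parameter t / s. *)
have E (B : {set leg}) : \sum_(r <- iota 1 s) (t / s%:R)%:C%C * colored_prod col (angle R s r) B =
    if block_balanced s B then t%:C%C else 0.
  rewrite -mulr_sumr.
  under eq_bigr do rewrite colored_prod_angle.
  rewrite sum_root_pow//.
    rewrite root_of_unity_expJ// -/(block_balanced s B); case: ifP => _; rewrite ?mulr0//.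
    by rewrite rmorphM fmorphV rmorph_nat divfK// pnatr_eq0 -lt0n.
  rewrite exprMn -!exprM !(mulnC _ s) !exprM -rmorphXn.
  by rewrite (prim_expr_order (root_of_unity_prim R s0)) rmorph1 !expr1n mulr1.
under eq_bigr do rewrite E.
case: ifP => [/forall_inP bal|/negbT].
  rewrite rmorphXn -prodr_const; apply: eq_bigr => B BP.
  by rewrite bal.
rewrite negb_forall_in => /exists_inP[B BP /negPf nB].
by rewrite (bigD1 B)//= nB mul0r.
Qed.

Lemma monomial_full (z : Pl) : monomial col finset.setT z = (modulus z ^+ m.*2)%:C%C.
Proof.
rewrite /monomial (eq_bigl predT) => [|e]; last by rewrite finset.inE.
rewrite -(pair_bigA _ (fun r b => colored col (to_complex z) (r, b))) /=.
have E (r : 'I_m) : \prod_b colored col (to_complex z) (r, b) = (modulus z ^+ 2)%:C%C.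
  rewrite (bigD1 true)//= (bigD1 false)//= big1 => [|[]//].
  rewrite mulr1 /colored /= /modulus sqr_sqrtr ?addr_ge0 ?sqr_ge0//.
  by apply/eqP; rewrite eq_complex /=; apply/andP; split; apply/eqP; ring.
rewrite (eq_bigr (fun=> (modulus z ^+ 2)%:C%C)) => [|r _]; last exact: E.
by rewrite prodr_const card_ord -rmorphXn /= -exprM mul2n.
Qed.

Lemma modulus_moment (mu : probability Pl R) (c : R) : all_moments col mu ->
  moment col mu finset.setT = c%:C%C ->
  summ mu (fun z => modulus z ^+ m.*2) /\ \int[mu]_z (modulus z ^+ m.*2) = c.
Proof.
move=> amu; have [s1 _] := amu finset.setT.
have E : (fun z => complex.Re (monomial col finset.setT z)) =
    (fun z : Pl => modulus z ^+ m.*2 : R).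
  by apply/funext => z; rewrite monomial_full.
rewrite /moment /cexpect => -[<- _]; split; first by rewrite E in s1.
by rewrite E.
Qed.

End BesselLaw.

(** From (b - 1)^2 >= 0 for b = |x^k|. It reduces the integrability of all powers to that of even
    ones. *)
Lemma norm_pow_le (R : realDomainType) (x : R) k : `|x ^+ k| <= 1 + x ^+ k.*2.
Proof.
have -> : x ^+ k.*2 = `|x ^+ k| ^+ 2 by rewrite real_normK ?num_real// -exprM muln2.
have := normr_ge0 (x ^+ k); move: `|_| => b b0; have := sqr_ge0 (b - 1).
by rewrite sqrrB1 => h; nra.
Qed.

(** * Densities and Gaussian moments *)

Section Density.
Context {R : realType} {d : measure_display} {T : measurableType d}.
Variables (mu nu : {measure set T -> \bar R}) (g : T -> R).
Hypotheses (mg : measurable_fun setT g) (g0 : forall x, 0 <= g x).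
Hypothesis nuE : forall A, measurable A -> (nu A = \int[mu]_(x in A) (g x)%:E)%E.

Import HBNNSimple.

Let integral_density_nnsfun (f : {nnsfun T >-> R}) :
  (\int[nu]_x (f x)%:E = \int[mu]_x ((f x)%:E * (g x)%:E))%E.
Proof.
under [LHS]eq_integral do rewrite fimfunE -fsumEFin//.
rewrite [LHS]ge0_integral_fsum//; last 2 first.
  - by move=> r; exact/measurable_EFinP/measurableT_comp.
  - by move=> n x _; rewrite EFinM nnfun_muleindic_ge0.
under [RHS]eq_integral.
  move=> x xD; rewrite fimfunE -fsumEFin// ge0_mule_fsuml; last first.
    by move=> r; rewrite EFinM nnfun_muleindic_ge0.
  over.
rewrite [RHS]ge0_integral_fsum//; last 2 first.
  - move=> r; apply: emeasurable_funM; last exact/measurable_EFinP.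
    exact/measurable_EFinP/measurableT_comp.
  - move=> n x _; apply: mule_ge0; last by rewrite lee_fin.
    by rewrite EFinM nnfun_muleindic_ge0.
apply: eq_fsbigr => r _.
rewrite integralZl_indic_nnsfun//= integral_indic// setIT nuE//.
have [r0|r0] := leP 0 r; last first.
  rewrite (preimage_nnfun0 f r0) integral_set0 mule0.
  by rewrite integral0_eq// => x _; rewrite indic0 mulr0 mul0e.
under [RHS]eq_integral do rewrite EFinM -muleA.
rewrite ge0_integralZl//; last 2 first.
- apply: emeasurable_funM; exact/measurable_EFinP.
- by move=> x _; rewrite mule_ge0// lee_fin.
congr (_ * _)%E; rewrite integral_mkcond; apply: eq_integral => x _.
rewrite patchE indicE; case: ifP => _; first by rewrite mul1e.
by rewrite mul0e.
Qed.

(** Approximation by nonnegative simple functions and monotone convergence on both sides; needed to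
    pass from the normal law to Lebesgue integrals of its density. *)
Lemma integral_density (f : T -> \bar R) : measurable_fun setT f ->
  (forall x, 0 <= f x)%E ->
  (\int[nu]_x f x = \int[mu]_x (f x * (g x)%:E))%E.
Proof.
move=> mf f0; pose f_ := nnsfun_approx measurableT mf.
transitivity (lim (\int[nu]_x (f_ n x)%:E @[n --> \oo])%E).
  rewrite -monotone_convergence//=.
  - apply: eq_integral => ? /[!inE] xD; apply/esym/cvg_lim => //=.
    exact: cvg_nnsfun_approx.
  - by move=> n; exact/measurable_EFinP/measurable_funTS.
  - by move=> n ? _; rewrite lee_fin.
  - by move=> ? _ ? ? mn; rewrite lee_fin; exact/lefP/nd_nnsfun_approx.
rewrite (_ : (fun n => \int[nu]_x (f_ n x)%:E)%E =
    (fun n => \int[mu]_x ((f_ n x)%:E * (g x)%:E))%E); last first.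
  by apply/funext => n; exact: integral_density_nnsfun.
rewrite -monotone_convergence//=.
- apply: eq_integral => x _; apply/cvg_lim => //=; apply: cvgeZr => //.
  exact: cvg_nnsfun_approx.
- by move=> n; apply: emeasurable_funM; exact/measurable_EFinP.
- by move=> n x _; rewrite mule_ge0// lee_fin.
- move=> x _ a b ab; rewrite lee_wpmul2r// ?lee_fin//.
  exact/lefP/nd_nnsfun_approx.
Qed.

End Density.

Lemma is_derive_gauss (R : realType) (c k x : R) : k != 0 ->
  is_derive x 1 (fun y => - (k / 2) * (c * expR (- y ^+ 2 / k)))
    (x * (c * expR (- x ^+ 2 / k))).
Proof.
move=> k0; have h : is_derive x 1 (fun y : R => - y ^+ 2 / k) (- (2 * x) / k).
  apply: is_derive_eq; rewrite scaler0 add0r /GRing.scale /= !mulr1.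
  by field.
have h2 := @is_derive1_comp _ expR (fun y => - y ^+ 2 / k) x _ _ (is_derive_expR _) h.
have h3 : is_derive x 1 (fun y => expR (- y ^+ 2 / k)) (- (2 * x) / k * expR (- x ^+ 2 / k)).
  by rewrite mulrC; exact: h2.
apply: is_derive_eq; rewrite /GRing.scale /= ?mulr0 ?addr0 ?scaler0.
by field.
Qed.

Section GaussianMoments.
Variables (R : realType) (sigma : R).
Hypothesis sigma0 : 0 < sigma.
Local Notation pdf := (normal_pdf 0 sigma).
Local Notation leb := (@lebesgue_measure R).
Local Notation P := (normal_prob 0 sigma : probability (measurableTypeR R) R).

Let sn0 : sigma != 0. Proof. by rewrite gt_eqF. Qed.

Lemma normal_pdf_centered : pdf =
  (fun x => normal_peak sigma * expR (- x ^+ 2 / (sigma ^+ 2 *+ 2))).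
Proof.
by rewrite normal_pdfE//; apply/funext => x; rewrite /normal_fun subr0.
Qed.

Lemma is_derive_pdf (x : R) :
  is_derive x 1 (fun x => - sigma ^+ 2 * pdf x) (x * pdf x).
Proof.
have k0 : sigma ^+ 2 *+ 2 != 0 by rewrite mulrn_eq0 expf_eq0.
have h := is_derive_gauss (normal_peak sigma) x k0.
rewrite normal_pdf_centered; move: h; congr (is_derive _ _ _ _).
by apply/funext => y; field.
Qed.

Let J n : set (measurableTypeR R) := `[- n.+1%:R, n.+1%:R]%classic.
Let mJ n : measurable (J n). Proof. exact: measurable_itv. Qed.
Let power_pdf p (x : R) := x ^+ p * pdf x.

Lemma continuous_power_pdf p : continuous (power_pdf p).
Proof.
by move=> x; apply: cvgM; [exact: exprn_continuous|exact: continuous_normal_pdf].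
Qed.

Lemma integrable_power_pdf p n : leb.-integrable (J n) (EFin \o power_pdf p).
Proof.
apply: continuous_compact_integrable; first exact: segment_compact.
by apply: continuous_subspaceT; exact: continuous_power_pdf.
Qed.

(** The fundamental theorem of calculus for x^(j+1) (- sigma^2 pdf), as the derivative of - sigma^2
    pdf is x pdf. A bounded interval is used, so that integrability needs only continuity. *)
Lemma gauss_parts j n :
  \int[leb]_(x in J n) power_pdf j.+2 x =
  - sigma ^+ 2 * (power_pdf j.+1 n.+1%:R - power_pdf j.+1 (- n.+1%:R)) +
  j.+1%:R * sigma ^+ 2 * \int[leb]_(x in J n) power_pdf j x.
Proof.
pose F (x : R) := x ^+ j.+1 * (- sigma ^+ 2 * pdf x).
pose f x := power_pdf j.+2 x - j.+1%:R * sigma ^+ 2 * power_pdf j x.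
have dF (x : R) : is_derive x 1 F (f x).
  have h := is_derive_pdf x.
  have h1 : is_derive x 1 (fun y : R => y ^+ j.+1) (j.+1%:R * x ^+ j).
    apply: DeriveDef; first exact: exprn_derivable.
    by rewrite exp_derive /GRing.scale /= mulr1.
  apply: (is_derive_eq (is_deriveM h1 h)); rewrite /GRing.scale /= /f /power_pdf !exprS. by ring.
have cF : continuous F.
  move=> x; apply: differentiable_continuous; apply/derivable1_diffP.
  by have [] := dF x.
have cf : continuous f.
  move=> x; apply: cvgB; first exact: continuous_power_pdf.
  by apply: cvgM; [exact: cvg_cst|exact: continuous_power_pdf].
have ab : - n.+1%:R < n.+1%:R :> R by rewrite -subr_gt0 opprK addr_gt0.
have /(congr1 fine) : (\int[leb]_(x in J n) (f x)%:E =
    (F n.+1%:R)%:E - (F (- n.+1%:R))%:E)%E.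
  apply: (continuous_FTC2 ab); first exact: continuous_subspaceT.
    split=> [x _||]; first by have [] := dF x.
    + exact/cvg_at_right_filter/cF.
    + exact/cvg_at_left_filter/cF.
  by move=> x _; rewrite derive1E; have [_ ->] := dF x.
rewrite -EFinB /= -[LHS]/(\int[leb]_(x in J n) f x) /f.
rewrite RintegralB//; last 2 first.
- exact: integrable_power_pdf.
- exact: (integrableZl (mJ n) _ (integrable_power_pdf j n)).
rewrite RintegralZl//; last exact: integrable_power_pdf.
move=> /eqP; rewrite subr_eq => /eqP ->; congr (_ + _).
by rewrite /F /power_pdf; ring.
Qed.

Lemma cvg_power_pdf p : power_pdf p n.+1%:R @[n --> \oo] --> (0 : R).
Proof.
have k0 : 0 < sigma ^+ 2 *+ 2 by rewrite pmulrn_lgt0// exprn_gt0.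
(* With N = n + 1 and y = N^2 / (2 sigma^2), exp y >= y^(p+1) / (p+1)! bounds the function by C /
   N^(p+2), hence by C / N. *)
pose C := normal_peak sigma * p.+1`!%:R * (sigma ^+ 2 *+ 2) ^+ p.+1.
have C0 : 0 <= C by rewrite !mulr_ge0// ?normal_peak_ge0// exprn_ge0// ltW.
apply: (@squeeze_cvgr _ _ _ _ (fun=> 0) (fun n => C * n.+1%:R^-1)); last 2 first.
- exact: cvg_cst.
- rewrite -[X in _ --> X](mulr0 C); apply: cvgM; first exact: cvg_cst.
  exact: cvg_harmonic.
near=> n; rewrite /power_pdf mulr_ge0 ?exprn_ge0 ?normal_pdf_ge0//=.
have y0 : 0 < n.+1%:R ^+ 2 / (sigma ^+ 2 *+ 2) :> R by rewrite divr_gt0// exprn_gt0.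
have := expR_ge1Dxn p (ltW y0); rewrite normal_pdf_centered mulNr expRN.
set E := expR _; set y := n.+1%:R ^+ 2 / _ in y0 *; move=> hE.
have f0 : 0 < p.+1`!%:R :> R by rewrite ltr0n fact_gt0.
have yE : y ^+ p.+1 / p.+1`!%:R <= E by apply: le_trans hE; rewrite lerDr.
have yp : 0 < y ^+ p.+1 / p.+1`!%:R by rewrite divr_gt0// exprn_gt0.
rewrite mulrCA.
apply: (@le_trans _ _ (normal_peak sigma * (n.+1%:R ^+ p * (y ^+ p.+1 / p.+1`!%:R)^-1))).
  rewrite ler_wpM2l ?normal_peak_ge0// ler_wpM2l ?exprn_ge0//.
  by rewrite lef_pV2// posrE (lt_le_trans yp).
have N0 : 0 < n.+1%:R :> R by rewrite ltr0n.
have -> : normal_peak sigma * (n.+1%:R ^+ p * (y ^+ p.+1 / p.+1`!%:R)^-1) =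
    C / n.+1%:R * n.+1%:R^-1 ^+ p.+1.
  rewrite /C /y; move: (p.+1`!%:R) f0 (n.+1%:R : R) N0.
  move: (sigma ^+ 2 *+ 2) k0 (normal_peak sigma) => kk kk0 c {}f f0 N N0.
  rewrite expr_div_n -exprM mul2n -addnn exprD exprVn !exprS.
  by field; rewrite !expf_eq0 !gt_eqF// !andbF.
apply: ler_piMr; first by rewrite mulr_ge0// invr_ge0.
by apply: exprn_ile1; rewrite ?invr_ge0// invf_le1// ler1n.
Unshelve. all: by end_near. Qed.

Let pdfN x : pdf (- x) = pdf x.
Proof. by rewrite normal_pdf_centered sqrrN. Qed.

Let powN_pdf j x : power_pdf j.*2.+1 (- x) = - power_pdf j.*2.+1 x.
Proof.
rewrite /power_pdf pdfN -mulNr; congr (_ * _).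
by rewrite exprNn -signr_odd /= odd_double expr1 mulN1r.
Qed.

Let even_ge0 j x : 0 <= power_pdf j.*2 x.
Proof. by rewrite mulr_ge0 ?normal_pdf_ge0// -mul2n exprM exprn_ge0// sqr_ge0. Qed.

Let bigcup_J : \bigcup_n J n = setT.
Proof.
apply/seteqP; split=> // x _; exists (Num.truncn `|x|) => //.
rewrite /J /= in_itv /= -ler_norml; apply: ltW; exact: truncnS_gt.
Qed.

Let cvg_J j : (\int[leb]_(x in J n) (power_pdf j.*2 x)%:E @[n --> \oo] -->
  \int[leb]_x (power_pdf j.*2 x)%:E)%E.
Proof.
rewrite -bigcup_J; apply: ge0_nondecreasing_set_cvg_integral => //.
- move=> a b ab; rewrite subsetEset => x; rewrite /J /= !in_itv /= => /andP[h1 h2].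
  have ab' : a.+1%:R <= b.+1%:R :> R by rewrite ler_nat ltnS.
  by rewrite (le_trans _ h1) ?lerN2//= (le_trans h2).
- move=> n; apply/measurable_EFinP; apply: measurable_funTS.
  by apply: continuous_measurable_fun; exact: continuous_power_pdf.
- by move=> n x _; rewrite lee_fin even_ge0.
Qed.

(** (2j-1)!! sigma^(2j). *)
Definition even_moment j : R := \prod_(i < j) (i.*2.+1%:R * sigma ^+ 2).

(** Even powers are nonnegative, so the integrals over the growing intervals converge to the full
    one. The boundary terms tend to 0, and each step leaves the factor (2j+1) sigma^2. *)
Lemma gauss_even_integral j :
  (\int[leb]_x (power_pdf j.*2 x)%:E = (even_moment j)%:E)%E.
Proof.
have IJ i n : (\int[leb]_(x in J n) (power_pdf i x)%:E =
    (\int[leb]_(x in J n) power_pdf i x)%:E)%E.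
  by rewrite fineK//; apply: integrable_fin_num (integrable_power_pdf i n).
elim: j => [|j IH].
  rewrite /even_moment big_ord0 -(integral_normal_pdf 0 sigma).
  by apply: eq_integral => x _; rewrite /power_pdf expr0 mul1r.
rewrite -(cvg_lim _ (@cvg_J j.+1))//; apply: cvg_lim => //.
under eq_fun do rewrite IJ; apply/fine_cvgP; split; first exact: nearW.
rewrite /= (_ : fine \o _ = fun n => - sigma ^+ 2 * (2 * power_pdf j.*2.+1 n.+1%:R) +
  j.*2.+1%:R * sigma ^+ 2 * \int[leb]_(x in J n) power_pdf j.*2 x); last first.
  by apply/funext => n; rewrite /= gauss_parts powN_pdf; congr (_ + _); ring.
rewrite /even_moment big_ord_recr/= -/(even_moment j) (mulrC (even_moment j)) -[X in _ --> X]add0r.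
apply: cvgD.
  rewrite -[X in _ --> X](mulr0 (- sigma ^+ 2)) -[X in _ * X](mulr0 2).
  apply: cvgM; first exact: cvg_cst.
  by apply: cvgM; [exact: cvg_cst|exact: cvg_power_pdf].
apply: cvgM; first exact: cvg_cst.
have := @cvg_J j; rewrite IH.
by under eq_fun do rewrite IJ; move/fine_cvgP => [_].
Qed.

Lemma normal_even_moment j :
  (\int[P]_x (x ^+ j.*2)%:E = (even_moment j)%:E)%E.
Proof.
rewrite -gauss_even_integral.
rewrite (@integral_density _ _ _ leb P pdf)//.
- exact: measurable_normal_pdf.
- exact: normal_pdf_ge0.
- by apply/measurable_EFinP; exact: measurable_funX.
- by move=> x; rewrite lee_fin -mul2n exprM exprn_ge0// sqr_ge0.
Qed.

Lemma normal_summ_pow k : summ P (fun x => x ^+ k).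
Proof.
have mX i : measurable_fun setT (fun x : measurableTypeR R => x ^+ i : R).
  exact: measurable_funX.
have sE j : summ P (fun x => x ^+ j.*2).
  apply/integrableP; split; first exact/measurable_EFinP.
  rewrite (eq_integral (fun x : measurableTypeR R => ((x : R) ^+ j.*2)%:E)) => [|x _].
    by rewrite normal_even_moment ltry.
  by rewrite /= ger0_norm// -mul2n exprM exprn_ge0// sqr_ge0.
apply: (@summ_le _ _ _ P _ (fun x : R => 1 + x ^+ k.*2)) => //; last first.
  by apply: summD => //; exact: summ_cst.
move=> x; rewrite [leRHS]ger0_norm ?norm_pow_le//.
by rewrite (le_trans _ (norm_pow_le x k)).
Qed.

Lemma normal_expect_even j : \int[P]_x (x ^+ j.*2) = even_moment j.
Proof. by rewrite /Rintegral normal_even_moment. Qed.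

End GaussianMoments.

(** Let M_m(f) be the sum with an extra weight f(i). By the symmetry i <-> m - i, (m+1) M_(m+1)(1) =
    2 M_(m+1)(i). Absorbing i into the binomial and using [eS] gives M_(m+1)(i) = (m+1) c M_m(2i+1),
    and symmetry again gives M_m(2i+1) = (m+1) M_m(1). *)
Lemma binomial_convolution (R : realFieldType) (e : nat -> R) (c : R) :
  e 0%N = 1 -> (forall j, e j.+1 = j.*2.+1%:R * c * e j) ->
  forall m, \sum_(i < m.+1) 'C(m, i)%:R * (e (m - i)%N * e i) = m`!%:R * (2 * c) ^+ m.
Proof.
move=> e0 eS; pose M m (f : nat -> R) := \sum_(i < m.+1) f i * ('C(m, i)%:R * (e (m - i)%N * e i)).
have Mrev m f : M m f = M m (fun i => f (m - i)%N).
  rewrite /M (reindex_inj rev_ord_inj) /=; apply: eq_bigr => i _.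
  have im : (i <= m)%N by rewrite -ltnS.
  by rewrite subSS bin_sub// subKn// [e i * _]mulrC.
have MD m f g : M m (fun i => f i + g i) = M m f + M m g.
  by rewrite -big_split; apply: eq_bigr => i _; rewrite mulrDl.
have MZ m d f : M m (fun i => d * f i) = d * M m f.
  by rewrite /M mulr_sumr; apply: eq_bigr => i _; rewrite -mulrA.
have Meq m f g : (forall i, (i <= m)%N -> f i = g i) -> M m f = M m g.
  by move=> fg; apply: eq_bigr => i _; rewrite fg// -ltnS.
suff H m : M m (fun=> 1) = m`!%:R * (2 * c) ^+ m.
  by move=> m; rewrite -H; apply: eq_bigr => i _; rewrite mul1r.
elim: m => [|m IH]; first by rewrite /M big_ord1 bin0 subnn e0 fact0 expr0 !mulr1.
have n0 : m.+1%:R != 0 :> R by rewrite pnatr_eq0.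
apply: (mulfI n0).
have -> : m.+1%:R * M m.+1 (fun=> 1) = 2 * M m.+1 (fun i => i%:R).
  rewrite [RHS]mulr_natl mulr2n [X in _ = _ + X]Mrev -MD -MZ.
  by apply: Meq => i im; rewrite mulr1 -natrD subnKC.
have -> : M m.+1 (fun i => i%:R) = m.+1%:R * c * M m (fun i => i.*2.+1%:R).
  rewrite /M big_ord_recl /= mul0r add0r mulr_sumr; apply: eq_bigr => i _.
  rewrite /= /bump add1n subSS eS.
  have := mul_bin_diag m.+1 i; rewrite -[m.+1.-1]/m => /(congr1 (fun n => n%:R : R)).
  rewrite !natrM => h.
  by rewrite mulrA -h; ring.
have -> : M m (fun i => i.*2.+1%:R) = m.+1%:R * M m (fun=> 1).
  have h : 2 * M m (fun i => i.*2.+1%:R) = 2 * (m.+1%:R * M m (fun=> 1)).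
    rewrite [LHS]mulr_natl mulr2n [X in _ + X = _]Mrev -MD -!MZ.
    apply: Meq => i im; rewrite mulr1 -natrD -natrM; congr _%:R.
    lia.
  by apply: mulfI h; rewrite pnatr_eq0.
by rewrite IH factS natrM exprS; ring.
Qed.

Lemma gaussian_moment (R : realType) (t : R) m : 0 < t ->
  summ (complex_gaussian t) (fun z => modulus z ^+ m.*2) /\
  \int[complex_gaussian t]_z (modulus z ^+ m.*2) = m`!%:R * t ^+ m.
Proof.
move=> t0; have t20 : 0 < t / 2 by rewrite divr_gt0.
set sigma := Num.sqrt (t / 2); have s0 : 0 < sigma by rewrite sqrtr_gt0.
have sE : sigma ^+ 2 = t / 2 by rewrite sqr_sqrtr// ltW.
pose P : probability (measurableTypeR R) R := normal_prob 0 sigma.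
have -> : complex_gaussian t = (P \x P)%E :> probability _ R by [].
pose f i (z : measurableTypeR R * measurableTypeR R) : R :=
  'C(m, i)%:R * (z.1 ^+ (m - i).*2 * z.2 ^+ i.*2).
have E : (fun z : measurableTypeR R * measurableTypeR R => modulus z ^+ m.*2 : R) =
    (fun z => \sum_(i < m.+1) f i z).
  apply/funext => z.
  rewrite -mul2n exprM /modulus sqr_sqrtr ?addr_ge0 ?sqr_ge0// exprDn.
  by apply: eq_bigr => i _; rewrite /f mulr_natl -!exprM !mul2n.
have sp i := summ_prod (normal_summ_pow s0 (m - i).*2) (normal_summ_pow s0 i.*2).
have sf i : summ (P \x P : probability _ R)%E (f i).
  by apply: summZ; exact: sp.
split; first by rewrite E; apply: summ_sum => i _; exact: sf.
rewrite E expect_sum => [|i _]; last exact: sf.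
rewrite -[t](_ : 2 * (t / 2) = _); last by field.
rewrite -sE -(@binomial_convolution _ (even_moment sigma)) => [||j].
- apply: eq_bigr => i _; rewrite expectZ; last exact: sp.
  rewrite (expect_prod (normal_summ_pow s0 (m - i).*2) (normal_summ_pow s0 i.*2)).
  by rewrite !normal_expect_even.
- by rewrite /even_moment big_ord0.
- by rewrite {1}/even_moment big_ord_recr /= mulrC.
Qed.

(** * Moments of the symmetrized squeezed law *)

Section Symmetrization.
Variables (R : realType) (mu : probability (measurableTypeR R * measurableTypeR R)%type R).
Variable c : nat -> R.
Hypothesis mu_moment : forall m, summ mu (fun z => modulus z ^+ m.*2) /\
  \int[mu]_z (modulus z ^+ m.*2) = c m.

Let B : probability bool R := bernoulli_prob (2^-1 : R).
Let sign (b : bool) : R := if b then 1 else -1.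

Let mX k : measurable_fun setT (fun x : measurableTypeR R => (x : R) ^+ k).
Proof. exact: measurable_funX. Qed.

Lemma summ_squeezed k : summ (squeezed mu) (fun x : R => x ^+ k).
Proof.
apply: summ_distribution => //.
apply: (@summ_le _ _ _ mu _ (fun z => 1 + (modulus z : R) ^+ k.*2)).
- by apply: measurableT_comp (mX k) _.
- move=> z; rewrite [leRHS]ger0_norm ?norm_pow_le//.
  by rewrite (le_trans _ (norm_pow_le _ k)).
- by apply: summD; [exact: summ_cst|have [] := mu_moment k].
Qed.

Let summ_sign : summ B sign.
Proof.
apply: (@summ_le _ _ _ _ _ (fun=> 1)) => //; last exact: summ_cst.
by case; rewrite /sign ?normrN normr1.
Qed.

Let expect_sign : \int[B]_b sign b = 0.
Proof.
have p01 : 0 <= (2^-1 : R) <= 1 by rewrite invr_ge0 ler0n invf_le1 ?ler1n.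
have s2 : summ B (fun b => sign b + 1) by apply: summD => //; exact: summ_cst.
(* The Bernoulli integral formula is applied to a nonnegative function, hence the shift by 1. *)
have : \int[B]_b (sign b + 1) = 1.
  rewrite /Rintegral integral_bernoulli_prob//=; last by case; rewrite lee_fin /sign ?addNr.
  by rewrite /= ?/sign /unstable.onem; field.
rewrite expectD//; last exact: summ_cst.
by rewrite expect_cst => h; apply: (@addIr _ 1); rewrite add0r.
Qed.

Let pow_sign k (x : R) b :
  (if b then x else - x) ^+ k = x ^+ k * (if odd k then sign b else 1).
Proof.
rewrite /sign; case: b; first by rewrite if_same mulr1.
by rewrite exprNn -signr_odd mulrC; case: (odd k).
Qed.

Lemma symmetrized_moments k :
  summ (symmetrized (squeezed mu)) (fun x : R => x ^+ k) /\
  \int[symmetrized (squeezed mu)]_x ((x : R) ^+ k) = if odd k then 0 else c k./2.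
Proof.
have E : (fun x : measurableTypeR R => (x : R) ^+ k) \o @apply_sign R =
    (fun p => (p.1 : R) ^+ k * (if odd k then sign p.2 else 1)).
  by apply/funext => -[x b]; exact: pow_sign.
pose f b : R := if odd k then sign b else 1.
have sf : summ B f by rewrite /f; case: (odd k); [exact: summ_sign|exact: summ_cst].
have sE : summ (squeezed mu \x B : probability _ R)%E
    ((fun x : measurableTypeR R => (x : R) ^+ k) \o @apply_sign R).
  by rewrite E; exact: (summ_prod (summ_squeezed k) sf).
split; first by apply: summ_distribution.
rewrite [LHS](expect_distribution (mX k) sE).
rewrite (_ : \int[_]_x _ =
    \int[(squeezed mu \x B : probability _ R)%E]_p ((p.1 : R) ^+ k * f p.2)); last first.
  by apply: eq_Rintegral => p _; exact: (congr1 (fun g => g p) E).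
rewrite (expect_prod (summ_squeezed k) sf) /f.
have [ok|ok] := boolP (odd k); first by rewrite expect_sign mulr0.
have [sm mm] := mu_moment k./2; rewrite even_halfK// in sm mm.
by rewrite expect_cst mulr1 (expect_distribution (mX k)).
Qed.

End Symmetrization.

(** * Moments through the weak limit for s = oo *)

Section WeakLimit.
Variables (R : realType) (t : R).
Hypothesis t0 : 0 < t.
Local Notation Pl := (measurableTypeR R * measurableTypeR R)%type.
Variable mu : probability Pl R.
Hypothesis mu_bessel : cvg_weakly (fun s => bessel s t) mu.

(** A block has at most m places of each parity, so for s > m congruence modulo s is equality: the
    moment of order 2m is eventually constant in s. *)
Lemma bessel_moment_large s m : (m < s)%N -> bessel_moment t s m = bessel_moment t 0 m.
Proof.
move=> ms; apply: eq_bigl => P; congr (_ && _).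
apply: eq_forallb_in => B _; rewrite /block_balanced.
have le (b : bool) : (#|[pred p in B | p.2 == b]| <= m)%N.
  have fI : injective (fun i : 'I_m => (i, b)) by move=> x y [].
  rewrite -[X in (_ <= X)%N]card_ord -(fintype.card_image fI).
  apply: subset_leq_card; apply/fintype.subsetP => -[i c]; rewrite !inE => /andP[_ /eqP/= ->].
  exact: fintype.image_f.
have e0 : #|[pred p in B | ~~ p.2]| = #|[pred p in B | p.2 == false]|.
  by apply: eq_card => p; rewrite !inE; case: p.2.
have e1 : #|[pred p in B | p.2]| = #|[pred p in B | p.2 == true]|.
  by apply: eq_card => p; rewrite !inE; case: p.2.
rewrite e0 e1 !modn0 !modn_small//; exact: leq_ltn_trans (le _) ms.
Qed.

Section Truncation.
Variable m : nat.
Local Notation g := (fun z : Pl => modulus z ^+ m.*2 : R).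
Local Notation gM M := (fun z : Pl => Num.min (modulus z ^+ m.*2) M : R).
Local Notation c k := (bessel_moment t 0 k).

Let g0 z : 0 <= g z. Proof. by rewrite exprn_ge0// sqrtr_ge0. Qed.

Let continuous_g : continuous (g : R * R -> R).
Proof.
have cX n : continuous (fun x : R => x ^+ n) by exact: exprn_continuous.
have c2 : continuous (fun z : R * R => z.1 ^+ 2 + z.2 ^+ 2 : R).
  move=> z; apply: cvgD.
    exact: (continuous_comp (f := fst) (g := fun x : R => x ^+ 2) cvg_fst (cX 2%N _)).
  exact: (continuous_comp (f := snd) (g := fun x : R => x ^+ 2) cvg_snd (cX 2%N _)).
have c1 : continuous (@modulus R : R * R -> R).
  move=> z; exact: (continuous_comp (c2 z) (@sqrt_continuous _ _)).
by move=> z; exact: (continuous_comp (c1 z) (cX m.*2 _)).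
Qed.

Let mg : measurable_fun setT g.
Proof. by apply: measurable_funX; exact: measurable_modulus. Qed.

Let mgM M : measurable_fun setT (gM M).
Proof. by apply: measurable_minr => //; exact: measurable_cst. Qed.

Let gM_bound M z : 0 <= M -> `|gM M z| <= M.
Proof. by move=> M0; rewrite ger0_norm ?ge_min ?lexx ?orbT// le_min g0. Qed.

Let summ_gM (P : probability Pl R) M : 0 <= M -> summ P (gM M).
Proof.
move=> M0; apply: (@summ_le _ _ _ P _ (fun=> M)) => //; last exact: summ_cst.
by move=> z; rewrite [leRHS]ger0_norm//; exact: gM_bound.
Qed.

(* x - min x M <= x ^ 2 / M *)
Let bessel_bounds M s : 0 < M -> (m.*2 < s)%N ->
  c m - c m.*2 / M <= \int[bessel s t]_z gM M z <= c m.
Proof.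
move=> M0 ms.
have s0 : (0 < s)%N by apply: leq_ltn_trans ms.
have [a1 b1] := bessel_moments m s0 t0; have [s1 e1] := modulus_moment a1 b1.
have [a2 b2] := bessel_moments m.*2 s0 t0; have [s2 e2] := modulus_moment a2 b2.
rewrite bessel_moment_large in e1; last by lia.
rewrite bessel_moment_large in e2; last by [].
have sM := summ_gM (bessel s t) (ltW M0).
rewrite -e1 -e2; apply/andP; split; last first.
  by apply: le_Rintegral => // z _; rewrite ge_min lexx.
rewrite mulrC lerBlDr -expectZ// -expectD//; last exact: summZ.
apply: le_Rintegral => //; first by apply: summD => //; exact: summZ.
move=> z _; rewrite -[m.*2.*2]muln2 exprM.
have := g0 z; set x := g z => x0; have [xM|Mx] := leP x M.
  by rewrite lerDl mulr_ge0 ?invr_ge0 ?sqr_ge0// ltW.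
apply: (@le_trans _ _ (M^-1 * (M * x))); first by rewrite mulKf// gt_eqF.
apply: (@le_trans _ _ (M^-1 * x ^+ 2)); last by rewrite lerDr ltW.
by rewrite ler_pM2l ?invr_gt0// expr2 ler_wpM2r// ltW.
Qed.

Let mu_bounds M : 0 < M -> c m - c m.*2 / M <= \int[mu]_z gM M z <= c m.
Proof.
move=> M0; have /mu_bessel h : continuous (gM M : R * R -> R).
  apply: min_fun_continuous; first exact: continuous_g.
  by move=> ?; exact: cvg_cst.
have {}h := h (ex_intro _ M (fun z => gM_bound z (ltW M0))).
have near_bound : \forall s \near \oo,
    c m - c m.*2 / M <= \int[bessel s t]_z gM M z <= c m.
  by near=> s; apply: bessel_bounds => //; near: s; exact: nbhs_infty_gt.
rewrite -(cvg_lim _ h)//; apply/andP; split.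
  apply: limr_ge; first by apply: cvgP h.
  by apply: filterS near_bound => s /andP[].
apply: limr_le; first by apply: cvgP h.
by apply: filterS near_bound => s /andP[].
Unshelve. all: by end_near. Qed.

(** The truncations are bounded and continuous, so their bounds, uniform in large s thanks to the
    moment of order 4m, pass to [mu]. Monotone convergence in the truncation level then yields both
    integrability and the value. *)
Lemma weak_limit_moment :
  summ mu g /\ \int[mu]_z g z = c m.
Proof.
have gn0 n z : 0 <= gM n.+1%:R z by rewrite le_min g0 /=.
have eI n : (\int[mu]_z (gM n.+1%:R z)%:E = (\int[mu]_z gM n.+1%:R z)%:E)%E.
  rewrite fineK//; apply: integrable_fin_num => //; exact: summ_gM.
have cI : (\int[mu]_z (gM n.+1%:R z)%:E @[n --> \oo] --> (c m)%:E)%E.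
  under eq_fun do rewrite eI; apply: cvg_EFin; first exact: nearW.
  apply: (@squeeze_cvgr _ _ _ _ (fun n => c m - c m.*2 * n.+1%:R^-1) (fun=> c m)).
  - by apply: nearW => n; exact: mu_bounds.
  - rewrite -[X in _ --> X]subr0 -[X in _ - X](mulr0 (c m.*2)).
    apply: cvgB; first exact: cvg_cst.
    by apply: cvgM; [exact: cvg_cst|exact: cvg_harmonic].
  - exact: cvg_cst.
have E : (\int[mu]_z (g z)%:E = (c m)%:E)%E.
  rewrite -(cvg_lim _ cI)// -monotone_convergence//=.
  - apply: eq_integral => z _; apply/esym/cvg_lim => //.
    apply: cvg_near_cst; apply: filterS (nbhs_infty_ger (g z)) => n gn.
    by congr EFin; apply/min_idPl/(le_trans gn); rewrite ler_nat.
  - by move=> n; apply/measurable_EFinP; exact: mgM.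
  - by move=> n z _; rewrite lee_fin.
  - move=> z _ a b ab; rewrite lee_fin le_min ge_min lexx /=.
    by rewrite ge_min ler_nat ltnS ab orbT.
split; last by rewrite /Rintegral E.
apply/integrableP; split; first exact/measurable_EFinP.
rewrite (eq_integral (fun z => (g z)%:E)) => [|z _]; first by rewrite E ltry.
by rewrite /= ger0_norm.
Qed.
End Truncation.
End WeakLimit.

(** * Comparison of the moments and conclusion *)

Section AsymptoticLaw.
Variables (R : realType) (A : nat -> cstarAlg R) (h : forall n, {scalar (A n)}).
Variable a : forall n, A n.
Variable mu : probability (measurableTypeR R * measurableTypeR R)%type R.
Variable c : nat -> R.
Local Notation K := (R[i]%C : numFieldType).

Lemma symmetrized_asymptotic_law :
  (forall m, summ mu (fun z => modulus z ^+ m.*2) /\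
     \int[mu]_z (modulus z ^+ m.*2) = c m) ->
  (forall m, (h n (a n ^+ m.*2) : K) @[n --> \oo] --> ((c m)%:C%C : K)) ->
  (forall n k, odd k -> h n (a n ^+ k) = 0) ->
  asymptotic_law h a (symmetrized (squeezed mu)).
Proof.
move=> mu_moment even_cvg odd0 k.
have [sk ->] := symmetrized_moments mu_moment k; split=> //.
have [ok|ok] := boolP (odd k).
  by under eq_fun do rewrite odd0//; exact: cvg_cst.
by have := even_cvg k./2; rewrite even_halfK.
Qed.

End AsymptoticLaw.

Theorem theorem7p6 (R : realType) (t : R) (t_gt0 : 0 < t) (t_le1 : t <= 1) :
  (forall (A : nat -> cstarAlg R) (u : forall n, 'M[A n]_n)
      (h : forall n, {scalar (A n)}),
    (forall n, is_universal (@Ostar_rel R n) (u n)) ->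
    (forall n, is_Haar (u n) (h n)) ->
    asymptotic_law h (fun n => truncated_char (u n) t)
      (symmetrized (squeezed (complex_gaussian t)))) /\
  (forall (s : option nat) (s_ge2 : if s is Some m then (2 <= m)%N else true)
      (A : nat -> cstarAlg R) (u : forall n, 'M[A n]_n)
      (h : forall n, {scalar (A n)}),
    (forall n, is_universal (@H_rel R n s) (u n)) ->
    (forall n, is_Haar (u n) (h n)) ->
    forall mu, is_bessel s t mu ->
    asymptotic_law h (fun n => truncated_char (u n) t)
      (symmetrized (squeezed mu))).
Proof.
have t01 : 0 <= t <= 1 by rewrite ltW.
split=> [A u h uU uH|s s_ge2 A u h uU uH mu mu_bessel].
  apply: (symmetrized_asymptotic_law (c := fun m => m`!%:R * t ^+ m)) => [m|m|n k].
  - exact: gaussian_moment.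
  - exact: cvg_ortho_moment.
  - apply: (Haar_char_odd t uH (rel := @Ostar_rel R) (uU n)); apply: model_Ostar.
    by apply: monomial_unitary => j; rewrite rmorph1 mulr1.
apply: (symmetrized_asymptotic_law (c := bessel_moment t (modulus_of s))) => [m|m|n k].
- case: s s_ge2 mu_bessel {uU} => [s s_ge2 ->|_ mu_bessel].
    have [b1 b2] := bessel_moments m (ltnW s_ge2) t_gt0.
    exact: modulus_moment b1 b2.
  exact: weak_limit_moment.
- exact: cvg_hyper_moment.
- by apply: (Haar_char_odd t uH (rel := fun n => @H_rel R n s) (uU n)); exact: rel_perm.
Qed.
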